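(* Let $(M^{2n},h,\omega,J)$ be an almost Kähler manifold, $L^n\subset M$ a compact embedded Lagrangian submanifold, and $\Psi:U\subset T^*L\to V\subset M$ a Weinstein Lagrangian neighborhood map of $L$. Let $\varphi(x,t)$ be a smooth function on $L\times[0,\delta)$ with $\varphi(\cdot,0)=0$, and let $F(x,t)=\Psi(x,d\varphi(x,t))$. Suppose that $d\varphi(x,t)$ is an exact section describing, through $F$, an evolution of Lagrangian submanifolds which satisfy the equation $$\left(\frac{dF}{dt}\right)^{\perp}=J\nabla\operatorname{div}(JH).$$ Then there is a function $G$ (depending on $\Psi$) such that $\varphi$ satisfies $$\frac{\partial\varphi}{\partial t}=-g^{ap}g^{ij}\frac{\partial^4\varphi}{\partial x^a\partial x^j\partial x^i\partial x^p}+G(x,D\varphi,D^2\varphi,D^3\varphi).$$ The coordinate free expression is $$\frac{\partial\varphi}{\partial t}=\operatorname{div}\big(J\Delta_g\Psi(x,d\varphi)\big).$$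
   Context: Almost Kähler means: $\omega$ is a symplectic form, $J$ an almost complex structure and $h$ a compatible Riemannian metric with $h(JV,W)=\omega(V,W)$. A Weinstein Lagrangian neighborhood map is a diffeomorphism $\Psi$ from a neighborhood $U\subset T^*L$ of the zero section (identified with $L$) onto a neighborhood $V\subset M$ of $L$ with $\Psi^*\omega=d\lambda_{can}$ (the canonical symplectic form, $dx\wedge dv$ in coordinates $(x,v)$ on $T^*L$) and with $\Psi$ restricting to the identity on $L$. For each $t$, $d\varphi(\cdot,t)$ is an exact 1-form on $L$, viewed as a section of $T^*L$ with graph in $U$, and $L_t=F(\cdot,t)(L)$ is the corresponding Lagrangian submanifold of $M$. Here $x=(x^1,\dots,x^n)$ are local coordinates on $L$; $g=g(t)$ is the metric induced by $h$ via $F(\cdot,t)$ and $(g^{ij})$ is its inverse in these coordinates; $H$ is the mean curvature vector of $L_t$ in $M$; $\nabla$ and $\operatorname{div}$ are taken along $L_t$ with respect to $g$ (since $L_t$ is Lagrangian, $JH$ is tangent to $L_t$); $\perp$ is the projection to the normal space of $L_t$. $\Delta_g\Psi(x,d\varphi)$ is the Laplacian (tension field) of the map $x\mapsto\Psi(x,d\varphi(x,t))$ from $(L,g)$ to $(M,h)$, which equals $H$. $D^m\varphi$ denotes the coordinate partial derivatives of order $m$ in $x$, and repeated indices are summed.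
   Formalization: The hypotheses determine φ only up to adding a function of t on each component of L (φ=t on a stationary flat L violates the claim), so both equations are proved for some smooth φ' with φ'(·,0)=0 and dφ'=dφ, hence the same F, in place of φ. *)

(* Defs.v *)
From HB Require Import structures.
From mathcomp Require Import all_boot all_order all_algebra.
From mathcomp Require Import all_classical all_reals all_analysis.
Set Implicit Arguments.
Unset Strict Implicit.
Unset Printing Implicit Defensive.
Import Order.TTheory GRing.Theory Num.Theory.
Import numFieldNormedType.Exports.
Local Open Scope classical_set_scope.
Local Open Scope ring_scope.

(* Vectors are rows and linear maps act on the right, so
   that row i of the Jacobian 'J f x is the partial derivative of f in the
   direction of the i-th coordinate. *)

Section Calculus.
Context {R : realType}.

Fixpoint Ck {V W : normedModType R} (k : nat) (A : set V) (f : V -> W) : Prop :=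
  match k with
  | 0%N => forall x, A x -> {for x, continuous f}
  | k'.+1 => (forall x, A x -> differentiable f x) /\
             (forall v, Ck k' A ('D_v f))
  end.

(* Used only for open A. *)
Definition smooth_on {V W : normedModType R} (A : set V) (f : V -> W) : Prop :=
  forall k, Ck k A f.

Definition pd {n : nat} {W : normedModType R} (i : 'I_n) (f : 'rV[R]_n -> W)
  (x : 'rV[R]_n) : W := 'D_(delta_mx 0 i) f x.

(* The derivative at t of a function on [0, delta[; one-sided at t = 0. *)
Definition dt {W : normedModType R} (delta : R) (f : R -> W) (t : R) : W :=
  lim ((fun s => (s - t)^-1 *: (f s - f t)) @ within `[0, delta[ t^').

Definition bilin {n : nat} (B : 'M[R]_n) (v w : 'rV[R]_n) : R :=
  (v *m B *m w^T) 0 0.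

End Calculus.

(* cfun and cinv are only meaningful on cdom and on cimg. *)
Record chart (R : realType) (n : nat) (M : topologicalType) := Chart {
  cdom : set M;
  cfun : M -> 'rV[R]_n;
  cinv : 'rV[R]_n -> M }.

Section Charts.
Context {R : realType} {n : nat} {M : topologicalType}.
Implicit Types c : chart R n M.

Definition cimg c : set 'rV[R]_n := cfun c @` cdom c.

Definition is_chart c : Prop :=
  [/\ open (cdom c), open (cimg c),
      forall p, cdom c p -> cinv c (cfun c p) = p,
      forall p, cdom c p -> {for p, continuous (cfun c)}
    & forall x, cimg c x -> {for x, continuous (cinv c)}].

Definition smooth_transition c c' : Prop :=
  smooth_on [set x | cimg c x /\ cdom c' (cinv c x)] (cfun c' \o cinv c).

End Charts.

(* A smooth manifold without boundary, with its maximal atlas.  A chart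
   chart_at p around each point p is singled out in order to represent the
   tangent space at p by 'rV[R]_n, a tangent vector being given by its
   components in chart_at p. *)
Record manifold (R : realType) (n : nat) := Manifold {
  carrier :> topologicalType;
  manifold_hausdorff : hausdorff_space carrier;
  manifold_countable : @second_countable carrier;
  atlas : set (chart R n carrier);
  atlas_chart : forall c, atlas c -> is_chart c;
  atlas_compat : forall c c', atlas c -> atlas c' -> smooth_transition c c';
  atlas_max : forall c, is_chart c ->
    (forall c', atlas c' -> smooth_transition c c' /\ smooth_transition c' c) ->
    atlas c;
  chart_at : carrier -> chart R n carrier;
  chart_at_atlas : forall p, atlas (chart_at p);
  chart_at_dom : forall p, cdom (chart_at p) p }.

Section Tensors.
Context {R : realType} {n : nat} {M : manifold R n}.
Implicit Types c : chart R n M.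

(* Row i is the coordinate vector d/dx^i of the chart c at the point cinv c x,
   written in the representation of the tangent space at that point. *)
Definition frame c (x : 'rV[R]_n) : 'M[R]_n :=
  'J (cfun (chart_at (cinv c x)) \o cinv c) x.

(* Components in the chart c of a field of bilinear forms, and of a field of
   endomorphisms V |-> V *m A, given on the tangent spaces. *)
Definition form_in c (B : M -> 'M[R]_n) (x : 'rV[R]_n) : 'M[R]_n :=
  frame c x *m B (cinv c x) *m (frame c x)^T.

Definition endo_in c (A : M -> 'M[R]_n) (x : 'rV[R]_n) : 'M[R]_n :=
  frame c x *m A (cinv c x) *m invmx (frame c x).

Definition smooth_to {V : normedModType R} (A : set V) (f : V -> M) : Prop :=
  (forall x, A x -> {for x, continuous f}) /\
  (forall c, atlas c ->
     smooth_on [set x | A x /\ cdom c (f x)] (cfun c \o f)).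

End Tensors.

Record almost_kahler (R : realType) (m : nat) (M : manifold R m) :=
  AlmostKahler {
  metric : M -> 'M[R]_m;
  omega : M -> 'M[R]_m;
  acs : M -> 'M[R]_m;
  metric_smooth : forall c i j, atlas c ->
    smooth_on (cimg c) (fun x => form_in c metric x i j);
  omega_smooth : forall c i j, atlas c ->
    smooth_on (cimg c) (fun x => form_in c omega x i j);
  acs_smooth : forall c i j, atlas c ->
    smooth_on (cimg c) (fun x => endo_in c acs x i j);
  metric_sym : forall (p : M) (v w : 'rV[R]_m), bilin (metric p) v w = bilin (metric p) w v;
  metric_pos : forall (p : M) (v : 'rV[R]_m), v != 0 -> 0 < bilin (metric p) v v;
  omega_alt : forall (p : M) (v : 'rV[R]_m), bilin (omega p) v v = 0;
  omega_nondeg : forall (p : M) (v : 'rV[R]_m), (forall w, bilin (omega p) v w = 0) -> v = 0;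
  omega_closed : forall c (x : 'rV[R]_m) (i j k : 'I_m), atlas c -> cimg c x ->
    pd i (fun y => form_in c omega y j k) x +
    pd j (fun y => form_in c omega y k i) x +
    pd k (fun y => form_in c omega y i j) x = 0;
  acs_sqr : forall (p : M) (v : 'rV[R]_m), v *m acs p *m acs p = - v;
  compat : forall (p : M) (v w : 'rV[R]_m), bilin (metric p) (v *m acs p) w = bilin (omega p) v w }.

(* A covector at cbase, given by its values on the basis of the tangent space
   at cbase, that is by its components in chart_at cbase. *)
Record cotangent (R : realType) (n : nat) (L : manifold R n) := Cotangent {
  cbase : L;
  ccomp : 'rV[R]_n }.

Section CotangentBundle.
Context {R : realType} {n : nat} {L : manifold R n}.

(* The coordinates (x, v) that a chart c of L induces on the cotangent bundle,
   where (x, v) stands for the covector v_i dx^i at cinv c x, and the inverse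
   parametrization. *)
Definition cot_fun (c : chart R n L) (xi : cotangent L) :
    'rV[R]_n * 'rV[R]_n :=
  let x := cfun c (cbase xi) in (x, ccomp xi *m (frame c x)^T).

Definition cot_inv (c : chart R n L) (z : 'rV[R]_n * 'rV[R]_n) : cotangent L :=
  Cotangent (cinv c z.1) (z.2 *m (invmx (frame c z.1))^T).

Definition differential (f : L -> R) (p : L) : cotangent L :=
  let c := chart_at p in
  Cotangent p (\row_i pd i (f \o cinv c) (cfun c p)).

Definition cot_img (c : chart R n L) (U : set (cotangent L)) :
    set ('rV[R]_n * 'rV[R]_n) :=
  [set z | cimg c z.1 /\ U (cot_inv c z)].

(* dx /\ dv on pairs of tangent vectors in the coordinates (x, v) *)
Definition can_form (a b : 'rV[R]_n * 'rV[R]_n) : R :=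
  (a.1 *m b.2^T) 0 0 - (a.2 *m b.1^T) 0 0.

End CotangentBundle.

Section Submanifolds.
Context {R : realType} {n m : nat} {L : manifold R n} {M : manifold R m}.
Variable (K : almost_kahler M) (iota : L -> M).

Definition embedding : Prop :=
  [/\ forall c, atlas c -> smooth_to (cimg c) (iota \o cinv c),
      forall c e x, atlas c -> atlas e -> cimg c x -> cdom e (iota (cinv c x)) ->
        row_free ('J (cfun e \o iota \o cinv c) x),
      injective iota
    & forall A : set L, open A -> exists2 B : set M, open B & A = iota @^-1` B].

Definition isotropic : Prop :=
  forall c e x v w, atlas c -> atlas e -> cimg c x -> cdom e (iota (cinv c x)) ->
    let f := cfun e \o iota \o cinv c in
    bilin (form_in e (omega K) (f x)) ('D_v f x) ('D_w f x) = 0.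

(* Lagrangian: isotropic of half the dimension. *)
Definition lagrangian : Prop := m = (2 * n)%N /\ isotropic.

Record weinstein_map := WeinsteinMap {
  wdom : set (cotangent L);
  wcod : set M;
  wfun : cotangent L -> M;
  winv : M -> cotangent L;
  wdom_open : forall c, atlas c -> open (cot_img c wdom);
  wdom_zero : forall p, wdom (Cotangent p 0);
  wcod_open : open wcod;
  wcod_iota : forall p, wcod (iota p);
  wfunP : forall xi, wdom xi -> wcod (wfun xi);
  winvP : forall q, wcod q -> wdom (winv q);
  wfunK : forall xi, wdom xi -> winv (wfun xi) = xi;
  winvK : forall q, wcod q -> wfun (winv q) = q;
  wfun_smooth : forall c, atlas c ->
    smooth_to (cot_img c wdom) (wfun \o cot_inv c);
  winv_smooth : forall c e, atlas c -> atlas e ->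
    let A := [set y | [/\ cimg e y, wcod (cinv e y)
                        & cdom c (cbase (winv (cinv e y)))]] in
    open A /\ smooth_on A (cot_fun c \o winv \o cinv e);
  wfun_zero : forall p, wfun (Cotangent p 0) = iota p;
  wfun_symplectic : forall c e z a b, atlas c -> atlas e ->
    cot_img c wdom z -> cdom e (wfun (cot_inv c z)) ->
    let f := cfun e \o wfun \o cot_inv c in
    bilin (form_in e (omega K) (f z)) ('D_a f z) ('D_b f z) = can_form a b }.

End Submanifolds.

(* Riemannian geometry in local coordinates: h is the matrix of the ambient
   metric and F an immersion. *)
Section LocalGeometry.
Context {R : realType}.

(* christoffel g x l i j is Gamma^l_ij of the Levi-Civita connection of g *)
Definition christoffel {k : nat} (g : 'rV[R]_k -> 'M[R]_k) (x : 'rV[R]_k)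
    (l i j : 'I_k) : R :=
  2^-1 * \sum_s invmx (g x) l s *
    (pd i (fun y => g y j s) x + pd j (fun y => g y i s) x
     - pd s (fun y => g y i j) x).

Definition divergence {k : nat} (g : 'rV[R]_k -> 'M[R]_k)
    (X : 'rV[R]_k -> 'rV[R]_k) (x : 'rV[R]_k) : R :=
  \sum_a (pd a (fun y => X y 0 a) x
          + \sum_b christoffel g x a a b * X x 0 b).

Definition gradient {k : nat} (g : 'rV[R]_k -> 'M[R]_k) (f : 'rV[R]_k -> R)
    (x : 'rV[R]_k) : 'rV[R]_k :=
  (\row_i pd i f x) *m invmx (g x).

Context {n m : nat}.
Variables (h : 'rV[R]_m -> 'M[R]_m) (F : 'rV[R]_n -> 'rV[R]_m).

Definition induced_metric (x : 'rV[R]_n) : 'M[R]_n :=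
  'J F x *m h (F x) *m ('J F x)^T.

(* The ambient covariant derivative of F_j in the direction F_i *)
Definition cov2 (i j : 'I_n) (x : 'rV[R]_n) : 'rV[R]_m :=
  pd i (pd j F) x +
  \row_a \sum_b \sum_c christoffel h (F x) a b c * pd i F x 0 b * pd j F x 0 c.

(* The vector X on the source whose image under dF is the tangential part of
   the ambient vector w at F x *)
Definition tangential (x : 'rV[R]_n) (w : 'rV[R]_m) : 'rV[R]_n :=
  w *m h (F x) *m ('J F x)^T *m invmx (induced_metric x).

Definition normal_part (x : 'rV[R]_n) (w : 'rV[R]_m) : 'rV[R]_m :=
  w - tangential x w *m 'J F x.

(* Trace (not averaged) of the second fundamental form *)
Definition mean_curvature (x : 'rV[R]_n) : 'rV[R]_m :=
  \sum_i \sum_j invmx (induced_metric x) i j *: normal_part x (cov2 i j x).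

(* Tension field of F from the induced metric to h *)
Definition tension (x : 'rV[R]_n) : 'rV[R]_m :=
  \sum_i \sum_j invmx (induced_metric x) i j *:
    (cov2 i j x - \sum_k christoffel induced_metric x k i j *: pd k F x).

(* Divergence with respect to the induced metric of an ambient vector field
   along F that is tangent to F *)
Definition div_along (W : 'rV[R]_n -> 'rV[R]_m) (x : 'rV[R]_n) : R :=
  divergence induced_metric (fun y => tangential y (W y)) x.

End LocalGeometry.

Section Flow.
Context {R : realType} {n m : nat} {L : manifold R n} {M : manifold R m}.

(* Smoothness of phi p t on L x [0, delta[, including the boundary t = 0 *)
Definition smooth_strip (delta : R) (phi : L -> R -> R) : Prop :=
  forall c x0 t0, atlas c -> cimg c x0 -> 0 <= t0 < delta ->
  exists (B : set ('rV[R]_n * R)) (f : 'rV[R]_n * R -> R),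
    [/\ open B, B (x0, t0), smooth_on B f
      & forall x t, B (x, t) -> cimg c x -> 0 <= t < delta ->
          phi (cinv c x) t = f (x, t)].

Variable K : almost_kahler M.

Definition loc_metric (e : chart R m M) := form_in e (metric K).
Definition loc_acs (e : chart R m M) := endo_in e (acs K).

Definition loc (c : chart R n L) (e : chart R m M) (f : L -> M) :
  'rV[R]_n -> 'rV[R]_m := cfun e \o f \o cinv c.

Definition deformation (iota : L -> M) (Psi : weinstein_map K iota)
  (phi : L -> R -> R) (p : L) (t : R) : M :=
  wfun Psi (differential (phi^~ t) p).

Definition div_J_mean_curvature (c : chart R n L) (e : chart R m M)
    (f : L -> M) : 'rV[R]_n -> R :=
  let F := loc c e f in
  div_along (loc_metric e) F
    (fun y => mean_curvature (loc_metric e) F y *m loc_acs e (F y)).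

Definition div_J_tension (c : chart R n L) (e : chart R m M)
    (f : L -> M) : 'rV[R]_n -> R :=
  let F := loc c e f in
  div_along (loc_metric e) F
    (fun y => tension (loc_metric e) F y *m loc_acs e (F y)).

(* (dF/dt)^perp = J grad (div (J H)), written in arbitrary charts c of L and e
   of M *)
Definition flow_equation (delta : R) (F : L -> R -> M) : Prop :=
  forall c e x t, atlas c -> atlas e -> cimg c x -> 0 <= t < delta ->
    cdom e (F (cinv c x) t) ->
    let h := loc_metric e in
    let Ft := loc c e (F^~ t) in
    normal_part h Ft x (dt delta (fun s => cfun e (F (cinv c x) s)) t) =
    gradient (induced_metric h Ft) (div_J_mean_curvature c e (F^~ t)) x
      *m 'J Ft x *m loc_acs e (Ft x).

End Flow.

(* Main.v *)
(* In the coordinates (x, v) the submanifold L_t is the graph v = D phi, and the symplectic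
   normalization of Psi gives omega (Psi_(v^k), F_p) = - delta_kp.  Pairing the flow equation
   with the tangent vectors F_p through omega therefore turns it into
   d (d phi / d t) = d (div (J H)), so that d phi / d t - div (J H) depends on t only on each
   component of L, and phi becomes a solution after subtracting the time integral of this
   difference, which does not change d phi.
   The tangential field J H has components g^(ap) g^(ij) omega (D_i F_j, F_p), where the third
   derivatives of phi enter only through - g^(ap) g^(ij) phi_ijp, so that its divergence is
   - g^(ap) g^(ij) phi_aijp plus a function of the 3-jet of phi.  That div (J H) depends neither
   on the chart of M nor on the chart of L follows from the transformation rules of the
   Levi-Civita connection, and from div X = tr D X + tr (g^-1 D_X g) / 2. *)

Require Import Defs.
From HB Require Import structures.
From mathcomp Require Import all_boot all_order all_algebra.
From mathcomp Require Import all_classical all_reals all_analysis.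
From mathcomp Require Import ring lra.
Set Implicit Arguments.
Unset Strict Implicit.
Unset Printing Implicit Defensive.
Import Order.TTheory GRing.Theory Num.Theory.
Import numFieldNormedType.Exports.
Local Open Scope classical_set_scope.
Local Open Scope ring_scope.

(** * Smooth maps between normed modules *)

Section Differentiability.
Context {R : realType} {V W : normedModType R}.

(** [G] is fixed before [phi] and knows no chart of [M], while the divergence is computed in a chart
    of [M] around the moving point. That point is determined by [x] and [D phi], so [G] can use the
    preferred chart there; invariance under charts of [M] then carries the formula to an arbitrary
    chart [e]. Invariance under charts of [L] serves another purpose: the defect between speed and
    divergence has to be a function on [L] before its time integral can be added to [phi]. To
    separate the orders of differentiation, the Hessian is treated as an independent matrix
    variable. The metric and the remainder of the field become smooth functions on a space of jets,
    and a fourth derivative can only come from the explicit linear third-order term. At time 0 all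
    time derivatives are one-sided. Locally [phi] is therefore replaced by a smooth extension to an
    open set of space-time, where ordinary calculus, including the exchange of time and space
    derivatives, is available; the flow equation itself is only used at times in [[0, delta[]. *)

Lemma near_eq_differentiable (f g : V -> W) (x : V) :
  (\near x, f x = g x) -> differentiable f x -> differentiable g x.
Proof.
move=> fg df.
have dg : g \o shift x = cst (g x) + 'd f x +o_ 0 id.
  apply/eqaddoP => e e0.
  have /eqaddoP/(_ _ e0) H := diff_locally df.
  have fgx : f x = g x := nbhs_singleton fg.
  have fg0 : \forall y \near (0 : V), f (y + x) = g (y + x).
    have := fg; rewrite (near_shift 0 x) => h.
    by apply: filterS h => y /=; rewrite subr0.
  near=> y; rewrite /= !fctE /= -!fgx.
  have fgy : f (y + x) = g (y + x) by near: y.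
  have : `|(f \o shift x - (cst (f x) + 'd f x)) y| <= e * `|y| by near: y.
  by rewrite /= !fctE /= fgy.
apply/diff_locallyP; have c := diff_continuous df.
by rewrite (diff_unique c dg).
Unshelve. all: by end_near. Qed.

Lemma open_near (A : set V) (P : V -> Prop) (x : V) :
  open A -> A x -> (forall y, A y -> P y) -> \near x, P x.
Proof. by move=> oA Ax AP; apply: filterS AP (open_nbhs_nbhs _). Qed.

Lemma linear_derive (l : {linear V -> W}) (x v : V) : continuous l -> 'D_v l x = l v.
Proof.
by move=> cl; rewrite deriveE ?diff_lin//; apply: linear_differentiable.
Qed.

End Differentiability.

Lemma derive_comp {R : realType} {U V W : normedModType R} (f : U -> V) (g : V -> W)
    (x v : U) : differentiable f x -> differentiable g (f x) ->
  'D_v (g \o f) x = 'D_('D_v f x) g (f x).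
Proof.
move=> df dg; rewrite deriveE; last exact: differentiable_comp.
by rewrite diff_comp//= !deriveE.
Qed.

Lemma derive_pair {R : realType} {U V W : normedModType R} (f : U -> V) (g : U -> W)
    (x v : U) : differentiable f x -> differentiable g x ->
  'D_v (fun y => (f y, g y)) x = ('D_v f x, 'D_v g x).
Proof.
move=> df dg; rewrite deriveE; last exact: differentiable_pair.
by rewrite diff_pair//= !deriveE.
Qed.

Lemma derive_linear_comp {R : realType} {U V W : normedModType R} (l : {linear V -> W})
    (f : U -> V) (x v : U) : continuous l -> differentiable f x ->
  'D_v (l \o f) x = l ('D_v f x).
Proof.
move=> cl df; rewrite derive_comp//; first exact: linear_derive.
exact: linear_differentiable.
Qed.

Section SmoothMaps.
Context {R : realType}.
Implicit Types V W U : normedModType R.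

Lemma Ck_differentiable {V W} k (A : set V) (f : V -> W) x :
  Ck k.+1 A f -> A x -> differentiable f x.
Proof. by case=> h _; apply: h. Qed.

Lemma Ck_pred {V W} k (A : set V) (f : V -> W) : Ck k.+1 A f -> Ck k A f.
Proof.
elim: k f => [|k IH] f [df Df]; first by move=> x /df/differentiable_continuous.
by split=> // v; apply: IH; apply: Df.
Qed.

Lemma Ck_sub {V W} k (A B : set V) (f : V -> W) : A `<=` B -> Ck k B f -> Ck k A f.
Proof.
move=> AB; elim: k f => [|k IH] f; first by move=> h x /AB/h.
case=> df Df; split=> [x Ax|v].
  by apply: df; apply: AB.
exact: IH (Df v).
Qed.

Lemma Ck_eq {V W} k (A : set V) (f g : V -> W) :
  open A -> (forall x, A x -> f x = g x) -> Ck k A f -> Ck k A g.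
Proof.
move=> oA; elim: k f g => [|k IH] f g fg; have fgn x (Ax : A x) := open_near oA Ax fg.
  move=> cf x Ax; have cfx : f @ x --> f x by exact: cf.
  have {}cfx : f @ x --> g x by rewrite -fg.
  apply: cvg_trans cfx; apply: near_eq_cvg.
  by apply: filterS (fgn x Ax) => y ->.
case=> df Df; split=> [x Ax|v]; first by apply: near_eq_differentiable (fgn x Ax) (df x Ax).
by apply: IH (Df v) => x Ax; apply: near_eq_derive; apply: fgn.
Qed.

Lemma Ck_cst {V W} k (A : set V) (w : W) : Ck k A (fun=> w).
Proof.
elim: k w => [|k IH] w; first by move=> x _; apply: cvg_cst.
split=> [x _|v]; first exact: differentiable_cst.
rewrite (_ : 'D_v _ = fun=> 0); first exact: IH.
by apply/funext => x; rewrite derive_cst.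
Qed.

Lemma Ck_linear {U V W} k (A : set U) (l : {linear V -> W}) (f : U -> V) :
  open A -> continuous l -> Ck k A f -> Ck k A (l \o f).
Proof.
move=> oA cl; elim: k f => [|k IH] f.
  move=> cf x /cf cfx; apply: continuous_comp.
    exact: cfx.
  exact: (cl (f x)).
case=> df Df; split=> [x Ax|v].
  by apply: differentiable_comp; [exact: df|exact: linear_differentiable].
apply: (@Ck_eq _ _ k _ (l \o 'D_v f)) => // [x Ax|]; last by apply: IH; apply: Df.
by rewrite derive_linear_comp//; apply: df.
Qed.

Lemma Ck_add {V W} k (A : set V) (f g : V -> W) :
  open A -> Ck k A f -> Ck k A g -> Ck k A (fun x => f x + g x).
Proof.
move=> oA; elim: k f g => [|k IH] f g.
  by move=> cf cg x Ax; apply: cvgD; [apply: cf|apply: cg].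
case=> df Df [dg Dg]; split=> [x Ax|v].
  by apply: differentiableD; [exact: df|exact: dg].
apply: (@Ck_eq _ _ k _ (fun x => 'D_v f x + 'D_v g x)) => // [x Ax|];
  last by apply: IH; [apply: Df|apply: Dg].
by rewrite deriveD//; apply: diff_derivable; [exact: df|exact: dg].
Qed.

Lemma Ck_pair {U V W} k (A : set U) (f : U -> V) (g : U -> W) :
  open A -> Ck k A f -> Ck k A g -> Ck k A (fun x => (f x, g x)).
Proof.
move=> oA; elim: k f g => [|k IH] f g.
  by move=> cf cg x Ax; apply: cvg_pair; [apply: cf|apply: cg].
case=> df Df [dg Dg]; split=> [x Ax|v].
  by apply: differentiable_pair; [exact: df|exact: dg].
apply: (@Ck_eq _ _ k _ (fun x => ('D_v f x, 'D_v g x))) => // [x Ax|];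
  last by apply: IH; [apply: Df|apply: Dg].
by rewrite derive_pair//; [exact: df|exact: dg].
Qed.

Lemma Ck_mul {V} k (A : set V) (f g : V -> R) :
  open A -> Ck k A f -> Ck k A g -> Ck k A (fun x => f x * g x).
Proof.
move=> oA; elim: k f g => [|k IH] f g.
  by move=> cf cg x Ax; apply: cvgM; [apply: cf|apply: cg].
move=> Cf Cg; have [df Df] := Cf; have [dg Dg] := Cg; split=> [x Ax|v].
  by apply: differentiableM; [exact: df|exact: dg].
apply: (@Ck_eq _ _ k _ (fun x => f x * 'D_v g x + g x * 'D_v f x)) => // [x Ax|].
  by rewrite deriveM//; apply: diff_derivable; [exact: df|exact: dg].
by apply: Ck_add => //; apply: IH; first [exact: Ck_pred|apply: Df|apply: Dg].
Qed.

Lemma Ck_inv {V} k (A : set V) (f : V -> R) : open A ->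
  (forall x, A x -> f x != 0) -> Ck k A f -> Ck k A (fun x => (f x)^-1).
Proof.
move=> oA f0; elim: k => [|k IH].
  by move=> cf x Ax; apply: cvgV; [exact: f0|apply: cf].
move=> Cf; have [df Df] := Cf; split=> [x Ax|v].
  by apply: differentiableV; [exact: df|exact: f0].
have Ci := IH (Ck_pred Cf).
apply: (@Ck_eq _ _ k _ (fun x => (-1) * ((f x)^-1 * (f x)^-1) * 'D_v f x)) => // [x Ax|].
  rewrite deriveV; [|exact: f0|by apply: diff_derivable; apply: df].
  by rewrite mulN1r -expr2 -exprVn.
apply: Ck_mul (Df v) => //; apply: Ck_mul => //; first exact: Ck_cst.
exact: Ck_mul.
Qed.

Lemma Ck_Zl {V W} k (A : set V) (f : V -> R) (w : W) : open A ->
  Ck k A f -> Ck k A (fun x => f x *: w).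
Proof.
move=> oA; elim: k f => [|k IH] f.
  by move=> cf x Ax; apply: cvgZr_tmp; apply: cf.
case=> df Df; split=> [x Ax|v].
  exact: differentiableZl (df x Ax).
apply: (@Ck_eq _ _ k _ (fun x => 'D_v f x *: w)) => // [x Ax|]; last by apply: IH; apply: Df.
rewrite [RHS]deriveE; last exact: differentiableZl (df x Ax).
by rewrite diffZl ?deriveE//; apply: df.
Qed.

Lemma Ck_sum {V W} k (A : set V) I (r : seq I) (P : pred I) (F : I -> V -> W) :
  open A -> (forall i, Ck k A (F i)) -> Ck k A (fun x => \sum_(i <- r | P i) F i x).
Proof.
move=> oA CF; elim: r => [|i r IH].
  by under eq_fun do rewrite big_nil; apply: Ck_cst.
under eq_fun do rewrite big_cons; case: (P i) => //.
exact: Ck_add.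
Qed.

Lemma Ck_prod {V} k (A : set V) I (r : seq I) (P : pred I) (F : I -> V -> R) :
  open A -> (forall i, Ck k A (F i)) -> Ck k A (fun x => \prod_(i <- r | P i) F i x).
Proof.
move=> oA CF; elim: r => [|i r IH].
  by under eq_fun do rewrite big_nil; apply: Ck_cst.
under eq_fun do rewrite big_cons; case: (P i) => //.
exact: Ck_mul.
Qed.

End SmoothMaps.

(** * Spaces with finitely many continuous coordinates *)

Definition linear_of {R : realType} {V W : normedModType R} (f : V -> W) (fl : linear f) :
  {linear V -> W} := HB.pack f (GRing.isLinear.Build _ _ _ _ _ fl).

(** The chain rule differentiates the outer map in a direction that varies with the point, whereas
    [Ck] only controls derivatives in fixed directions. Expanding the direction in a finite basis
    with continuous coordinates closes the induction in [Ck_comp]. *)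
Definition findim {R : realType} (W : normedModType R) : Prop :=
  exists (I : finType) (b : I -> W) (l : I -> {linear W -> R}),
    (forall i, continuous (l i)) /\ forall w, w = \sum_i l i w *: b i.

Section FiniteDimension.
Context {R : realType}.

Lemma coord_is_linear m n i j : linear (fun A : 'M[R]_(m, n) => A i j).
Proof. by move=> a A B; rewrite !mxE. Qed.

Lemma findim_scalar : findim R.
Proof.
exists 'I_1, (fun=> 1 : R), (fun=> idfun); split=> [_ x|w]; first exact: cvg_id.
by rewrite big_ord1 /= [_ *: _]mulr1.
Qed.

Lemma findim_matrix m n : findim 'M[R]_(m, n).
Proof.
exists ('I_m * 'I_n)%type, (fun p => delta_mx p.1 p.2),
  (fun p => linear_of (@coord_is_linear m n p.1 p.2)); split=> [i|w].
  exact: coord_continuous.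
by rewrite [LHS]matrix_sum_delta pair_big.
Qed.

Lemma fst_is_linear (V W : normedModType R) : linear (fst : V * W -> V).
Proof. by []. Qed.

Lemma snd_is_linear (V W : normedModType R) : linear (snd : V * W -> W).
Proof. by []. Qed.

Lemma findim_prod (V W : normedModType R) : findim V -> findim W -> findim (V * W)%type.
Proof.
move=> [I [b [l [cl bl]]]] [J [b' [l' [cl' bl']]]].
exists (I + J)%type,
  (fun k => match k with inl i => (b i, 0) | inr j => (0, b' j) end),
  (fun k => match k with inl i => l i \o linear_of (@fst_is_linear V W)
     | inr j => l' j \o linear_of (@snd_is_linear V W) end : {linear _ -> _}).
split=> [[i|j] z|[w w']].
- by apply: continuous_comp; [exact: cvg_fst|exact: cl].
- by apply: continuous_comp; [exact: cvg_snd|exact: cl'].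
have sum1 (K : finType) (F : K -> (V * W)%type) : (\sum_k F k).1 = \sum_k (F k).1.
  exact: (raddf_sum (linear_of (@fst_is_linear V W))).
have sum2 (K : finType) (F : K -> (V * W)%type) : (\sum_k F k).2 = \sum_k (F k).2.
  exact: (raddf_sum (linear_of (@snd_is_linear V W))).
rewrite big_sumType /=; apply: injective_projections; rewrite /= ?sum1 ?sum2.
  rewrite [in LHS](bl w) [X in _ + X]big1 ?addr0// => j _.
  exact: scaler0.
rewrite [in LHS](bl' w') [X in X + _]big1 ?add0r// => j _.
exact: scaler0.
Qed.

End FiniteDimension.

(** * Mean value theorem and symmetry of second derivatives *)

Section MeanValue.
Context {R : realType} {V : normedModType R}.
Implicit Types f : V -> R.

Lemma derive_along_line f (y v : V) (r : R) : differentiable f (y + r *: v) ->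
  is_derive r 1 (fun s => f (y + s *: v)) ('D_v f (y + r *: v)).
Proof.
move=> df.
have dz : differentiable (fun s : R => s *: v) r.
  exact: (@differentiableZl _ _ _ (@id R)).
have lE : (fun s : R => y + s *: v) = cst y + (fun s : R => s *: v) by [].
have dl : differentiable (fun s : R => y + s *: v) r.
  by rewrite lE; apply: differentiableD.
have Dl : 'D_1 (fun s : R => y + s *: v) r = v.
  rewrite deriveE// lE diffD//.
  by rewrite /= diff_cst add0r (@diffZl _ _ _ (@id R))// diff_val scale1r.
apply: DeriveDef; first by apply: diff_derivable; exact: differentiable_comp.
rewrite -[LHS]/('D_1 (f \o (fun s : R => y + s *: v)) r).
by rewrite derive_comp// Dl.
Qed.

Lemma MVT_line f (y v : V) (s : R) : 0 < s ->
  (forall r, 0 <= r <= s -> differentiable f (y + r *: v)) ->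
  exists2 c, 0 < c < s & f (y + s *: v) - f y = s * 'D_v f (y + c *: v).
Proof.
move=> s0 df.
have [r||c cs] := @MVT R (fun r => f (y + r *: v)) (fun r => 'D_v f (y + r *: v)) 0 s s0.
- rewrite in_itv /= => /andP[/ltW r0 /ltW rs]; apply: derive_along_line.
  by apply: df; rewrite r0.
- apply: derivable_within_continuous => r.
  rewrite in_itv /= => rs; have := derive_along_line (df r rs).
  by case.
- by move: cs; rewrite in_itv /= => cs; rewrite scale0r addr0 subr0 mulrC => e; exists c.
Qed.

(** The mean value theorem is applied along [v] to the increment of [f] by [s *: w], then along [w]
    to ['D_v f]. The left side is symmetric in [v] and [w], so exchanging them expresses the same
    number by the other mixed derivative. *)
Lemma second_difference f (x v w : V) (s : R) : 0 < s ->
  (forall r q, 0 <= r <= s -> 0 <= q <= s ->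
    differentiable f (x + r *: v + q *: w) /\ differentiable ('D_v f) (x + r *: v + q *: w)) ->
  exists c d, [/\ 0 < c < s, 0 < d < s &
    f (x + s *: v + s *: w) - f (x + s *: v) - (f (x + s *: w) - f x) =
    s * (s * 'D_w ('D_v f) (x + c *: v + d *: w))].
Proof.
move=> s0 df.
have s0' : 0 <= s <= s by rewrite (ltW s0) lexx.
have z0 : (0 : R) <= 0 <= s by rewrite lexx ltW.
have ds r q (rs : 0 <= r <= s) (qs : 0 <= q <= s) := (df r q rs qs).1.
have shE : (fun y => y + s *: w) = id + cst (s *: w) by [].
have dsh (y : V) : differentiable (fun y => y + s *: w) y.
  by rewrite shE; apply: differentiableD.
have Dsh (y : V) : 'D_v (fun y => y + s *: w) y = v.
  rewrite shE deriveD//.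
  by rewrite derive_id derive_cst addr0.
have d1 r : 0 <= r <= s -> differentiable (f \o (fun y => y + s *: w)) (x + r *: v).
  by move=> rs; apply: differentiable_comp => //; apply: ds.
have d2 r : 0 <= r <= s -> differentiable f (x + r *: v).
  by move=> rs; have := ds r 0 rs z0; rewrite scale0r addr0.
have [|c cs] := @MVT_line ((f \o (fun y => y + s *: w)) - f) x v s s0.
  by move=> r rs; apply: differentiableB; [exact: d1|exact: d2].
have cs' : 0 <= c <= s by case/andP: cs => /ltW -> /ltW ->.
rewrite deriveB; [|exact/diff_derivable/d1|exact/diff_derivable/d2].
rewrite derive_comp//; last exact: ds.
rewrite Dsh /= => e1.
have [|d dbound e2] := @MVT_line ('D_v f) (x + c *: v) w s s0.
  by move=> q qs; apply: (df c q cs' qs).2.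
exists c, d; split=> //.
by rewrite -e2 -e1 /=.
Qed.

(** Both mixed derivatives, taken at points close to [x], equal the same second difference divided
    by the square of [s]; their continuity at [x] makes the difference at [x] smaller than every
    [e]. *)
Lemma derive_comm f (A : set V) (x v w : V) : open A -> A x -> Ck 2 A f ->
  'D_v ('D_w f) x = 'D_w ('D_v f) x.
Proof.
move=> oA Ax [df Df]; apply/eqP; rewrite -subr_eq0 -normr_eq0; apply/eqP/le_anti.
rewrite normr_ge0 andbT; apply/ler_addgt0Pr => e e0; rewrite add0r.
have cvw : {for x, continuous ('D_v ('D_w f))} by have [_ D] := Df w; apply: (D v).
have cwv : {for x, continuous ('D_w ('D_v f))} by have [_ D] := Df v; apply: (D w).
have e20 : 0 < e / 2 by rewrite divr_gt0.
have [r /= r0 rA] : exists2 r, 0 < r & forall y, ball x r y ->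
    [/\ A y, `|'D_v ('D_w f) x - 'D_v ('D_w f) y| < e / 2 &
              `|'D_w ('D_v f) x - 'D_w ('D_v f) y| < e / 2].
  have nA : nbhs x A := open_nbhs_nbhs (conj oA Ax).
  have n1 : \forall y \near x, `|'D_v ('D_w f) x - 'D_v ('D_w f) y| < e / 2.
    by apply: (cvgrPdist_lt _ _).1 e20; exact: cvw.
  have n2 : \forall y \near x, `|'D_w ('D_v f) x - 'D_w ('D_v f) y| < e / 2.
    by apply: (cvgrPdist_lt _ _).1 e20; exact: cwv.
  have [r r0 h] := (nbhs_ballP _ _).1 (filterI nA (filterI n1 n2) : nbhs x _).
  by exists r => // y /h [? []].
(* The parallelogram with sides [s *: v] and [s *: w] at [x] then has all its points within [r / 2]
   of [x]. The summand 1 keeps the denominator positive when [v] and [w] vanish. *)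
pose s := r / 2 / (`|v| + `|w| + 1).
have N0 : 0 < `|v| + `|w| + 1 by rewrite ltr_wpDl// addr_ge0.
have s0 : 0 < s by rewrite !divr_gt0.
have inball (v' w' : V) : `|v'| + `|w'| + 1 = `|v| + `|w| + 1 ->
    forall c d, 0 <= c <= s -> 0 <= d <= s -> ball x r (x + c *: v' + d *: w').
  move=> vw c d /andP[c0 cs] /andP[d0 ds]; rewrite -ball_normE /=.
  rewrite -addrA opprD addNKr normrN.
  apply: (le_lt_trans (ler_normD _ _)); rewrite !normrZ (ger0_norm c0) (ger0_norm d0).
  apply: (@le_lt_trans _ _ (s * (`|v| + `|w| + 1))).
    rewrite -vw !mulrDr mulr1 -[leLHS]addr0; apply: lerD; last exact: ltW.
    by apply: lerD; apply: ler_wpM2r.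
  by rewrite /s divfK ?gt_eqF// ltr_pdivrMr// ltr_pMr// ltr1n.
have sd (v' w' : V) : `|v'| + `|w'| + 1 = `|v| + `|w| + 1 -> forall r q,
   0 <= r <= s -> 0 <= q <= s ->
    differentiable f (x + r *: v' + q *: w') /\ differentiable ('D_v' f) (x + r *: v' + q *: w').
  move=> vw c d cs ds; have [Ay _ _] := rA _ (inball _ _ vw c d cs ds).
  by split; [exact: df|have [+ _] := Df v'; apply].
have [c [d [cs ds e1]]] := second_difference s0 (sd v w erefl).
have [|c' [d' [cs' ds' e2]]] := @second_difference f x w v s s0 (sd w v _).
  by rewrite (addrC `|w|).
have wk (z : R) : 0 < z < s -> 0 <= z <= s by case/andP => /ltW -> /ltW ->.
have [_ _ h1] := rA _ (inball v w erefl c d (wk _ cs) (wk _ ds)).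
have [|_ h2 _] := rA _ (inball w v _ c' d' (wk _ cs') (wk _ ds')).
  by rewrite (addrC `|w|).
have e3 : 'D_w ('D_v f) (x + c *: v + d *: w) = 'D_v ('D_w f) (x + c' *: w + d' *: v).
  apply: (mulfI (lt0r_neq0 s0)); apply: (mulfI (lt0r_neq0 s0)).
  apply: etrans (etrans (esym e1) _) e2; rewrite (addrAC x (s *: w)).
  by move: (f _) (f (x + s *: v)) (f (x + s *: w)) (f x) => *; ring.
rewrite e3 in h1; move: h1 h2 {e1 e2 e3 cvw cwv rA sd inball}.
move: ('D_v ('D_w f) (x + c' *: w + d' *: v)) ('D_w ('D_v f) x) ('D_v ('D_w f) x).
move=> P X Y h1 h2; rewrite [leRHS]splitr.
apply: (le_trans (ler_distD P Y X)); apply: lerD; apply: ltW; first exact: h2.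
by rewrite distrC.
Qed.

(** Balls are convex, so the segment from [x] to [y] stays where the differential vanishes. No bound
    that is uniform over the ball is required, which matters in [speed_defect_ball]. *)
Lemma eq_on_ball f (x : V) (r : R) :
  (forall y, ball x r y -> differentiable f y /\ 'd f y =1 (fun=> 0)) ->
  forall y, ball x r y -> f y = f x.
Proof.
move=> df y xy.
have inb c : 0 <= c <= 1 -> ball x r (x + c *: (y - x)).
  move=> /andP[c0 c1]; move: xy; rewrite -ball_normE /= => xy.
  rewrite opprD addNKr normrN normrZ ger0_norm//.
  by apply: le_lt_trans xy; rewrite distrC ler_piMl.
have [|c cs] := @MVT_line f x (y - x) 1 ltr01.
  by move=> c /inb/df[].
have cs' : 0 <= c <= 1 by case/andP: cs => /ltW -> /ltW ->.
have [dfc dfc0] := df _ (inb _ cs').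
rewrite deriveE// dfc0 mulr0 scale1r (addrC x) subrK => /eqP.
by rewrite subr_eq0 => /eqP.
Qed.

End MeanValue.

(** * Smoothness and derivatives of matrix-valued maps *)

Section SmoothCalculus.
Context {R : realType}.
Implicit Types U V W : normedModType R.

Lemma derive_coord {V} m n (f : V -> 'M[R]_(m, n)) (x v : V) i j :
  differentiable f x -> 'D_v f x i j = 'D_v (fun y => f y i j) x.
Proof.
move=> df; rewrite -[RHS]/('D_v (linear_of (@coord_is_linear R m n i j) \o f) x).
by rewrite derive_linear_comp//; exact: coord_continuous.
Qed.

Lemma differentiable_entry {V} m n (f : V -> 'M[R]_(m, n)) (x : V) i j :
  differentiable f x -> differentiable (fun y => f y i j) x.
Proof.
move=> df; apply: (@differentiable_comp _ _ _ _ f (fun A : 'M[R]_(m, n) => A i j)) => //.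
exact: differentiable_coord.
Qed.

Lemma Ck_comp {V W} k (A : set V) (B : set W) (f : W -> R) (g : V -> W) :
  findim W -> open A -> Ck k A g -> Ck k B f -> (forall x, A x -> B (g x)) ->
  Ck k A (f \o g).
Proof.
move=> [I [b [l [cl bl]]]] oA; elim: k f => [|k IH] f Cg Cf gB.
  by move=> x Ax; apply: continuous_comp; [exact: Cg|apply: Cf; exact: gB].
have [dg Dg] := Cg; have [df Df] := Cf; split=> [x Ax|v].
  by apply: differentiable_comp; [exact: dg|apply: df; exact: gB].
apply: (@Ck_eq _ _ _ k _ (fun x => \sum_i (l i \o 'D_v g) x * ('D_(b i) f \o g) x)) => //.
  move=> x Ax; rewrite derive_comp; [|exact: dg|by apply: df; exact: gB].
  rewrite [in RHS]deriveE; last by apply: df; exact: gB.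
  rewrite [in RHS](bl ('D_v g x)) linear_sum; apply: eq_bigr => i _.
  by rewrite linearZ /= (@deriveE _ _ _ f)//; apply: df; exact: gB.
apply: Ck_sum => // i; apply: Ck_mul => //.
  by apply: Ck_linear => //; apply: Dg.
by apply: IH => //; [exact: Ck_pred|apply: Df].
Qed.

Lemma Ck_mx {V} m n k (A : set V) (f : V -> 'M[R]_(m, n)) : open A ->
  (forall i j, Ck k A (fun x => f x i j)) -> Ck k A f.
Proof.
move=> oA Cf.
apply: (@Ck_eq _ _ _ k _ (fun x => \sum_i \sum_j f x i j *: delta_mx i j)) => //.
  by move=> x Ax; rewrite [RHS]matrix_sum_delta.
by apply: Ck_sum => // i; apply: Ck_sum => // j; apply: Ck_Zl.
Qed.

Section SmoothOn.
Context {V : normedModType R} {A : set V} (oA : open A).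

Lemma smooth_differentiable {W} (f : V -> W) x : smooth_on A f -> A x -> differentiable f x.
Proof. by move=> sf; apply: Ck_differentiable (sf 1%N). Qed.

Lemma smooth_derive {W} (f : V -> W) v : smooth_on A f -> smooth_on A ('D_v f).
Proof. by move=> sf k; have [_] := sf k.+1; apply. Qed.

Lemma smooth_eq {W} (f g : V -> W) :
  (forall x, A x -> f x = g x) -> smooth_on A f -> smooth_on A g.
Proof. by move=> fg sf k; apply: Ck_eq (sf k). Qed.

Lemma smooth_cst {W} (w : W) : smooth_on A (fun=> w).
Proof. by move=> k; apply: Ck_cst. Qed.

Lemma smooth_linear {W} (l : {linear V -> W}) : continuous l -> smooth_on A l.
Proof.
move=> cl [|k]; first by move=> x _; apply: cl.
split=> [x _|v]; first exact: linear_differentiable.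
by apply: (@Ck_eq _ _ _ k _ (fun=> l v)) (Ck_cst _ _ _) => // x _; rewrite linear_derive.
Qed.

Lemma smooth_linear_comp {U W} (l : {linear U -> W}) (f : V -> U) :
  continuous l -> smooth_on A f -> smooth_on A (l \o f).
Proof. by move=> cl sf k; apply: Ck_linear. Qed.

Lemma smooth_add {W} (f g : V -> W) :
  smooth_on A f -> smooth_on A g -> smooth_on A (fun x => f x + g x).
Proof. by move=> sf sg k; apply: Ck_add. Qed.

Lemma smooth_sum {W} (I : finType) (F : I -> V -> W) :
  (forall i, smooth_on A (F i)) -> smooth_on A (fun x => \sum_i F i x).
Proof. by move=> sF k; apply: Ck_sum => // i; apply: sF. Qed.

Lemma smooth_mul (f g : V -> R) :
  smooth_on A f -> smooth_on A g -> smooth_on A (fun x => f x * g x).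
Proof. by move=> sf sg k; apply: Ck_mul. Qed.

Lemma smooth_opp (f : V -> R) : smooth_on A f -> smooth_on A (fun x => - f x).
Proof.
move=> sf; under eq_fun do rewrite -mulN1r.
by apply: smooth_mul => //; apply: smooth_cst.
Qed.

Lemma smooth_inv (f : V -> R) :
  (forall x, A x -> f x != 0) -> smooth_on A f -> smooth_on A (fun x => (f x)^-1).
Proof. by move=> f0 sf k; apply: Ck_inv. Qed.

Lemma smooth_pair {U W} (f : V -> U) (g : V -> W) :
  smooth_on A f -> smooth_on A g -> smooth_on A (fun x => (f x, g x)).
Proof. by move=> sf sg k; apply: Ck_pair. Qed.

Lemma smooth_mx m n (f : V -> 'M[R]_(m, n)) :
  (forall i j, smooth_on A (fun x => f x i j)) -> smooth_on A f.
Proof. by move=> sf k; apply: Ck_mx => // i j; apply: sf. Qed.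

Lemma smooth_entry m n (f : V -> 'M[R]_(m, n)) i j :
  smooth_on A f -> smooth_on A (fun x => f x i j).
Proof.
move=> sf; apply: (@smooth_linear_comp _ _ (linear_of (@coord_is_linear R m n i j)) f) => //.
exact: coord_continuous.
Qed.

Lemma smooth_comp {W} (B : set W) (f : W -> R) (g : V -> W) : findim W ->
  smooth_on A g -> smooth_on B f -> (forall x, A x -> B (g x)) -> smooth_on A (f \o g).
Proof. by move=> fW sg sf gB k; apply: Ck_comp. Qed.

Lemma smooth_comp_mx {W} m n (B : set W) (f : W -> 'M[R]_(m, n)) (g : V -> W) :
  findim W -> open B -> smooth_on A g -> smooth_on B f -> (forall x, A x -> B (g x)) ->
  smooth_on A (f \o g).
Proof.
move=> fW oB sg sf gB; apply: smooth_mx => i j.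
apply: (@smooth_comp _ B (fun y => f y i j) g) => // k.
apply: (@Ck_linear _ _ _ _ k _ (linear_of (@coord_is_linear R m n i j)) f) => //.
exact: coord_continuous.
Qed.

Lemma smooth_mulmx m n p (f : V -> 'M[R]_(m, n)) (g : V -> 'M[R]_(n, p)) :
  smooth_on A f -> smooth_on A g -> smooth_on A (fun x => f x *m g x).
Proof.
move=> sf sg; apply: smooth_mx => i j; under eq_fun do rewrite mxE.
by apply: smooth_sum => k; apply: smooth_mul; apply: smooth_entry.
Qed.

Lemma smooth_trmx m n (f : V -> 'M[R]_(m, n)) :
  smooth_on A f -> smooth_on A (fun x => (f x)^T).
Proof.
by move=> sf; apply: smooth_mx => i j; under eq_fun do rewrite mxE; apply: smooth_entry.
Qed.

Lemma smooth_det n (f : V -> 'M[R]_n) : smooth_on A f -> smooth_on A (fun x => \det (f x)).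
Proof.
move=> sf k; apply: Ck_sum => // s; apply: Ck_mul => //; first exact: Ck_cst.
by apply: Ck_prod => // i; apply: smooth_entry.
Qed.

Lemma smooth_invmx n (f : V -> 'M[R]_n) : (forall x, A x -> f x \in unitmx) ->
  smooth_on A f -> smooth_on A (fun x => invmx (f x)).
Proof.
move=> fu sf; apply: smooth_mx => i j.
apply: (@smooth_eq _ (fun x => (\det (f x))^-1 * cofactor (f x) j i)).
  by move=> x Ax; rewrite /invmx fu// !mxE.
apply: smooth_mul.
  apply: smooth_inv; last exact: smooth_det.
  by move=> x /fu; rewrite unitmxE unitfE.
apply: smooth_mul; first exact: smooth_cst.
apply: smooth_det; apply: smooth_mx => a b; under eq_fun do rewrite !mxE.
exact: smooth_entry.
Qed.

Lemma derive_commutes (f : V -> R) (x v w : V) : smooth_on A f -> A x ->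
  'D_v ('D_w f) x = 'D_w ('D_v f) x.
Proof. by move=> sf Ax; apply: derive_comm oA Ax (sf 2%N). Qed.

End SmoothOn.

Lemma derive_mulmx {V} m n p (f : V -> 'M[R]_(m, n)) (g : V -> 'M[R]_(n, p)) (x v : V) :
  differentiable f x -> differentiable g x ->
  'D_v (fun y => f y *m g y) x = 'D_v f x *m g x + f x *m 'D_v g x.
Proof.
move=> df dg.
have dfg i j : is_derive x v (fun y => (f y *m g y) i j)
    (('D_v f x *m g x + f x *m 'D_v g x) i j).
  under eq_fun do rewrite mxE.
  rewrite (_ : (fun y => _) = \sum_k ((fun y => f y i k) * (fun y => g y k j))); last first.
    by apply/funext => y; rewrite fct_sumE.
  apply: is_derive_eq.
    apply: is_derive_sum => k; apply: is_deriveM; apply: derivableP.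
      exact/diff_derivable/differentiable_entry.
    exact/diff_derivable/differentiable_entry.
  rewrite !mxE -big_split; apply: eq_bigr => k _ /=.
  by rewrite !derive_coord// addrC; congr (_ + _); exact: mulrC.
rewrite derive_mx.
  by apply/matrixP => i j; rewrite mxE (@derive_val _ _ _ _ _ _ _ (dfg i j)).
by apply/derivable_mxP => i j; have [] := dfg i j.
Qed.

Lemma differentiable_mx {V} m n (f : V -> 'M[R]_(m, n)) (x : V) :
  (forall i j, differentiable (fun y => f y i j) x) -> differentiable f x.
Proof.
move=> df; rewrite (_ : f = \sum_i \sum_j (fun y => f y i j *: delta_mx i j)).
  apply: differentiable_sum => i; apply: differentiable_sum => j.
  exact: differentiableZl.
apply/funext => y; rewrite [LHS]matrix_sum_delta fct_sumE; apply: eq_bigr => i _.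
by rewrite fct_sumE.
Qed.

Lemma differentiable_mulmx {V} m n p (f : V -> 'M[R]_(m, n)) (g : V -> 'M[R]_(n, p)) x :
  differentiable f x -> differentiable g x -> differentiable (fun y => f y *m g y) x.
Proof.
move=> df dg; apply: differentiable_mx => i j; under eq_fun do rewrite mxE.
rewrite (_ : (fun y => _) = \sum_k ((fun y => f y i k) * (fun y => g y k j))); last first.
  by apply/funext => y; rewrite fct_sumE.
by apply: differentiable_sum => k; apply: differentiableM; apply: differentiable_entry.
Qed.

Lemma derive_trmx {V} m n (f : V -> 'M[R]_(m, n)) (x v : V) :
  differentiable f x -> 'D_v (fun y => (f y)^T) x = ('D_v f x)^T.
Proof.
move=> df; rewrite derive_mx.
  apply/matrixP => i j; rewrite !mxE derive_coord//.
  by congr ('D_v _ x); apply/funext => y; rewrite mxE.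
apply/derivable_mxP => i j; under eq_fun do rewrite mxE.
exact/diff_derivable/differentiable_entry.
Qed.

Lemma differentiable_trmx {V} m n (f : V -> 'M[R]_(m, n)) (x : V) :
  differentiable f x -> differentiable (fun y => (f y)^T) x.
Proof.
move=> df; apply: differentiable_mx => i j; under eq_fun do rewrite mxE.
exact: differentiable_entry.
Qed.

Lemma row_jacobian m n (f : 'rV[R]_m -> 'rV[R]_n) x i :
  differentiable f x -> row i ('J f x) = pd i f x.
Proof. by move=> df; rewrite /pd deriveEjacobian// rowE. Qed.

Lemma jacobianE m n (f : 'rV[R]_m -> 'rV[R]_n) x i j :
  differentiable f x -> 'J f x i j = pd i (fun y => f y 0 j) x.
Proof. by move=> df; rewrite /pd -derive_coord// -[in RHS]/(pd i f x) -row_jacobian// [RHS]mxE. Qed.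

Lemma jacobian_comp m n p (f : 'rV[R]_m -> 'rV[R]_n) (g : 'rV[R]_n -> 'rV[R]_p) x :
  differentiable f x -> differentiable g (f x) -> 'J (g \o f) x = 'J f x *m 'J g (f x).
Proof.
move=> df dg; apply/row_matrixP => i; rewrite row_jacobian; last exact: differentiable_comp.
by rewrite /pd derive_comp// deriveEjacobian// row_mul row_jacobian.
Qed.

Lemma smooth_jacobian m n (A : set 'rV[R]_m) (f : 'rV[R]_m -> 'rV[R]_n) :
  open A -> smooth_on A f -> smooth_on A (jacobian f).
Proof.
move=> oA sf; apply: smooth_mx => // i j.
apply: (@smooth_eq _ A oA _ (fun x => pd i f x 0 j)).
  by move=> x Ax; rewrite -row_jacobian; [rewrite [LHS]mxE|exact: smooth_differentiable sf Ax].
by apply: smooth_entry => //; apply: smooth_derive.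
Qed.

Lemma derive_basis {V} n (f : 'rV[R]_n -> V) x v :
  differentiable f x -> 'D_v f x = \sum_i v 0 i *: pd i f x.
Proof.
move=> df; rewrite deriveE// [in LHS](row_sum_delta v) linear_sum.
by apply: eq_bigr => i _; rewrite linearZ /pd /= deriveE.
Qed.

End SmoothCalculus.

Section ScalesAndSums.
Context {R : realType} {V : normedModType R}.

Lemma differentiable_scale m n (f : V -> R) (g : V -> 'M[R]_(m, n)) x :
  differentiable f x -> differentiable g x -> differentiable (fun y => f y *: g y) x.
Proof.
move=> df dg; apply: differentiable_mx => i j; under eq_fun do rewrite mxE.
by apply: differentiableM => //; exact: differentiable_entry.
Qed.

Lemma derive_scale m n (f : V -> R) (g : V -> 'M[R]_(m, n)) x v :
  differentiable f x -> differentiable g x ->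
  'D_v (fun y => f y *: g y) x = 'D_v f x *: g x + f x *: 'D_v g x.
Proof.
move=> df dg; apply/matrixP => i j; rewrite derive_coord; last exact: differentiable_scale.
under eq_fun do rewrite mxE.
have dgij := differentiable_entry i j dg.
rewrite -[fun y => _]/(f * (fun y => g y i j)) deriveM; [|exact: diff_derivable..].
by rewrite addrC !mxE derive_coord//; congr (_ + _); exact: mulrC.
Qed.

Lemma differentiable_sum_fun {W : normedModType R} n (f : 'I_n -> V -> W) x :
  (forall i, differentiable (f i) x) -> differentiable (fun y => \sum_i f i y) x.
Proof.
move=> df; rewrite (_ : (fun y => _) = \sum_i f i); first exact: differentiable_sum.
by apply/funext => y; rewrite fct_sumE.
Qed.

Lemma derive_sum_fun {W : normedModType R} n (f : 'I_n -> V -> W) x v :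
  (forall i, differentiable (f i) x) ->
  'D_v (fun y => \sum_i f i y) x = \sum_i 'D_v (f i) x.
Proof.
move=> df; rewrite (_ : (fun y => _) = \sum_i f i).
  by rewrite derive_sum// => i; exact: diff_derivable.
by apply/funext => y; rewrite fct_sumE.
Qed.

Lemma derive_add_fun {W : normedModType R} (f g : V -> W) x v :
  differentiable f x -> differentiable g x ->
  'D_v (fun y => f y + g y) x = 'D_v f x + 'D_v g x.
Proof. by move=> df dg; rewrite -deriveD//; exact: diff_derivable. Qed.

Lemma derive_sub_fun {W : normedModType R} (f g : V -> W) x v :
  differentiable f x -> differentiable g x ->
  'D_v (fun y => f y - g y) x = 'D_v f x - 'D_v g x.
Proof. by move=> df dg; rewrite -deriveB//; exact: diff_derivable. Qed.

End ScalesAndSums.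

(** * One-sided time derivatives and primitives *)

Section OneVariable.
Context {R : realType}.

(** The bridge from the half-open time interval to ordinary calculus: the one-sided derivative may
    be computed from any extension [g] that is differentiable at [t], also at [t = 0]. *)
Lemma dt_eq {W : normedModType R} (delta : R) (f g : R -> W) (t : R) :
  0 <= t < delta -> (\forall s \near t, 0 <= s < delta -> f s = g s) ->
  derivable g t 1 -> dt delta f t = 'D_1 g t.
Proof.
move=> /andP[t0 td] fg dg.
(* [dt] is a [lim], whose value is determined only along a proper filter. The point [t + d], with
   [d] half of the room available to the right, lies in the interval and differs from [t]. *)
have PF : ProperFilter (within `[0, delta[ t^').
  apply: Build_ProperFilter_ex => // P.
  move=> /nbhs_ballP[e /= e0 h].
  pose d := Num.min e (delta - t) / 2.
  have m0 : 0 < Num.min e (delta - t) by rewrite lt_min e0 subr_gt0.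
  have d0 : 0 < d by rewrite divr_gt0.
  have dm : d < Num.min e (delta - t) by rewrite ltr_pdivrMr// ltr_pMr// ltr1n.
  exists (t + d); apply: h => /=.
  - rewrite /ball /= opprD addNKr normrN ger0_norm ?ltW//.
    by apply: lt_le_trans dm _; rewrite ge_min lexx.
  - by rewrite -subr_eq0 addrC addKr gt_eqF.
  - rewrite in_itv /= addr_ge0 ?(ltW d0)//= -ltrBrDl.
    by apply: lt_le_trans dm _; rewrite ge_min lexx orbT.
apply: cvg_lim => //; apply/cvgrPdist_lt => e e0.
have cg : h^-1 *: (g (h *: 1 + t) - g t) @[h --> 0^'] --> 'D_1 g t by exact: dg.
have /nbhs_ballP[r /= r0 hr] : \forall h \near (0 : R)^',
    `|'D_1 g t - h^-1 *: (g (h *: 1 + t) - g t)| < e.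
  by apply: (cvgrPdist_lt _ _).1 e0; exact: cg.
have ft : f t = g t by apply: (nbhs_singleton fg); rewrite t0.
apply/nbhs_ballP.
have /nbhs_ballP[q /= q0 hq] := fg.
exists (Num.min r q) => /=; first by rewrite lt_min r0.
move=> s; rewrite /ball /= lt_min => /andP[sr sq] st; rewrite in_itv /= => sd.
have := hr (s - t); rewrite /ball /= sub0r normrN distrC => /(_ sr).
rewrite subr_eq0 => /(_ st).
by rewrite [_ *: 1]mulr1 subrK ft -(hq s).
Qed.

Definition primitive (a : R) (k : R -> R) (y : R) : R :=
  (\int[lebesgue_measure]_(t in [set` `[a, y]]) (k t))%R.

(** For [y < a] the integral runs over the empty interval, so the two-sided derivative is claimed
    strictly to the right of [a]. Later base points are therefore placed to the left of the times of
    interest. *)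
Lemma is_derive_primitive (a b : R) (k : R -> R) (x : R) :
  (forall x, a <= x < b -> {for x, continuous k}) ->
  a < x < b -> is_derive x 1 (primitive a k) (k x).
Proof.
move=> ck /andP[ax xb].
pose u := (x + b) / 2.
have xu : x < u by rewrite midf_lt.
have ub : u < b by rewrite midf_lt.
have ik : lebesgue_measure.-integrable `[a, u] (EFin \o k).
  apply: continuous_compact_integrable; first exact: segment_compact.
  apply: continuous_in_subspaceT => y; rewrite inE /= in_itv /= => /andP[ay yu].
  by apply: ck; rewrite ay (le_lt_trans yu).
have cx : {for x, continuous k} by apply: ck; rewrite ltW.
have [dF F'] := @continuous_FTC1_closed R k a x u xu ik ax cx.
by apply: DeriveDef; [exact: dF|rewrite -derive1E F'].
Qed.

Lemma eq_of_derive0 (f : R -> R) (x y : R) : x <= y ->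
  (forall z, x <= z <= y -> is_derive z 1 f 0) -> f x = f y.
Proof.
move=> xy df.
have [z|| z _ e] := @MVT_segment R f (fun=> 0) x y xy.
- by rewrite in_itv /= => /andP[/ltW xz /ltW zy]; apply: df; rewrite xz.
- apply: derivable_within_continuous => z; rewrite in_itv /= => zxy.
  by have [] := df z zxy.
- by move: e; rewrite mul0r => /eqP; rewrite subr_eq0 => /eqP.
Qed.

Lemma derive_scalar {W : normedModType R} (f : R -> W) (x v : R) :
  differentiable f x -> 'D_v f x = v *: 'D_1 f x.
Proof. by move=> df; rewrite !deriveE// -[in LHS](mulr1 v) -linearZ. Qed.

Lemma smooth_of_derive (A : set R) (f k : R -> R) : open A ->
  (forall x, A x -> is_derive x 1 f (k x)) -> smooth_on A k -> smooth_on A f.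
Proof.
move=> oA df sk.
have dif x : A x -> differentiable f x by move=> /df[dfx _]; apply/derivable1_diffP.
move=> [|j]; first by move=> x /dif/differentiable_continuous.
split=> // v; apply: (@Ck_eq _ _ _ j _ (fun x => v * k x)) => //.
  by move=> x Ax; rewrite derive_scalar//; [have [_ ->] := df x Ax|exact: dif].
by apply: Ck_mul => //; exact: Ck_cst.
Qed.

End OneVariable.

(** * Levi-Civita connection and divergence *)

Section Bilinear.
Context {R : realType} {n : nat}.
Implicit Types (A B : 'M[R]_n) (v w : 'rV[R]_n).

Lemma bilinDl B v v' w : bilin B (v + v') w = bilin B v w + bilin B v' w.
Proof. by rewrite /bilin !mulmxDl mxE. Qed.

Lemma bilinD A B v w : bilin (A + B) v w = bilin A v w + bilin B v w.
Proof. by rewrite /bilin mulmxDr mulmxDl mxE. Qed.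

Lemma bilin_congr m (B : 'M[R]_m) (S : 'M[R]_(n, m)) v w :
  bilin (S *m B *m S^T) v w = bilin B (v *m S) (w *m S).
Proof. by rewrite /bilin trmx_mul !mulmxA. Qed.

Lemma bilin_delta B i j : bilin B (delta_mx 0 i) (delta_mx 0 j) = B i j.
Proof. by rewrite /bilin trmx_delta -rowE -colE !mxE. Qed.

Lemma bilin_trmx B v w : bilin (B^T) v w = bilin B w v.
Proof.
rewrite /bilin -[w *m _ *m _]trmxK [RHS]mxE; congr (_ 0 0).
by rewrite !trmx_mul !trmxK mulmxA.
Qed.

Lemma bilin_ext A B : (forall v w, bilin A v w = bilin B v w) -> A = B.
Proof. by move=> AB; apply/matrixP => i j; rewrite -!bilin_delta. Qed.

End Bilinear.

Section LeviCivita.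
Context {R : realType}.

Lemma pd_entry {n} m k (f : 'rV[R]_n -> 'M[R]_(m, k)) x i a b :
  differentiable f x -> pd i (fun y => f y a b) x = ('D_(delta_mx 0 i) f x) a b.
Proof. by move=> df; rewrite derive_coord. Qed.

(** In the contraction the first and the third derivative of [g] cancel by symmetry. What remains is
    the logarithmic derivative of the volume density, written as a trace so that no determinant has
    to be differentiated. *)
Lemma trace_christoffel {n} (g : 'rV[R]_n -> 'M[R]_n) x b :
  differentiable g x -> (\forall y \near x, (g y)^T = g y) ->
  \sum_a christoffel g x a a b = 2^-1 * \tr (invmx (g x) *m 'D_(delta_mx 0 b) g x).
Proof.
move=> dg gs.
have gsx : (g x)^T = g x := nbhs_singleton gs.
have Ds v : ('D_v g x)^T = 'D_v g x.
  by rewrite -derive_trmx//; apply: near_eq_derive.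
have Is : (invmx (g x))^T = invmx (g x) by rewrite trmx_inv gsx.
rewrite /christoffel -mulr_sumr; congr (_ * _).
under eq_bigr do under eq_bigr do rewrite !pd_entry// mulrBr mulrDr.
under eq_bigr do rewrite sumrB big_split /=.
rewrite sumrB big_split /= [X in _ - X]exchange_big /=.
rewrite [X in X + _ - _](_ : _ = \sum_j \sum_i invmx (g x) i j * 'D_(delta_mx 0 j) g x i b).
  rewrite addrC addKr /mxtrace; apply: eq_bigr => a _; rewrite mxE.
  by apply: eq_bigr => s _; rewrite -[in LHS]Ds mxE.
apply: eq_bigr => a _; apply: eq_bigr => s _.
by rewrite -[in LHS]Is mxE -[in LHS]Ds mxE.
Qed.

Lemma divergenceE {n} (g : 'rV[R]_n -> 'M[R]_n) X x :
  differentiable g x -> (\forall y \near x, (g y)^T = g y) -> differentiable X x ->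
  divergence g X x = \tr ('J X x) + 2^-1 * \tr (invmx (g x) *m 'D_(X x) g x).
Proof.
move=> dg gs dX; rewrite /divergence big_split /=; congr (_ + _).
  by apply: eq_bigr => a _; rewrite jacobianE.
rewrite exchange_big /= derive_basis// mulmx_sumr raddf_sum mulr_sumr.
apply: eq_bigr => b _; rewrite -mulr_suml trace_christoffel// -scalemxAr /= mxtraceZ.
by rewrite mulrC mulrCA.
Qed.

Lemma divergence_near {n} (g g' : 'rV[R]_n -> 'M[R]_n) X X' x :
  (\forall y \near x, g y = g' y) -> (\forall y \near x, X y = X' y) ->
  divergence g X x = divergence g' X' x.
Proof.
move=> gg XX; rewrite /divergence (nbhs_singleton XX).
have ggx := nbhs_singleton gg.
have gpd i a b : pd i (fun y => g y a b) x = pd i (fun y => g' y a b) x.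
  by apply: near_eq_derive; apply: filterS gg => y ->.
apply: eq_bigr => a _; congr (_ + _).
  by apply: near_eq_derive; apply: filterS XX => y ->.
apply: eq_bigr => b _; rewrite /christoffel ggx; congr (_ * _ * _).
by apply: eq_bigr => s _; rewrite !gpd.
Qed.

(* Twice the Christoffel symbol of the first kind, as a trilinear form *)
Definition christoffel1 {m} (h : 'rV[R]_m -> 'M[R]_m)
    (y u v w : 'rV[R]_m) : R :=
  bilin ('D_u h y) v w + bilin ('D_v h y) u w - bilin ('D_w h y) u v.

Lemma christoffel1_sum {m} (h : 'rV[R]_m -> 'M[R]_m) (y u v w : 'rV[R]_m) :
  differentiable h y -> christoffel1 h y u v w =
  \sum_b \sum_c \sum_s u 0 b * v 0 c * w 0 s *
    (pd b (fun z => h z c s) y + pd c (fun z => h z b s) y - pd s (fun z => h z b c) y).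
Proof.
move=> dh.
pose S (u1 v1 w1 : 'rV[R]_m) :=
  \sum_b \sum_c \sum_s u1 0 b * v1 0 c * w1 0 s * pd b (fun z => h z c s) y.
have tri u1 v1 w1 : bilin ('D_u1 h y) v1 w1 = S u1 v1 w1.
  rewrite derive_basis// /bilin mulmx_sumr mulmx_suml summxE; apply: eq_bigr => b _.
  rewrite -scalemxAr -scalemxAl mxE [X in _ * X]mxE mulr_sumr exchange_big /=.
  apply: eq_bigr => s _; rewrite mxE mulr_suml mulr_sumr; apply: eq_bigr => c _.
  by rewrite mxE pd_entry// /pd; ring.
have -> : christoffel1 h y u v w = S u v w + S v u w - S w u v.
  by congr (_ + _ - _); exact: tri.
rewrite /S.
rewrite [X in _ + X - _]exchange_big /=.
rewrite [X in _ - X](_ : _ = \sum_b \sum_c \sum_s u 0 b * v 0 c * w 0 s *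
    pd s (fun z => h z b c) y); last first.
  rewrite exchange_big /=; apply: eq_bigr => b _; rewrite exchange_big /=.
  by apply: eq_bigr => c _; apply: eq_bigr => s _; ring.
rewrite -big_split -sumrB; apply: eq_bigr => b _ /=.
rewrite -big_split -sumrB; apply: eq_bigr => c _ /=.
rewrite -big_split -sumrB; apply: eq_bigr => s _ /=.
by ring.
Qed.

(** Lowering the index with [h] cancels the inverse metric. The trilinear form that remains is
    linear in the derivative of [h], so its behaviour under a change of coordinates follows from the
    product rule. *)
Lemma christoffel_lower {m} (h : 'rV[R]_m -> 'M[R]_m) (y u v w : 'rV[R]_m) :
  differentiable h y -> (h y)^T = h y -> h y \in unitmx ->
  bilin (h y) (\row_a \sum_b \sum_c christoffel h y a b c * u 0 b * v 0 c) w =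
  2^-1 * christoffel1 h y u v w.
Proof.
move=> dh hs hu.
have Is : (invmx (h y))^T = invmx (h y) by rewrite trmx_inv hs.
have qE : \row_a \sum_b \sum_c christoffel h y a b c * u 0 b * v 0 c =
    2^-1 *: ((\row_s christoffel1 h y u v (delta_mx 0 s)) *m invmx (h y)).
  apply/rowP => a; rewrite !mxE mulr_sumr.
  under [RHS]eq_bigr => s _ do rewrite mxE christoffel1_sum// mulrA mulr_sumr mulr_suml.
  rewrite [RHS]exchange_big /=; apply: eq_bigr => b _.
  under [RHS]eq_bigr => s _ do rewrite mulr_sumr mulr_suml.
  rewrite [RHS]exchange_big /=; apply: eq_bigr => c _.
  rewrite /christoffel mulr_sumr !mulr_suml; apply: eq_bigr => s _.
  rewrite (bigD1 s)//= big1 ?addr0; last first.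
    by move=> k ks; rewrite mxE eqxx /= (negbTE ks) mulr0 mul0r.
  rewrite mxE !eqxx mulr1 -[in LHS]Is mxE.
  by ring.
rewrite qE /bilin -!scalemxAl mulmxKV// mxE; congr (_ * _).
rewrite [LHS]mxE [RHS]christoffel1_sum//.
under [LHS]eq_bigr => s _ do rewrite mxE christoffel1_sum// mulr_suml.
rewrite [LHS]exchange_big /=; apply: eq_bigr => b _.
under [LHS]eq_bigr => s _ do rewrite mulr_suml.
rewrite [LHS]exchange_big /=; apply: eq_bigr => c _.
apply: eq_bigr => s _.
rewrite (bigD1 s)//= big1 ?addr0; last first.
  by move=> k ks; rewrite mxE eqxx /= (negbTE ks) mulr0 mul0r.
by rewrite !mxE !eqxx mulr1 mulrAC.
Qed.

End LeviCivita.

(** * The mean curvature field and its invariance *)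

(* Otherwise failing unifications between derivatives unfold to limits of filters. *)
#[local] Opaque derive.

Section MeanCurvatureField.
Context {R : realType} {n m : nat}.
Variables (h om : 'rV[R]_m -> 'M[R]_m) (F : 'rV[R]_n -> 'rV[R]_m).

(* For a Lagrangian immersion these are the 1-form [omega (H, .)] and its metric dual,
   which is [J H] as a vector field on the source: see tangential_mean_curvature. *)
Definition mcform (x : 'rV[R]_n) : 'rV[R]_n :=
  \sum_i \sum_j invmx (induced_metric h F x) i j *:
    (cov2 h F i j x *m om (F x) *m ('J F x)^T).

Definition mcfield (x : 'rV[R]_n) : 'rV[R]_n := mcform x *m invmx (induced_metric h F x).

(** [J h = om] turns the tangential projection into a pairing by [om] with the tangent vectors, and
    isotropy kills every tangential correction [s i j *m 'J F x]. Taking for [s] the tangential part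
    of [cov2] gives the mean curvature, taking the Christoffel symbols of the induced metric gives
    the tension. Both divergences thus agree without a comparison of the two vectors themselves. *)
Lemma tangential_mcfield J x (s : 'I_n -> 'I_n -> 'rV[R]_n) :
  'J F x *m om (F x) *m ('J F x)^T = 0 -> J (F x) *m h (F x) = om (F x) ->
  tangential h F x ((\sum_i \sum_j invmx (induced_metric h F x) i j *:
    (cov2 h F i j x - s i j *m 'J F x)) *m J (F x)) = mcfield x.
Proof.
move=> lagr Jh; rewrite /tangential /mcfield -(mulmxA _ (J _)) Jh; congr (_ *m _).
rewrite !mulmx_suml; apply: eq_bigr => i _; rewrite !mulmx_suml; apply: eq_bigr => j _.
rewrite -!scalemxAl; congr (_ *: _).
by rewrite !mulmxBl -!mulmxA [X in _ - s i j *m X]mulmxA lagr mulmx0 subr0.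
Qed.

Lemma tangential_mean_curvature J x :
  'J F x *m om (F x) *m ('J F x)^T = 0 -> J (F x) *m h (F x) = om (F x) ->
  tangential h F x (mean_curvature h F x *m J (F x)) = mcfield x.
Proof. by move=> lagr Jh; exact: tangential_mcfield. Qed.

Lemma tangential_tension J x : differentiable F x ->
  'J F x *m om (F x) *m ('J F x)^T = 0 -> J (F x) *m h (F x) = om (F x) ->
  tangential h F x (tension h F x *m J (F x)) = mcfield x.
Proof.
move=> dF lagr Jh.
pose s i j : 'rV_n := \row_k christoffel (induced_metric h F) x k i j.
suff -> : tension h F x = \sum_i \sum_j invmx (induced_metric h F x) i j *:
    (cov2 h F i j x - s i j *m 'J F x) by exact: tangential_mcfield.
apply: eq_bigr => i _; apply: eq_bigr => j _; congr (_ *: (_ - _)).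
rewrite mulmx_sum_row; apply: eq_bigr => k _.
by rewrite mxE row_jacobian.
Qed.

Lemma cov2_lower i j x w :
  differentiable h (F x) -> (h (F x))^T = h (F x) -> h (F x) \in unitmx ->
  bilin (h (F x)) (cov2 h F i j x) w = bilin (h (F x)) (pd i (pd j F) x) w +
    2^-1 * christoffel1 h (F x) (pd i F x) (pd j F x) w.
Proof. by move=> dh hs hu; rewrite /cov2 bilinDl christoffel_lower. Qed.

End MeanCurvatureField.

(** * Change of the ambient chart *)

Section AmbientChange.
Context {R : realType} {n m : nat}.
Variables (h h' om om' : 'rV[R]_m -> 'M[R]_m) (F F' : 'rV[R]_n -> 'rV[R]_m).
Variables (T : 'rV[R]_m -> 'rV[R]_m) (A : set 'rV[R]_n) (B : set 'rV[R]_m).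
Hypotheses (oA : open A) (oB : open B) (sF : smooth_on A F) (sT : smooth_on B T).
Hypotheses (FB : forall x, A x -> B (F x)) (F'E : forall x, A x -> F' x = T (F x)).
Hypotheses (Tu : forall y, B y -> 'J T y \in unitmx).
Hypotheses (dh' : forall y, B y -> differentiable h' (T y)).
Hypotheses (h's : forall y, B y -> (h' (T y))^T = h' (T y)).
Hypotheses (h'u : forall y, B y -> h' (T y) \in unitmx).
Hypotheses (hE : forall y, B y -> h y = 'J T y *m h' (T y) *m ('J T y)^T).
Hypotheses (omE : forall y, B y -> om y = 'J T y *m om' (T y) *m ('J T y)^T).

Let sJ : smooth_on B (jacobian T) := smooth_jacobian oB sT.
Let dJ y (By : B y) : differentiable (jacobian T) y := smooth_differentiable sJ By.
Let dT y (By : B y) : differentiable T y := smooth_differentiable sT By.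
Let dF x (Ax : A x) : differentiable F x := smooth_differentiable sF Ax.

Let hess (y u v : 'rV[R]_m) : 'rV[R]_m := v *m 'D_u (jacobian T) y.

Let hessC y u v : B y -> hess y u v = hess y v u.
Proof.
move=> By; have hessE a b : hess y a b = 'D_a ('D_b T) y.
  rewrite /hess; have -> : 'D_a ('D_b T) y = 'D_a (fun z => b *m jacobian T z) y.
    by apply: near_eq_derive; apply: open_near oB By _ => z Bz; rewrite deriveEjacobian//; exact: dT.
  rewrite derive_mulmx ?derive_cst ?mul0mx ?add0r//; exact: dJ.
rewrite !hessE; apply/rowP => k.
have sD a : smooth_on B ('D_a T) by exact: smooth_derive.
have e a b : 'D_a ('D_b T) y 0 k = 'D_a ('D_b (fun z => T z 0 k)) y.
  rewrite derive_coord; last exact: smooth_differentiable (sD _) By.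
  apply: near_eq_derive; apply: open_near oB By _ => z Bz.
  by rewrite derive_coord//; exact: dT.
apply: etrans (e u v) (etrans _ (esym (e v u))).
by apply: (derive_commutes oB) By; exact: smooth_entry.
Qed.

Let derive_h y u : B y -> 'D_u h y =
  ('D_u (jacobian T) y *m h' (T y) + 'J T y *m 'D_(u *m 'J T y) h' (T y)) *m ('J T y)^T +
  'J T y *m h' (T y) *m ('D_u (jacobian T) y)^T.
Proof.
move=> By.
have -> : 'D_u h y = 'D_u (fun z => jacobian T z *m (h' \o T) z *m (jacobian T z)^T) y.
  by apply: near_eq_derive; apply: open_near oB By _.
have dhT : differentiable (h' \o T) y by apply: differentiable_comp; [exact: dT|exact: dh'].
rewrite derive_mulmx; [|exact: differentiable_mulmx (dJ By) dhT
  |exact: differentiable_trmx (dJ By)].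
rewrite derive_trmx; last exact: dJ.
rewrite derive_mulmx; [|exact: dJ|exact: dhT].
rewrite derive_comp; [|exact: dT|exact: dh'].
by rewrite deriveEjacobian//; exact: dT.
Qed.

(** Differentiating [h = 'J T *m h' *m ('J T)^T] gives two Hessian terms [P] and one tensorial term
    [Q] in each of the three summands. Since [P] is symmetric in its first two arguments, four of
    the six Hessian terms cancel and the other two coincide. *)
Let christoffel1_change y u v w : B y ->
  christoffel1 h y u v w = 2 * bilin (h' (T y)) (hess y u v) (w *m 'J T y) +
    christoffel1 h' (T y) (u *m 'J T y) (v *m 'J T y) (w *m 'J T y).
Proof.
move=> By.
pose P a b c := bilin (h' (T y)) (hess y a b) (c *m 'J T y).
pose Q a b c := bilin ('D_(a *m 'J T y) h' (T y)) (b *m 'J T y) (c *m 'J T y).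
suff : christoffel1 h y u v w = 2 * P u v w + (Q u v w + Q v u w - Q w u v) by [].
have tri a b c : bilin ('D_a h y) b c = P a b c + Q a b c + P a c b.
  rewrite derive_h// mulmxDl !bilinD; congr (_ + _ + _).
  - by rewrite /P /bilin /hess trmx_mul !mulmxA.
  - by rewrite bilin_congr.
  - rewrite /P -[in RHS](h's By) bilin_trmx.
    by rewrite /bilin /hess trmx_mul !mulmxA.
have PC a b c : P a b c = P b a c by rewrite /P hessC.
have -> : christoffel1 h y u v w = (P u v w + Q u v w + P u w v) +
    (P v u w + Q v u w + P v w u) - (P w u v + Q w u v + P w v u).
  by congr (_ + _ - _); exact: tri.
clearbody P Q; rewrite (PC v u) (PC w u) (PC w v).
by ring.
Qed.

Let pd_change j x : A x -> pd j F' x = pd j F x *m 'J T (F x).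
Proof.
move=> Ax; rewrite /pd (_ : 'D_ _ F' x = 'D_(delta_mx 0 j) (T \o F) x); last first.
  exact: near_eq_derive (open_near oA Ax F'E).
rewrite derive_comp; [|exact: dF|by apply: dT; exact: FB].
by rewrite deriveEjacobian//; apply: dT; exact: FB.
Qed.

Lemma jacobian_ambient x : A x -> 'J F' x = 'J F x *m 'J T (F x).
Proof.
move=> Ax.
have dF' : differentiable F' x.
  apply: (@near_eq_differentiable _ _ _ (T \o F)).
    by apply: open_near oA Ax _ => y Ay; rewrite F'E.
  by apply: differentiable_comp; [exact: dF|apply: dT; exact: FB].
apply/row_matrixP => i.
apply: etrans (row_jacobian i dF') (etrans (pd_change i Ax) _).
by rewrite -(row_jacobian i (dF Ax)) -row_mul.
Qed.

Lemma induced_metric_ambient x : A x -> induced_metric h' F' x = induced_metric h F x.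
Proof.
move=> Ax; rewrite /induced_metric jacobian_ambient// F'E// hE; last exact: FB.
by rewrite trmx_mul !mulmxA.
Qed.

(** The Hessian of [T] produced by the second derivatives of [T \o F] is exactly the inhomogeneous
    term of the Christoffel symbols. The two sides are compared after lowering the index with the
    nondegenerate form [h'], where [christoffel1_change] applies. *)
Let cov2_ambient i j x : A x -> cov2 h' F' i j x = cov2 h F i j x *m 'J T (F x).
Proof.
move=> Ax; have By := FB Ax.
have dh : differentiable h (F x).
  apply: (@near_eq_differentiable _ _ _ (fun z => jacobian T z *m (h' \o T) z *m (jacobian T z)^T)).
    by apply: open_near oB By _ => z Bz; rewrite hE.
  apply: differentiable_mulmx; last exact: differentiable_trmx (dJ By).
  apply: differentiable_mulmx; first exact: dJ.
  by apply: differentiable_comp; [exact: dT|exact: dh'].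
have hs : (h (F x))^T = h (F x) by rewrite hE// !trmx_mul trmxK h's// mulmxA.
have hu : h (F x) \in unitmx by rewrite hE// !unitmx_mul unitmx_tr Tu// h'u.
have sD : smooth_on A (pd j F) by exact: smooth_derive.
have pd2 : pd i (pd j F') x = pd i (pd j F) x *m 'J T (F x) +
    hess (F x) (pd i F x) (pd j F x).
  have -> : pd i (pd j F') x = pd i (fun y => pd j F y *m (jacobian T \o F) y) x.
    by apply: near_eq_derive; apply: open_near oA Ax _ => y Ay; rewrite pd_change.
  rewrite /pd derive_mulmx; [|exact: smooth_differentiable sD Ax|].
    apply: (congr1 (fun M => 'D_(delta_mx 0 i) (pd j F) x *m 'J T (F x) + pd j F x *m M)).
    exact: derive_comp (dF Ax) (dJ By).
  by apply: differentiable_comp; [exact: dF|exact: dJ].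
have key w : bilin (h' (F' x)) (cov2 h' F' i j x) w =
    bilin (h' (F' x)) (cov2 h F i j x *m 'J T (F x)) w.
  have [w' ->] : exists w', w = w' *m 'J T (F x).
    by exists (w *m invmx ('J T (F x))); rewrite mulmxKV// Tu.
  have e1 := @cov2_lower _ _ _ h' F' i j x (w' *m 'J T (F x)).
  rewrite F'E// in e1 *; rewrite e1; [|exact: dh'|exact: h's|exact: h'u].
  rewrite pd2 (pd_change i Ax) (pd_change j Ax) bilinDl -!bilin_congr -hE// cov2_lower//.
  rewrite christoffel1_change// -addrA; congr (_ + _).
  by rewrite [RHS]mulrDr mulKf.
apply: (can_inj (mulmxK (h'u By))).
apply/rowP => k; have := key (delta_mx 0 k).
by rewrite /bilin trmx_delta -!colE !mxE F'E.
Qed.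

Lemma mcfield_ambient x : A x -> mcfield h' om' F' x = mcfield h om F x.
Proof.
move=> Ax; rewrite /mcfield /mcform (induced_metric_ambient Ax).
apply: (congr1 (mulmx^~ _)); apply: eq_bigr => i _; apply: eq_bigr => j _.
apply: (congr1 ( *:%R _)).
rewrite (cov2_ambient i j Ax) (jacobian_ambient Ax) (F'E Ax) (omE (FB Ax)).
by rewrite trmx_mul !mulmxA.
Qed.

End AmbientChange.

#[local] Opaque jacobian.

(** * Change of the source chart *)

Lemma invmx_congr {R : realType} n (S G : 'M[R]_n) : S \in unitmx -> G \in unitmx ->
  invmx (S *m G *m S^T) = invmx S^T *m invmx G *m invmx S.
Proof.
move=> Su Gu; have SGu : S *m G *m S^T \in unitmx by rewrite !unitmx_mul unitmx_tr Su Gu.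
apply: (can_inj (mulKmx SGu)); rewrite mulmxV// !mulmxA.
by rewrite mulmxK ?unitmx_tr// mulmxK// mulmxV.
Qed.

(** The sum in the trace is the product rule for [S *m G *m S^T], with [D] and [E] the derivatives
    of [S] and [G]. The two terms containing [D] have the same trace, and the resulting factor 2
    meets the factor 1/2 in the divergence. *)
Lemma trace_congr {R : realType} n (S G D E : 'M[R]_n) :
  S \in unitmx -> G^T = G -> G \in unitmx ->
  \tr (invmx S^T *m invmx G *m invmx S *m (D *m G *m S^T + S *m E *m S^T + S *m G *m D^T)) =
  2 * \tr (invmx S *m D) + \tr (invmx G *m E).
Proof.
move=> Su Gs Gu; rewrite !mulmxDr !raddfD /=.
set a := \tr (invmx S *m D); set b := \tr (invmx G *m E).
have -> : \tr (invmx S^T *m invmx G *m invmx S *m (D *m G *m S^T)) = a.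
  rewrite !mulmxA mxtrace_mulC !mulmxA mulmxV ?unitmx_tr// mul1mx.
  by rewrite -!mulmxA mxtrace_mulC -!mulmxA mulmxV// mulmx1.
have -> : \tr (invmx S^T *m invmx G *m invmx S *m (S *m E *m S^T)) = b.
  rewrite !mulmxA mxtrace_mulC !mulmxA mulmxV ?unitmx_tr// mul1mx.
  by rewrite mulmxKV.
have -> : \tr (invmx S^T *m invmx G *m invmx S *m (S *m G *m D^T)) = a.
  rewrite !mulmxA mulmxKV// mulmxKV// -mxtrace_tr trmx_mul trmxK trmx_inv trmxK.
  by rewrite mxtrace_mulC.
by ring.
Qed.

Section SourceChange.
Context {R : realType} {n m : nat}.
Variables (s : 'rV[R]_n -> 'rV[R]_n) (A A' : set 'rV[R]_n).
Hypotheses (oA : open A) (oA' : open A') (ss : smooth_on A s).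
Hypotheses (sA : forall x, A x -> A' (s x)).
Hypotheses (su : forall x, A x -> 'J s x \in unitmx).

Let sJ : smooth_on A (jacobian s) := smooth_jacobian oA ss.
Let dJ x (Ax : A x) : differentiable (jacobian s) x := smooth_differentiable sJ Ax.
Let ds x (Ax : A x) : differentiable s x := smooth_differentiable ss Ax.

(** Symmetry of the second derivatives of [s], phrased for its Jacobian matrix: the direction of
    differentiation and the row index trade places. *)
Lemma row_derive_jacobian x u i : A x -> row i ('D_u (jacobian s) x) =
  u *m 'D_(delta_mx 0 i) (jacobian s) x.
Proof.
move=> Ax.
have sD a : smooth_on A ('D_a s) by exact: smooth_derive.
have DJ (a b : 'rV[R]_n) : b *m 'D_a (jacobian s) x = 'D_a ('D_b s) x.
  apply: etrans (_ : 'D_a (fun z => b *m jacobian s z) x = _).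
    rewrite derive_mulmx; [|exact: differentiable_cst|exact: dJ].
    by rewrite derive_cst mul0mx add0r.
  apply: near_eq_derive; apply: open_near oA Ax _ => z Az.
  by rewrite deriveEjacobian//; exact: ds.
rewrite rowE !DJ; apply/rowP => k.
have e (a b : 'rV[R]_n) : 'D_a ('D_b s) x 0 k = 'D_a ('D_b (fun z => s z 0 k)) x.
  rewrite derive_coord; last exact: smooth_differentiable (sD _) Ax.
  apply: near_eq_derive; apply: open_near oA Ax _ => z Az.
  by rewrite derive_coord//; exact: ds.
apply: etrans (e _ _) (etrans _ (esym (e _ _))).
by apply: (derive_commutes oA) Ax; exact: smooth_entry.
Qed.

Section Divergence.
Variables (g g' : 'rV[R]_n -> 'M[R]_n) (X X' : 'rV[R]_n -> 'rV[R]_n).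
Hypotheses (g'd : forall y, A' y -> differentiable g' y).
Hypotheses (g's : forall y, A' y -> (g' y)^T = g' y).
Hypotheses (g'u : forall y, A' y -> g' y \in unitmx).
Hypotheses (gE : forall x, A x -> g x = 'J s x *m g' (s x) *m ('J s x)^T).
Hypotheses (Xd : forall x, A x -> differentiable X x).
Hypotheses (X'd : forall y, A' y -> differentiable X' y).
Hypotheses (XE : forall x, A x -> X x *m 'J s x = X' (s x)).

(** Passing from [X] to [X'] changes the trace of the Jacobian by [\tr (invmx S *m DS)], because the
    second derivatives of [s] enter. The metric term of the divergence changes by the opposite
    amount according to [trace_congr]. *)
Lemma divergence_source x : A x -> divergence g X x = divergence g' X' (s x).
Proof.
move=> Ax; have Ax' := sA Ax.
have dg's : differentiable (g' \o s) x.
  by apply: differentiable_comp; [exact: ds|exact: g'd].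
have dg : differentiable g x.
  apply: (@near_eq_differentiable _ _ _ (fun z => jacobian s z *m (g' \o s) z *m (jacobian s z)^T)).
    by apply: open_near oA Ax _ => z Bz; rewrite gE.
  apply: differentiable_mulmx; last exact: differentiable_trmx (dJ Ax).
  by apply: differentiable_mulmx; first exact: dJ.
have gsn : \forall z \near x, (g z)^T = g z.
  apply: open_near oA Ax _ => z Az.
  by rewrite gE// !trmx_mul trmxK g's ?mulmxA//; exact: sA.
rewrite (divergenceE dg gsn (Xd Ax)).
rewrite (divergenceE (g'd Ax') (open_near oA' Ax' g's) (X'd Ax')).
set S := 'J s x; have Su : S \in unitmx by exact: su.
set DS := 'D_(X x) (jacobian s) x.
(* Differentiate [XE] row by row; [row_derive_jacobian] assembles the derivatives of the Jacobian
   contracted with [X x] into the single matrix [DS]. *)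
have JX : 'J X x *m S + DS = S *m 'J X' (s x).
  apply/row_matrixP => i.
  have rowD (B C : 'M[R]_n) : row i (B + C) = row i B + row i C.
    by apply/rowP => k; rewrite !mxE.
  have e1 : row i ('J X x *m S) = 'D_(delta_mx 0 i) X x *m S.
    exact: etrans (row_mul _ _ _) (congr1 (mulmx^~ S) (row_jacobian i (Xd Ax))).
  apply: etrans (rowD _ _) (etrans (congr2 +%R e1 (row_derive_jacobian (X x) i Ax)) _).
  apply: etrans (esym (derive_mulmx _ (Xd Ax) (dJ Ax))) _.
  apply: etrans (_ : 'D_(delta_mx 0 i) (X' \o s) x = _).
    by apply: near_eq_derive; apply: open_near oA Ax _ => z Az; rewrite XE.
  rewrite (derive_comp _ (ds Ax) (X'd Ax')) (deriveEjacobian _ (ds Ax)).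
  apply: etrans (deriveEjacobian _ (X'd Ax')) _.
  exact: etrans (congr1 (mulmx^~ _) (esym (rowE i S))) (esym (row_mul _ _ _)).
have trJ : \tr ('J X' (s x)) = \tr ('J X x) + \tr (invmx S *m DS).
  rewrite -[X in \tr X = _](mulKmx Su) -JX mulmxDr raddfD /= mulmxA mxtrace_mulC.
  by rewrite mulmxA mulmxV// mul1mx.
have Dg : 'D_(X x) g x = DS *m g' (s x) *m S^T + S *m 'D_(X' (s x)) g' (s x) *m S^T +
    S *m g' (s x) *m DS^T.
  apply: etrans (_ : 'D_(X x) (fun z => jacobian s z *m (g' \o s) z *m (jacobian s z)^T) x = _).
    by apply: near_eq_derive; apply: open_near oA Ax _ => z Az; rewrite gE.
  rewrite derive_mulmx; [|exact: differentiable_mulmx (dJ Ax) dg's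
    |exact: differentiable_trmx (dJ Ax)].
  rewrite (derive_trmx _ (dJ Ax)) (derive_mulmx _ (dJ Ax) dg's).
  rewrite (derive_comp _ (ds Ax) (g'd Ax')) (deriveEjacobian _ (ds Ax)) XE//.
  by rewrite mulmxDl.
have gu := g'u Ax'.
have gi : invmx (g x) = invmx S^T *m invmx (g' (s x)) *m invmx S.
  by rewrite gE// invmx_congr.
apply: etrans (congr1 (fun M => \tr ('J X x) + 2^-1 * \tr M) (congr2 mulmx gi Dg)) _.
apply: etrans _ (congr1 (fun z => z + _) (esym trJ)).
rewrite (trace_congr DS _ Su (g's Ax') gu) -addrA; apply: (congr1 (+%R _)).
by rewrite mulrDr mulKf.
Qed.

End Divergence.
End SourceChange.

Section ChristoffelVector.
Context {R : realType} {n m : nat}.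
Implicit Types (h : 'rV[R]_m -> 'M[R]_m) (F : 'rV[R]_n -> 'rV[R]_m).

Definition christoffel_vec h (y u v : 'rV[R]_m) : 'rV[R]_m :=
  \row_a \sum_b \sum_c christoffel h y a b c * u 0 b * v 0 c.

Lemma cov2E h F i j x : cov2 h F i j x =
  pd i (pd j F) x + christoffel_vec h (F x) (pd i F x) (pd j F x).
Proof. by []. Qed.

Lemma christoffel_vec_linearl h y v : linear (christoffel_vec h y ^~ v).
Proof.
move=> a u u'; apply/rowP => k; rewrite !mxE mulr_sumr -big_split; apply: eq_bigr => b _ /=.
rewrite mulr_sumr -big_split; apply: eq_bigr => c _ /=.
by rewrite !mxE; ring.
Qed.

Lemma christoffel_vec_linearr h y u : linear (christoffel_vec h y u).
Proof.
move=> a v v'; apply/rowP => k; rewrite !mxE mulr_sumr -big_split; apply: eq_bigr => b _ /=.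
rewrite mulr_sumr -big_split; apply: eq_bigr => c _ /=.
by rewrite !mxE; ring.
Qed.

Lemma christoffel_vec_sum (I J : finType) h y (a : I -> R) (b : J -> R) u v :
  christoffel_vec h y (\sum_i a i *: u i) (\sum_j b j *: v j) =
  \sum_i \sum_j (a i * b j) *: christoffel_vec h y (u i) (v j).
Proof.
have sumL v0 : christoffel_vec h y (\sum_i a i *: u i) v0 =
    \sum_i christoffel_vec h y (a i *: u i) v0.
  exact: (linear_sum (linear_of (@christoffel_vec_linearl h y v0))).
have scaleL c u0 v0 : christoffel_vec h y (c *: u0) v0 = c *: christoffel_vec h y u0 v0.
  exact: (linearZ_LR (linear_of (@christoffel_vec_linearl h y v0))).
have sumR u0 : christoffel_vec h y u0 (\sum_j b j *: v j) =
    \sum_j christoffel_vec h y u0 (b j *: v j).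
  exact: (linear_sum (linear_of (@christoffel_vec_linearr h y u0))).
have scaleR c u0 v0 : christoffel_vec h y u0 (c *: v0) = c *: christoffel_vec h y u0 v0.
  exact: (linearZ_LR (linear_of (@christoffel_vec_linearr h y u0))).
rewrite sumL; apply: eq_bigr => i _; rewrite scaleL sumR scaler_sumr.
by apply: eq_bigr => j _; rewrite scaleR scalerA.
Qed.

End ChristoffelVector.

Section SourceChangeField.
Context {R : realType} {n m : nat}.
Variables (h om : 'rV[R]_m -> 'M[R]_m) (F F' : 'rV[R]_n -> 'rV[R]_m).
Variables (s : 'rV[R]_n -> 'rV[R]_n) (A A' : set 'rV[R]_n).
Hypotheses (oA : open A) (oA' : open A') (ss : smooth_on A s).
Hypotheses (sA : forall x, A x -> A' (s x)).
Hypotheses (su : forall x, A x -> 'J s x \in unitmx).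
Hypotheses (sF' : smooth_on A' F') (FE : forall x, A x -> F x = F' (s x)).
Hypotheses (lagr : forall y, A' y -> 'J F' y *m om (F' y) *m ('J F' y)^T = 0).
Hypotheses (gu : forall y, A' y -> induced_metric h F' y \in unitmx).

Let sJ : smooth_on A (jacobian s) := smooth_jacobian oA ss.
Let dJ x (Ax : A x) : differentiable (jacobian s) x := smooth_differentiable sJ Ax.
Let ds x (Ax : A x) : differentiable s x := smooth_differentiable ss Ax.
Let dF' y (Ay : A' y) : differentiable F' y := smooth_differentiable sF' Ay.

Lemma jacobian_source x : A x -> 'J F x = 'J s x *m 'J F' (s x).
Proof.
move=> Ax; rewrite -(jacobian_comp (ds Ax) (dF' (sA Ax))).
have dFs : differentiable (F' \o s) x.
  by apply: differentiable_comp; [exact: ds|apply: dF'; exact: sA].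
have E : \forall z \near x, (F' \o s) z = F z.
  by apply: open_near oA Ax _ => z Az; rewrite FE.
apply/row_matrixP => i.
apply: etrans (row_jacobian i (near_eq_differentiable E dFs)) _.
apply: etrans _ (esym (row_jacobian i dFs)); apply/esym.
exact: near_eq_derive.
Qed.

Lemma induced_metric_source x : A x ->
  induced_metric h F x = 'J s x *m induced_metric h F' (s x) *m ('J s x)^T.
Proof.
by move=> Ax; rewrite /induced_metric jacobian_source// FE// trmx_mul !mulmxA.
Qed.

Let pd_source j x : A x -> pd j F x = \sum_b 'J s x j b *: pd b F' (s x).
Proof.
move=> Ax; apply: etrans (_ : 'D_(delta_mx 0 j) (F' \o s) x = _).
  apply: near_eq_derive; apply: open_near oA Ax _ => z Az; exact: FE.
rewrite (derive_comp _ (ds Ax) (dF' (sA Ax))) (derive_basis _ (dF' (sA Ax))).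
apply: eq_bigr => b _; rewrite (deriveEjacobian _ (ds Ax)) -rowE.
by rewrite [in LHS]mxE.
Qed.

(** [cov2] uses no connection on the source, so it is tensorial only modulo tangent vectors. The row
    [q] collects the second derivatives of [s]; its value is left existential because isotropy
    annihilates it in [mcfield_source]. *)
Let cov2_source i j x : A x -> exists q : 'rV[R]_n, cov2 h F i j x = q *m 'J F' (s x) +
  \sum_a \sum_b ('J s x i a * 'J s x j b) *: cov2 h F' a b (s x).
Proof.
move=> Ax; have Ax' := sA Ax.
exists (\row_b pd i (fun y => 'J s y j b) x).
under [X in _ = _ + X]eq_bigr do under eq_bigr do rewrite cov2E scalerDr.
under [X in _ = _ + X]eq_bigr do rewrite big_split /=.
rewrite big_split /= cov2E addrA; congr (_ + _); last first.
  by rewrite (pd_source i Ax) (pd_source j Ax) FE// christoffel_vec_sum.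
have sD b : smooth_on A' (pd b F') by exact: smooth_derive.
have dD b : differentiable (pd b F' \o s) x.
  by apply: differentiable_comp; [exact: ds|exact: smooth_differentiable (sD b) Ax'].
have dS b : differentiable (fun y => 'J s y j b) x by apply: differentiable_entry (dJ Ax).
have Dterm b : is_derive x (delta_mx 0 i) (fun y => 'J s y j b *: pd b F' (s y))
    (pd i (fun y => 'J s y j b) x *: pd b F' (s x) +
     \sum_a ('J s x i a * 'J s x j b) *: pd a (pd b F') (s x)).
  apply: DeriveDef; first exact: diff_derivable (differentiable_scale (dS b) (dD b)).
  apply: etrans (derive_scale _ (dS b) (dD b)) _; apply: (congr1 (+%R _)).
  rewrite (derive_comp _ (ds Ax) (smooth_differentiable (sD b) Ax')).
  rewrite (derive_basis _ (smooth_differentiable (sD b) Ax')) scaler_sumr.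
  apply: eq_bigr => a _; rewrite scalerA mulrC; congr (_ * _ *: _).
  by rewrite (deriveEjacobian _ (ds Ax)) -rowE [in LHS]mxE.
have -> : pd i (pd j F) x = 'D_(delta_mx 0 i) (\sum_b (fun y => 'J s y j b *: pd b F' (s y))) x.
  apply: near_eq_derive; apply: open_near oA Ax _ => z Az.
  by rewrite (pd_source j Az) fct_sumE.
rewrite derive_sum; last by move=> b; have [] := Dterm b.
rewrite (eq_bigr _ (fun b _ => @derive_val _ _ _ _ _ _ _ (Dterm b))) big_split /=.
apply: congr2; last exact: exchange_big.
apply: etrans _ (esym (mulmx_sum_row _ _)); apply: eq_bigr => b _.
by rewrite mxE; apply: congr1; apply/esym/(row_jacobian b (dF' Ax')).
Qed.

Lemma mcfield_source x : A x -> mcfield h om F x *m 'J s x = mcfield h om F' (s x).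
Proof.
move=> Ax; have Ax' := sA Ax.
set S := 'J s x; have Su : S \in unitmx by exact: su.
pose K := invmx (induced_metric h F x); pose K' := invmx (induced_metric h F' (s x)).
have gi : S^T *m K *m S = K'.
  have G'u := gu Ax'.
  rewrite /K /K' (induced_metric_source Ax) -/S invmx_congr// !mulmxA.
  by rewrite mulmxV ?unitmx_tr// mul1mx mulmxKV.
have formE : mcform h om F x = mcform h om F' (s x) *m S^T.
  suff : \sum_i \sum_j K i j *: (cov2 h F i j x *m om (F x) *m ('J F x)^T) =
    (\sum_a \sum_b K' a b *: (cov2 h F' a b (s x) *m om (F' (s x)) *m ('J F' (s x))^T)) *m S^T.
    by [].
  rewrite -gi mulmx_suml; clearbody K.
  (* Both sides are compared with one fourfold sum. Summing over [i, j] first produces the entries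
     of [S^T *m K *m S]; summing over [a, b] first produces the transformed second derivatives. *)
  transitivity (\sum_a \sum_b \sum_i \sum_j
     (K i j * (S i a * S j b)) *:
     (cov2 h F' a b (s x) *m om (F' (s x)) *m ('J F' (s x))^T *m S^T)); last first.
    apply: eq_bigr => a _; rewrite mulmx_suml; apply: eq_bigr => b _.
    rewrite -scalemxAl [in RHS]mxE scaler_suml [LHS]exchange_big /=; apply: eq_bigr => j _.
    rewrite [in RHS]mxE mulr_suml scaler_suml; apply: eq_bigr => i _.
    by rewrite [in RHS]mxE; congr (_ *: _); ring.
  under [RHS]eq_bigr do rewrite exchange_big /=.
  rewrite [RHS]exchange_big /=; apply: eq_bigr => i _.
  under [RHS]eq_bigr do rewrite exchange_big /=.
  rewrite [RHS]exchange_big /=; apply: eq_bigr => j _.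
  have [q ->] := cov2_source i j Ax.
  rewrite (jacobian_source Ax) FE// trmx_mul !mulmxDl !mulmxA.
  rewrite -(mulmxA q) -(mulmxA q) (lagr Ax') mulmx0 mul0mx add0r.
  rewrite !mulmx_suml scaler_sumr; apply: eq_bigr => a _.
  rewrite !mulmx_suml scaler_sumr; apply: eq_bigr => b _.
  by rewrite -!scalemxAl scalerA.
apply: etrans (congr1 (fun f => f *m K *m S) formE) _.
by rewrite -!mulmxA (mulmxA S^T) gi.
Qed.

End SourceChangeField.

(** * Dependence on the jets of the potential *)

Section SmoothGeometry.
Context {R : realType} {V : normedModType R} {A : set V} (oA : open A).

Lemma smooth_scale m n (f : V -> R) (g : V -> 'M[R]_(m, n)) :
  smooth_on A f -> smooth_on A g -> smooth_on A (fun x => f x *: g x).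
Proof.
move=> sf sg; apply: (smooth_mx oA) => i j; under eq_fun do rewrite mxE.
by apply: (smooth_mul oA) => //; exact: smooth_entry.
Qed.

Lemma smooth_matrix m n (f : V -> 'I_m -> 'I_n -> R) :
  (forall i j, smooth_on A (fun x => f x i j)) -> smooth_on A (fun x => \matrix_(i, j) f x i j).
Proof. by move=> sf; apply: (smooth_mx oA) => i j; under eq_fun do rewrite mxE; exact: sf. Qed.

Lemma smooth_christoffel_vec m (h : 'rV[R]_m -> 'M[R]_m) (B : set 'rV[R]_m)
    (F u v : V -> 'rV[R]_m) : open B -> smooth_on B h ->
  (forall y, B y -> h y \in unitmx) -> smooth_on A F -> smooth_on A u -> smooth_on A v ->
  (forall x, A x -> B (F x)) -> smooth_on A (fun x => christoffel_vec h (F x) (u x) (v x)).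
Proof.
move=> oB sh hu sF su sv FB; apply: (smooth_mx oA) => i a.
under eq_fun do rewrite mxE.
apply: (smooth_sum oA) => b; apply: (smooth_sum oA) => c.
apply: (smooth_mul oA); last exact: smooth_entry.
apply: (smooth_mul oA); last exact: smooth_entry.
apply: (@smooth_comp _ _ _ oA _ B (fun y => christoffel h y a b c) F) => //.
  exact: findim_matrix.
apply: (smooth_mul oB); first exact: smooth_cst.
apply: (smooth_sum oB) => l; apply: (smooth_mul oB).
  by apply: (smooth_entry oB); exact: smooth_invmx.
have sd i' j k : smooth_on B (pd i' (fun y => h y j k)).
  by apply: smooth_derive; exact: smooth_entry.
by apply: (smooth_add oB); [apply: (smooth_add oB)|apply: (smooth_opp oB)]; exact: sd.
Qed.

End SmoothGeometry.

Lemma posdef_unitmx {R : realType} n (G : 'M[R]_n) :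
  (forall v, v != 0 -> 0 < bilin G v v) -> G \in unitmx.
Proof.
move=> Gpos; rewrite -row_free_unit; apply: inj_row_free => v vG.
apply/eqP; apply: contraT => v0; have := Gpos v v0.
by rewrite /bilin vG mul0mx mxE ltxx.
Qed.

Section Jets.
Context {R : realType} {n m : nat}.
Local Notation base := ('rV[R]_n * 'rV[R]_n)%type.
Local Notation jet := ('rV[R]_n * 'rV[R]_n * 'M[R]_n)%type.
Implicit Types (jt : jet) (z : base).

Lemma findim_base : findim base.
Proof. by apply: findim_prod; exact: findim_matrix. Qed.

Definition grad (u : 'rV[R]_n -> R) (x : 'rV[R]_n) : 'rV[R]_n := \row_i pd i u x.
Definition hessian (u : 'rV[R]_n -> R) (x : 'rV[R]_n) : 'M[R]_n :=
  \matrix_(i, j) pd i (pd j u) x.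
Definition jet2 u x : jet := ((x, grad u x), hessian u x).

(* The derivative of jet2 u in the a-th direction at a point where the second and third
   derivatives of u are P and T *)
Definition jet_dir (P : 'M[R]_n) (T : 'I_n -> 'I_n -> 'I_n -> R) (a : 'I_n) : jet :=
  ((delta_mx 0 a, row a P), \matrix_(k, l) T a k l).

(* On jet2 u this is the derivative of f (x, grad u x) in the i-th direction. *)
Definition total_derive {W : normedModType R} (f : base -> W) (i : 'I_n) (jt : jet) : W :=
  'D_(delta_mx 0 i, 0) f jt.1 + \sum_k jt.2 i k *: 'D_(0, delta_mx 0 k) f jt.1.

Lemma total_deriveE {W : normedModType R} (f : base -> W) i jt :
  differentiable f jt.1 -> total_derive f i jt = 'D_(delta_mx 0 i, row i jt.2) f jt.1.
Proof.
move=> df; rewrite [RHS]deriveE//.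
have -> : (delta_mx 0 i, row i jt.2) = (delta_mx 0 i, 0) +
    \sum_k jt.2 i k *: ((0, delta_mx 0 k) : base) :> base.
  have sum1 (F : 'I_n -> base) : (\sum_k F k).1 = \sum_k (F k).1.
    exact: (raddf_sum (linear_of (@fst_is_linear R 'rV[R]_n 'rV[R]_n))).
  have sum2 (F : 'I_n -> base) : (\sum_k F k).2 = \sum_k (F k).2.
    exact: (raddf_sum (linear_of (@snd_is_linear R 'rV[R]_n 'rV[R]_n))).
  apply: injective_projections => /=.
    by rewrite sum1 big1 ?addr0// => k _; exact: scaler0.
  rewrite sum2 add0r [LHS]row_sum_delta; apply: eq_bigr => k _ /=.
  by rewrite mxE.
rewrite linearD linear_sum; congr (_ + _); first by rewrite deriveE.
by apply: eq_bigr => k _; rewrite linearZ /= deriveE.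
Qed.

Variables (h om : 'rV[R]_m -> 'M[R]_m) (psi : base -> 'rV[R]_m).

(** From here on the geometry of a graph is expressed at a jet [((x, p), P)], with an arbitrary
    matrix [P] in place of the Hessian. Jets then form a full vector space, on which the ordinary
    calculus applies; symmetry of [P] is imposed only where isotropy requires it. *)
Definition jet_jacobian jt : 'M[R]_(n, m) := \matrix_(i, a) total_derive psi i jt 0 a.
Definition jet_metric jt : 'M[R]_n :=
  jet_jacobian jt *m h (psi jt.1) *m (jet_jacobian jt)^T.
Definition jet_inverse_metric jt : 'M[R]_n := invmx (jet_metric jt).
(** [cov2] of the graph without the terms in which a third derivative multiplies a vertical
    derivative ['D_(0, delta_mx 0 k) psi]; those are restored in [cov2_jet]. *)
Definition jet_cov2 i j jt : 'rV[R]_m :=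
  total_derive (fun z => 'D_(delta_mx 0 j, 0) psi z) i jt +
  \sum_k jt.2 j k *: total_derive (fun z => 'D_(0, delta_mx 0 k) psi z) i jt +
  christoffel_vec h (psi jt.1) (total_derive psi i jt) (total_derive psi j jt).
Definition jet_field jt : 'rV[R]_n :=
  (\sum_i \sum_j jet_inverse_metric jt i j *:
    (jet_cov2 i j jt *m om (psi jt.1) *m (jet_jacobian jt)^T)) *m jet_inverse_metric jt.
Definition jet_trace (T : 'I_n -> 'I_n -> 'I_n -> R) jt : 'rV[R]_n :=
  \row_k \sum_i \sum_j jet_inverse_metric jt i j * T i j k.

(** The divergence of [jet_field - jet_trace T *m K], with [T] the third derivatives, minus the
    contribution in which the derivative falls on [T] itself. The first sum differentiates
    [jet_field] and the two occurrences of the inverse metric; the last line is the metric term of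
    the divergence. Third derivatives also enter through the direction [jet_dir], so the expression
    is not linear in [T]. *)
Definition lower_order_term (jt : jet) (T : 'I_n -> 'I_n -> 'I_n -> R) : R :=
  let K := jet_inverse_metric jt in
  let X := jet_field jt - jet_trace T jt *m K in
  \sum_a ('D_(jet_dir jt.2 T a) jet_field jt 0 a -
    ((\row_k \sum_i \sum_j 'D_(jet_dir jt.2 T a) jet_inverse_metric jt i j * T i j k) *m K +
     jet_trace T jt *m 'D_(jet_dir jt.2 T a) jet_inverse_metric jt) 0 a) +
  2^-1 * \tr (K *m \sum_a X 0 a *: 'D_(jet_dir jt.2 T a) jet_metric jt).

Variables (Om : set base) (B : set 'rV[R]_m).
Hypotheses (oOm : open Om) (oB : open B).
Hypotheses (spsi : smooth_on Om psi) (psiB : forall z, Om z -> B (psi z)).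
Hypotheses (sh : smooth_on B h) (som : smooth_on B om).
Hypotheses (hs : forall y, B y -> (h y)^T = h y).
Hypotheses (hpos : forall y (v : 'rV[R]_m), B y -> v != 0 -> 0 < bilin (h y) v v).
Hypotheses (symp : forall z a b, Om z ->
  bilin (om (psi z)) ('D_a psi z) ('D_b psi z) = can_form a b).

Let Om2 : set jet := [set jt | Om jt.1].

Let oOm2 : open Om2.
Proof. by apply: open_comp oOm => jt _; exact: cvg_fst. Qed.

Let hu y : B y -> h y \in unitmx.
Proof. by move=> By; apply: posdef_unitmx => v; exact: hpos. Qed.

Let dpsi z (Oz : Om z) : differentiable psi z := smooth_differentiable spsi Oz.

Let smooth_base {p q} (f : base -> 'M[R]_(p, q)) : smooth_on Om f ->
  smooth_on Om2 (fun jt => f jt.1).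
Proof.
move=> sf; apply: (@smooth_comp_mx _ _ _ oOm2 _ _ _ Om f fst) => //.
  exact: findim_base.
apply: (smooth_linear oOm2 (l := linear_of (@fst_is_linear R base 'M[R]_n))).
by move=> x; exact: cvg_fst.
Qed.

Let smooth_entry2 i k : smooth_on Om2 (fun jt : jet => jt.2 i k).
Proof.
apply: (smooth_entry oOm2).
apply: (smooth_linear oOm2 (l := linear_of (@snd_is_linear R base 'M[R]_n))).
by move=> x; exact: cvg_snd.
Qed.

Let smooth_total_derive {p q} (f : base -> 'M[R]_(p, q)) i :
  smooth_on Om f -> smooth_on Om2 (total_derive f i).
Proof.
move=> sf; apply: (smooth_add oOm2); first exact: smooth_base (smooth_derive _ sf).
apply: (smooth_sum oOm2) => k; apply: (smooth_scale oOm2); first exact: smooth_entry2.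
exact: smooth_base (smooth_derive _ sf).
Qed.

Let smooth_jet_jacobian : smooth_on Om2 jet_jacobian.
Proof.
by apply: (smooth_matrix oOm2) => i a; apply: (smooth_entry oOm2); exact: smooth_total_derive.
Qed.

Let smooth_comp_psi (f : 'rV[R]_m -> 'M[R]_m) : smooth_on B f ->
  smooth_on Om2 (fun jt => f (psi jt.1)).
Proof.
move=> sf; apply: (@smooth_base _ _ (f \o psi)).
by apply: (@smooth_comp_mx _ _ _ oOm _ _ _ B f psi) => //; exact: findim_matrix.
Qed.

Lemma smooth_jet_metric : smooth_on Om2 jet_metric.
Proof.
apply: (smooth_mulmx oOm2); last exact: smooth_trmx.
by apply: (smooth_mulmx oOm2) => //; exact: smooth_comp_psi.
Qed.

(** A tangent vector [v] of the base lifts to the tangent vector [(v, v *m P)] of a graph whose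
    gradient has derivative [P]. In this form the symplectic hypothesis can be evaluated by
    [can_form]. *)
Lemma jet_jacobian_mul jt (v : 'rV[R]_n) : Om jt.1 ->
  v *m jet_jacobian jt = 'D_(v, v *m jt.2) psi jt.1.
Proof.
move=> Oz; rewrite [LHS]mulmx_sum_row.
have -> : (v, v *m jt.2) = \sum_i v 0 i *: ((delta_mx 0 i, row i jt.2) : base) :> base.
  have sum1 (F : 'I_n -> base) : (\sum_k F k).1 = \sum_k (F k).1.
    exact: (raddf_sum (linear_of (@fst_is_linear R 'rV[R]_n 'rV[R]_n))).
  have sum2 (F : 'I_n -> base) : (\sum_k F k).2 = \sum_k (F k).2.
    exact: (raddf_sum (linear_of (@snd_is_linear R 'rV[R]_n 'rV[R]_n))).
  by apply: injective_projections; rewrite /= ?sum1 ?sum2 ?mulmx_sum_row// [LHS]row_sum_delta.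
rewrite [RHS]deriveE; last exact: dpsi.
rewrite linear_sum; apply: eq_bigr => i _; rewrite linearZ /=; apply: congr1.
rewrite -deriveE; last exact: dpsi.
rewrite -(total_deriveE _ (dpsi Oz)).
by apply/rowP => k; rewrite !mxE.
Qed.

(** Pairing the image of [v] with the vertical derivative in direction [k] returns the coordinate
    [v 0 k]. That graphs are immersed thus follows from the nondegeneracy of the canonical form
    alone. *)
Lemma jet_jacobian_inj jt (v : 'rV[R]_n) : Om jt.1 -> v *m jet_jacobian jt = 0 -> v = 0.
Proof.
move=> Oz v0; apply/rowP => k; rewrite [RHS]mxE.
have := symp (v, v *m jt.2) (0, delta_mx 0 k) Oz.
rewrite -jet_jacobian_mul// v0 /bilin !mul0mx [X in X = _]mxE /can_form /=.
by rewrite trmx0 mulmx0 [X in _ - X]mxE subr0 trmx_delta -colE mxE.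
Qed.

Lemma jet_metric_unit jt : Om jt.1 -> jet_metric jt \in unitmx.
Proof.
move=> Oz; apply: posdef_unitmx => v v0; rewrite bilin_congr; apply: hpos; first exact: psiB.
by apply: contra_neq v0; exact: jet_jacobian_inj.
Qed.

Lemma jet_metric_sym jt : Om jt.1 -> (jet_metric jt)^T = jet_metric jt.
Proof. by move=> Oz; rewrite !trmx_mul trmxK hs ?mulmxA//; exact: psiB. Qed.

Lemma smooth_jet_inverse_metric : smooth_on Om2 jet_inverse_metric.
Proof.
by apply: (smooth_invmx oOm2); [exact: jet_metric_unit|exact: smooth_jet_metric].
Qed.

Lemma smooth_jet_field : smooth_on Om2 jet_field.
Proof.
apply: (smooth_mulmx oOm2); last exact: smooth_jet_inverse_metric.
apply: (smooth_sum oOm2) => i; apply: (smooth_sum oOm2) => j; apply: (smooth_scale oOm2).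
  by apply: (smooth_entry oOm2); exact: smooth_jet_inverse_metric.
apply: (smooth_mulmx oOm2); last exact: smooth_trmx.
apply: (smooth_mulmx oOm2); last exact: smooth_comp_psi.
apply: (smooth_add oOm2); last first.
  apply: (smooth_christoffel_vec oOm2 oB sh hu); [exact: smooth_base|exact: smooth_total_derive..|].
  by move=> jt Oz; exact: psiB.
apply: (smooth_add oOm2); first by apply: smooth_total_derive; exact: smooth_derive.
apply: (smooth_sum oOm2) => k; apply: (smooth_scale oOm2); first exact: smooth_entry2.
by apply: smooth_total_derive; exact: smooth_derive.
Qed.

(** On the lifts of two basis vectors the canonical form equals [P j i - P i j]: a graph is
    Lagrangian exactly because the Hessian is symmetric. *)
Lemma jet_isotropic jt : Om jt.1 -> (jt.2)^T = jt.2 ->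
  jet_jacobian jt *m om (psi jt.1) *m (jet_jacobian jt)^T = 0.
Proof.
move=> Oz Ps; apply/matrixP => i j; rewrite -bilin_delta bilin_congr !jet_jacobian_mul// symp//.
rewrite /can_form /= -!rowE trmx_delta -colE !mxE.
by rewrite -[in X in X - _]Ps mxE subrr.
Qed.

Lemma vertical_pairing jt k : Om jt.1 ->
  'D_(0, delta_mx 0 k) psi jt.1 *m om (psi jt.1) *m (jet_jacobian jt)^T = - delta_mx 0 k.
Proof.
move=> Oz; apply/rowP => p.
have := symp (0, delta_mx 0 k) (delta_mx 0 p, delta_mx 0 p *m jt.2) Oz.
rewrite -jet_jacobian_mul// /bilin trmx_mul mulmxA trmx_delta -colE mxE => ->.
by rewrite /can_form /= mul0mx [X in X - _]mxE sub0r trmx_delta -colE !mxE eqxx.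
Qed.

Section JetOfFunction.
Variables (u : 'rV[R]_n -> R) (A : set 'rV[R]_n).
Hypotheses (oA : open A) (su : smooth_on A u) (uOm : forall x, A x -> Om (x, grad u x)).

Definition third (x : 'rV[R]_n) (i j k : 'I_n) : R := pd i (pd j (pd k u)) x.

Variable F : 'rV[R]_n -> 'rV[R]_m.
Hypothesis FE : forall x, A x -> F x = psi (x, grad u x).

Let smooth_pd k : smooth_on A (pd k u).
Proof. exact: smooth_derive. Qed.

Let smooth_pd2 j k : smooth_on A (pd j (pd k u)).
Proof. exact: smooth_derive. Qed.

Let smooth_third i j k : smooth_on A (fun x => third x i j k).
Proof. exact: smooth_derive. Qed.

Lemma smooth_grad : smooth_on A (grad u).
Proof. exact: (smooth_matrix oA (f := fun x _ k => pd k u x)). Qed.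

Let smooth_hessian : smooth_on A (hessian u).
Proof. exact: (smooth_matrix oA (f := fun x j k => pd j (pd k u) x)). Qed.

Let dgrad x (Ax : A x) : differentiable (grad u) x := smooth_differentiable smooth_grad Ax.
Let dhess x (Ax : A x) : differentiable (hessian u) x :=
  smooth_differentiable smooth_hessian Ax.

Let dbase x : A x -> differentiable (fun y => (y, grad u y)) x.
Proof. by move=> Ax; apply: differentiable_pair => //; exact: dgrad. Qed.

Let djet2 x : A x -> differentiable (jet2 u) x.
Proof. by move=> Ax; apply: differentiable_pair; [exact: dbase|exact: dhess]. Qed.

Let derive_base x a : A x ->
  'D_(delta_mx 0 a) (fun y => (y, grad u y)) x = (delta_mx 0 a, row a (hessian u x)).
Proof.
move=> Ax; apply: etrans (derive_pair _ _ (dgrad Ax)) _ => //.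
rewrite derive_id; apply: congr2 => //; apply/rowP => k.
have e : (fun y => grad u y 0 k) = pd k u by apply/funext => y; rewrite mxE.
apply: etrans (derive_coord _ _ _ (dgrad Ax)) _; rewrite [RHS]mxE [RHS]mxE.
exact: (congr1 (fun f => 'D_(delta_mx 0 a) f x) e).
Qed.

Let derive_jet2 x a : A x ->
  'D_(delta_mx 0 a) (jet2 u) x = jet_dir (hessian u x) (third x) a.
Proof.
move=> Ax; apply: etrans (derive_pair _ (dbase Ax) (dhess Ax)) _.
apply: congr2; first exact: derive_base.
apply/matrixP => k l.
have e : (fun y => hessian u y k l) = pd k (pd l u) by apply/funext => y; rewrite mxE.
apply: etrans (derive_coord _ _ _ (dhess Ax)) (etrans _ (esym (mxE _ _ _ _))).
exact: (congr1 (fun f => 'D_(delta_mx 0 a) f x) e).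
Qed.

Let pd_base {W : normedModType R} (f : base -> W) x a : A x ->
  differentiable f (x, grad u x) -> pd a (fun y => f (y, grad u y)) x = total_derive f a (jet2 u x).
Proof.
move=> Ax df; apply: etrans (derive_comp _ (dbase Ax) df) _.
by rewrite derive_base// total_deriveE.
Qed.

Let dF x : A x -> differentiable F x.
Proof.
move=> Ax; apply: (@near_eq_differentiable _ _ _ (psi \o (fun y => (y, grad u y)))).
  by apply: open_near oA Ax _ => y Ay; rewrite FE.
by apply: differentiable_comp; [exact: dbase|exact: dpsi (uOm Ax)].
Qed.

Let pd_F k x : A x -> pd k F x = total_derive psi k (jet2 u x).
Proof.
move=> Ax; apply: etrans (pd_base k Ax (dpsi (uOm Ax))).
exact: near_eq_derive (open_near oA Ax FE).
Qed.

Lemma jacobian_jet x : A x -> 'J F x = jet_jacobian (jet2 u x).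
Proof.
move=> Ax; apply/row_matrixP => i; apply: etrans (row_jacobian i (dF Ax)) _.
by apply: etrans (pd_F i Ax) _; apply/rowP => k; rewrite !mxE.
Qed.

Lemma induced_metric_jet x : A x -> induced_metric h F x = jet_metric (jet2 u x).
Proof. by move=> Ax; rewrite /induced_metric jacobian_jet// FE. Qed.

Lemma hessian_sym x : A x -> (hessian u x)^T = hessian u x.
Proof.
by move=> Ax; apply/matrixP => i j; rewrite !mxE; exact: (derive_commutes oA _ _ su Ax).
Qed.

Lemma isotropic_jet x : A x -> 'J F x *m om (F x) *m ('J F x)^T = 0.
Proof.
move=> Ax; rewrite jacobian_jet// FE//.
by apply: (@jet_isotropic (jet2 u x)); [exact: uOm|exact: hessian_sym].
Qed.

Let cov2_jet i j x : A x -> cov2 h F i j x = jet_cov2 i j (jet2 u x) +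
  \sum_k third x i j k *: 'D_(0, delta_mx 0 k) psi (x, grad u x).
Proof.
move=> Ax; have Oz := uOm Ax.
rewrite cov2E (pd_F i Ax) (pd_F j Ax) /jet_cov2 (FE Ax) [RHS]addrAC.
apply: (congr1 (+%R^~ _)).
have sD v : smooth_on Om ('D_v psi) by exact: smooth_derive.
have dD v y : A y -> differentiable ('D_v psi) (y, grad u y).
  by move=> Ay; exact: smooth_differentiable (sD v) (uOm Ay).
have dDu v : differentiable (fun y => 'D_v psi (y, grad u y)) x.
  by apply: (@differentiable_comp _ _ _ _ (fun y => (y, grad u y)) ('D_v psi)); [exact: dbase|exact: dD].
have dh k : differentiable (fun y => hessian u y j k) x by exact: differentiable_entry (dhess Ax).
have dt k : differentiable (fun y => hessian u y j k *: 'D_(0, delta_mx 0 k) psi (y, grad u y)) x.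
  exact: differentiable_scale (dh k) (dDu _).
apply: etrans (_ : pd i (fun y => 'D_(delta_mx 0 j, 0) psi (y, grad u y) +
    \sum_k hessian u y j k *: 'D_(0, delta_mx 0 k) psi (y, grad u y)) x = _).
  by apply: near_eq_derive; apply: open_near oA Ax _; exact: pd_F.
rewrite /pd.
apply: etrans (derive_add_fun _ (dDu (delta_mx 0 j, 0)) (differentiable_sum_fun dt)) _.
rewrite -addrA; apply: congr2; first exact: pd_base i Ax (dD _ _ Ax).
rewrite derive_sum_fun// -big_split; apply: eq_bigr => k _ /=.
apply: etrans (derive_scale _ (dh k) (dDu _)) _; rewrite [LHS]addrC.
apply: congr2.
  exact: (congr1 (fun w => hessian u x j k *: w) (pd_base i Ax (dD _ _ Ax))).
apply: (congr1 (fun c => c *: _)).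
by apply: (congr1 (fun f => 'D__ f x)); apply/funext => y; rewrite mxE.
Qed.

Let field (x : 'rV[R]_n) : 'rV[R]_n :=
  jet_field (jet2 u x) - jet_trace (third x) (jet2 u x) *m jet_inverse_metric (jet2 u x).

Lemma mcfield_jet x : A x -> mcfield h om F x = field x.
Proof.
move=> Ax; have Oz := uOm Ax.
rewrite /mcfield /field /jet_field -mulmxBl; apply: (congr2 mulmx);
  last by rewrite induced_metric_jet.
rewrite /mcform (induced_metric_jet Ax) -/(jet_inverse_metric (jet2 u x)).
have -> : jet_trace (third x) (jet2 u x) = \sum_i \sum_j jet_inverse_metric (jet2 u x) i j *:
    \row_k third x i j k.
  apply/rowP => k; rewrite mxE summxE; apply: eq_bigr => i _; rewrite summxE.
  by apply: eq_bigr => j _; rewrite !mxE.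
rewrite -sumrB; apply: eq_bigr => i _; rewrite -sumrB; apply: eq_bigr => j _.
rewrite -scalerBr; apply: (congr1 ( *:%R _)).
rewrite (cov2_jet i j Ax) (jacobian_jet Ax) (FE Ax) !mulmxDl; apply: (congr1 (+%R _)).
rewrite !mulmx_suml [in RHS](row_sum_delta (\row_k _)) -sumrN; apply: eq_bigr => k _.
rewrite mxE -!scalemxAl; apply: etrans (congr1 ( *:%R _) (@vertical_pairing (jet2 u x) k Oz)) _.
by rewrite scalerN.
Qed.

Let K x := jet_inverse_metric (jet2 u x).

Let djet {p q} (f : jet -> 'M[R]_(p, q)) x : A x -> smooth_on Om2 f ->
  differentiable (fun y => f (jet2 u y)) x.
Proof.
move=> Ax sf; apply: (@differentiable_comp _ _ _ _ (jet2 u) f); first exact: djet2.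
by apply: smooth_differentiable sf _; exact: uOm.
Qed.

Let derive_jet {p q} (f : jet -> 'M[R]_(p, q)) x a : A x -> smooth_on Om2 f ->
  'D_(delta_mx 0 a) (fun y => f (jet2 u y)) x =
  'D_(jet_dir (hessian u x) (third x) a) f (jet2 u x).
Proof.
move=> Ax sf.
have Ox : Om2 (jet2 u x) by exact: uOm.
apply: etrans (derive_comp _ (djet2 Ax) (smooth_differentiable sf Ox)) _.
by rewrite derive_jet2.
Qed.

Let trace_sumE y : jet_trace (third y) (jet2 u y) =
  \sum_i \sum_j K y i j *: \row_k third y i j k.
Proof.
apply/rowP => k; rewrite mxE summxE; apply: eq_bigr => i _; rewrite summxE.
by apply: eq_bigr => j _; rewrite !mxE.
Qed.

Let dK x (Ax : A x) : differentiable K x := djet Ax smooth_jet_inverse_metric.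

Let dthird x i j : A x -> differentiable (fun y => \row_k third y i j k) x.
Proof.
move=> Ax; apply: differentiable_mx => a k; under eq_fun do rewrite mxE.
exact: smooth_differentiable (smooth_third i j k) Ax.
Qed.

Let dtrace_term x i j : A x -> differentiable (fun y => K y i j *: \row_k third y i j k) x.
Proof.
move=> Ax; apply: differentiable_scale; last exact: dthird.
exact: differentiable_entry (dK Ax).
Qed.

Let dtrace x : A x -> differentiable (fun y => jet_trace (third y) (jet2 u y)) x.
Proof.
move=> Ax; under eq_fun do rewrite trace_sumE.
by apply: differentiable_sum_fun => i; apply: differentiable_sum_fun => j; exact: dtrace_term.
Qed.

(** The only source of fourth derivatives: the first row differentiates the inverse metric and stays
    within the 3-jet, the second differentiates the third derivatives. *)
Let derive_trace x a : A x -> 'D_(delta_mx 0 a) (fun y => jet_trace (third y) (jet2 u y)) x =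
  (\row_k \sum_i \sum_j
    'D_(jet_dir (hessian u x) (third x) a) jet_inverse_metric (jet2 u x) i j * third x i j k) +
  \row_k \sum_i \sum_j K x i j * pd a (fun y => third y i j k) x.
Proof.
move=> Ax; under eq_fun do rewrite trace_sumE.
have rowE2 (al ka : 'M[R]_n) (r q : 'I_n -> 'I_n -> 'I_n -> R) :
    \sum_i \sum_j (al i j *: (\row_k r i j k) + ka i j *: \row_k q i j k) =
    \row_k (\sum_i \sum_j al i j * r i j k) + \row_k \sum_i \sum_j ka i j * q i j k
    :> 'rV[R]_n.
  apply/rowP => k; rewrite !mxE summxE -big_split; apply: eq_bigr => i _ /=.
  by rewrite summxE -big_split; apply: eq_bigr => j _ /=; rewrite !mxE.
apply: etrans _ (rowE2 _ _ _ _).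
apply: etrans (derive_sum_fun _ _) _.
  by move=> i; apply: differentiable_sum_fun => j; exact: dtrace_term.
apply: eq_bigr => i _.
apply: etrans (derive_sum_fun _ (fun j => dtrace_term i j Ax)) _; apply: eq_bigr => j _.
apply: etrans (derive_scale _ (differentiable_entry i j (dK Ax)) (dthird i j Ax)) _.
apply: congr2.
  apply: (congr1 (fun c => c *: _)).
  apply: etrans (esym (derive_coord _ _ _ (dK Ax))) _.
  exact: (congr1 (fun M : 'M[R]_n => M i j) (derive_jet a Ax smooth_jet_inverse_metric)).
apply: (congr1 (fun w => K x i j *: w)); apply/rowP => k.
apply: etrans (derive_coord _ _ _ (dthird i j Ax)) (etrans _ (esym (mxE _ _ _ _))).
have e : (fun y => (\row_k third y i j k : 'rV[R]_n) 0 k) = (fun y => third y i j k).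
  by apply/funext => y; rewrite mxE.
exact: (congr1 (fun f => 'D_(delta_mx 0 a) f x) e).
Qed.

Let dfield x : A x -> differentiable field x.
Proof.
move=> Ax; apply: differentiableB; first exact: djet Ax smooth_jet_field.
by apply: differentiable_mulmx; [exact: dtrace|exact: dK].
Qed.

Lemma divergence_mcfield x : A x ->
  divergence (induced_metric h F) (mcfield h om F) x =
  - (\sum_a \sum_p \sum_i \sum_j
       K x a p * K x i j * pd a (pd j (pd i (pd p u))) x) +
  lower_order_term (jet2 u x) (third x).
Proof.
move=> Ax; have Ox : Om2 (jet2 u x) by exact: uOm.
have Ks : (K x)^T = K x by rewrite trmx_inv jet_metric_sym.
rewrite (@divergence_near _ _ _ (fun y => jet_metric (jet2 u y)) _ field); last first.
- by apply: open_near oA Ax _; exact: mcfield_jet.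
- by apply: open_near oA Ax _; exact: induced_metric_jet.
rewrite divergenceE; [|exact: djet Ax smooth_jet_metric
  |by apply: open_near oA Ax _ => y Ay; exact: (@jet_metric_sym (jet2 u y) (uOm Ay))|exact: dfield].
rewrite /lower_order_term addrA; apply: congr2; last first.
  apply: (congr1 (fun M => _ * \tr (_ *m M))).
  rewrite (derive_basis _ (djet Ax smooth_jet_metric)); apply: eq_bigr => a _.
  by apply: (congr1 ( *:%R _)); exact: derive_jet a Ax smooth_jet_metric.
rewrite /mxtrace addrC -sumrB; apply: eq_bigr => a _.
have -> : 'J field x a a = pd a field x 0 a by rewrite -(row_jacobian a (dfield Ax)) [RHS]mxE.
have -> : pd a field x = 'D_(jet_dir (hessian u x) (third x) a) jet_field (jet2 u x) -
  ('D_(delta_mx 0 a) (fun y => jet_trace (third y) (jet2 u y)) x *m K x +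
   jet_trace (third x) (jet2 u x) *m
     'D_(jet_dir (hessian u x) (third x) a) jet_inverse_metric (jet2 u x)).
  apply: etrans (derive_sub_fun _ (djet Ax smooth_jet_field)
    (differentiable_mulmx (dtrace Ax) (dK Ax))) _.
  apply: congr2; first exact: derive_jet a Ax smooth_jet_field.
  apply: (congr1 -%R); apply: etrans (derive_mulmx _ (dtrace Ax) (dK Ax)) _.
  by apply: (congr1 (fun M => _ + _ *m M)); exact: derive_jet a Ax smooth_jet_inverse_metric.
rewrite (derive_trace a Ax) mulmxDl.
have -> : \sum_p \sum_i \sum_j K x a p * K x i j * pd a (pd j (pd i (pd p u))) x =
  ((\row_k \sum_i \sum_j K x i j * pd a (fun y => third y i j k) x) *m K x) 0 a.
  (* The differentiated trace carries the indices in the order [a, i, j, k], the statement in the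
     order [a, j, i, p]. Symmetry of the inverse metric permits renaming the summation indices, so
     no fourth-order derivatives have to be commuted. *)
  have E (M : 'M[R]_n) (D : 'I_n -> 'I_n -> 'I_n -> R) : M^T = M ->
      \sum_p \sum_i \sum_j M a p * M i j * D j i p =
      ((\row_k \sum_i \sum_j M i j * D i j k) *m M) 0 a.
    move=> Ms; have Mij i j : M i j = M j i by rewrite -[in LHS]Ms mxE.
    rewrite mxE; apply: eq_bigr => p _; rewrite mxE exchange_big mulr_suml /=.
    apply: eq_bigr => i _; rewrite mulr_suml; apply: eq_bigr => j _.
    by rewrite (Mij p a) (Mij j i); ring.
  exact: (E (K x) (fun i j k => pd a (pd i (pd j (pd k u))) x) Ks).
have fin (M1 M2 M3 M4 : 'rV[R]_n) :
    (M1 - (M2 + M3 + M4)) 0 a = M1 0 a - (M2 + M4) 0 a - M3 0 a by rewrite !mxE; ring.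
exact: fin.
Qed.

Lemma differentiable_mcfield x : A x -> differentiable (mcfield h om F) x.
Proof.
move=> Ax; apply: near_eq_differentiable _ (dfield Ax).
by apply: open_near oA Ax _ => y Ay; rewrite mcfield_jet.
Qed.

Lemma differentiable_induced_metric x : A x -> differentiable (induced_metric h F) x.
Proof.
move=> Ax; apply: near_eq_differentiable _ (djet Ax smooth_jet_metric).
by apply: open_near oA Ax _ => y Ay; rewrite induced_metric_jet.
Qed.

Lemma induced_metric_unit x : A x -> induced_metric h F x \in unitmx.
Proof. by move=> Ax; rewrite induced_metric_jet//; apply: jet_metric_unit; exact: uOm. Qed.

Lemma induced_metric_sym x : A x -> (induced_metric h F x)^T = induced_metric h F x.
Proof. by move=> Ax; rewrite induced_metric_jet//; apply: jet_metric_sym; exact: uOm. Qed.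

Lemma smooth_lagrangian_graph : smooth_on A F.
Proof.
apply: (@smooth_eq _ _ _ oA _ (psi \o (fun y => (y, grad u y)))).
  by move=> x Ax; rewrite FE.
apply: (@smooth_comp_mx _ _ _ oA _ _ _ Om psi (fun y => (y, grad u y))) => //.
  exact: findim_base.
apply: (smooth_pair oA); last exact: smooth_grad.
by apply: (smooth_linear oA (l := idfun)) => x; exact: cvg_id.
Qed.

End JetOfFunction.
End Jets.

Lemma open_setI_preimage {S T : topologicalType} (A : set S) (f : S -> T) (B : set T) :
  open A -> (forall x, A x -> {for x, continuous f}) -> open B ->
  open [set x | A x /\ B (f x)].
Proof.
move=> oA cf oB; rewrite openE => x [Ax Bfx].
apply: filterI; first exact: open_nbhs_nbhs.
by apply: (cf x Ax); exact: open_nbhs_nbhs.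
Qed.

Lemma smooth_local {R : realType} {V W : normedModType R} (A : set V) (f : V -> W) :
  (forall x, A x -> exists U, [/\ open U, U x & smooth_on U f]) -> smooth_on A f.
Proof.
move=> H k; elim: k f H => [|k IH] f H.
  move=> x /H[U [oU Ux sf]]; exact: differentiable_continuous (smooth_differentiable sf Ux).
split=> [x /H[U [oU Ux sf]]|v]; first exact: smooth_differentiable sf Ux.
apply: IH => x /H[U [oU Ux sf]]; exists U; split=> //.
exact: smooth_derive.
Qed.

Lemma smooth_sub {R : realType} {V W : normedModType R} (A B : set V) (f : V -> W) :
  A `<=` B -> smooth_on B f -> smooth_on A f.
Proof. by move=> AB sf k; apply: Ck_sub AB (sf k). Qed.

(** * Time-dependent families *)

Section Slices.
Context {R : realType} {n : nat}.
Local Notation strip := ('rV[R]_n * R)%type.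
Variables (Bs : set strip) (oBs : open Bs).

Lemma findim_strip : findim strip.
Proof. by apply: findim_prod; [exact: findim_matrix|exact: findim_scalar]. Qed.

Lemma smooth_slice_map (t : R) (A : set 'rV[R]_n) : open A ->
  smooth_on A (fun x => (x, t) : strip).
Proof.
move=> oA; apply: (smooth_pair oA); last exact: smooth_cst.
by apply: (smooth_linear oA (l := idfun)) => x; exact: cvg_id.
Qed.

Lemma smooth_slice_scalar (f : strip -> R) t (A : set 'rV[R]_n) : open A ->
  smooth_on Bs f -> (forall x, A x -> Bs (x, t)) -> smooth_on A (fun x => f (x, t)).
Proof.
move=> oA sf AB; apply: (@smooth_comp _ _ _ oA _ Bs f (fun x => (x, t))) => //.
  exact: findim_strip.
exact: smooth_slice_map.
Qed.

Lemma pd_slice {W : normedModType R} (f : strip -> W) i (z : strip) : differentiable f z ->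
  pd i (fun y => f (y, z.2)) z.1 = 'D_(delta_mx 0 i, 0) f z.
Proof.
case: z => x t df /=.
have dp : differentiable (fun y : 'rV[R]_n => (y, t)) x by exact: differentiable_pair.
apply: etrans (derive_comp _ dp df) _; rewrite derive_pair//.
by rewrite derive_id derive_cst.
Qed.

Lemma derive_time {W : normedModType R} (f : strip -> W) (z : strip) : differentiable f z ->
  'D_1 (fun s => f (z.1, s)) z.2 = 'D_(0, 1) f z.
Proof.
case: z => x t df /=.
have dp : differentiable (fun s : R => (x, s)) t by exact: differentiable_pair.
apply: etrans (derive_comp _ dp df) _; rewrite derive_pair//.
by rewrite derive_id derive_cst.
Qed.

(** A space derivative at frozen time is the derivative on the strip in direction
    [(delta_mx 0 i, 0)], hence smooth jointly in space and time. *)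
Lemma smooth_pd_slice {W : normedModType R} (f : strip -> W) i : smooth_on Bs f ->
  smooth_on Bs (fun z => pd i (fun y => f (y, z.2)) z.1).
Proof.
move=> sf; apply: (@smooth_eq _ _ _ oBs _ ('D_(delta_mx 0 i, 0) f)).
  by move=> z Bz; rewrite pd_slice//; exact: smooth_differentiable sf Bz.
exact: smooth_derive.
Qed.

Section Family.
Context {m : nat}.
Variables (h om : 'rV[R]_m -> 'M[R]_m) (B : set 'rV[R]_m) (Fh : strip -> 'rV[R]_m).
Hypotheses (oB : open B) (sh : smooth_on B h) (som : smooth_on B om).
Hypotheses (hu : forall y, B y -> h y \in unitmx).
Hypotheses (sF : smooth_on Bs Fh) (FB : forall z, Bs z -> B (Fh z)).
Let F (t : R) (x : 'rV[R]_n) := Fh (x, t).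
Hypotheses (gu : forall z, Bs z -> induced_metric h (F z.2) z.1 \in unitmx).

Let smooth_slice_jacobian : smooth_on Bs (fun z => 'J (F z.2) z.1).
Proof.
apply: (smooth_mx oBs) => i j.
apply: (@smooth_eq _ _ _ oBs _ (fun z => pd i (fun y => Fh (y, z.2)) z.1 0 j)).
  move=> [x t] Bz /=; have dF : differentiable (F t) x.
    apply: (@differentiable_comp _ _ _ _ (fun y => (y, t)) Fh); first exact: differentiable_pair.
    exact: smooth_differentiable sF Bz.
  by rewrite -(row_jacobian i dF) [LHS]mxE.
by apply: (smooth_entry oBs); exact: smooth_pd_slice.
Qed.

Let smooth_comp_F (f : 'rV[R]_m -> 'M[R]_m) : smooth_on B f ->
  smooth_on Bs (fun z => f (F z.2 z.1)).
Proof.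
move=> sf; apply: (@smooth_eq _ _ _ oBs _ (f \o Fh)); first by case.
by apply: (@smooth_comp_mx _ _ _ oBs _ _ _ B f Fh) => //; exact: findim_matrix.
Qed.

Let smooth_metric : smooth_on Bs (fun z => induced_metric h (F z.2) z.1).
Proof.
apply: (smooth_mulmx oBs); last exact: smooth_trmx.
by apply: (smooth_mulmx oBs) => //; exact: smooth_comp_F.
Qed.

Let smooth_pdF i : smooth_on Bs (fun z => pd i (F z.2) z.1).
Proof. exact: smooth_pd_slice. Qed.

Let smooth_F : smooth_on Bs (fun z => F z.2 z.1).
Proof. by apply: (@smooth_eq _ _ _ oBs _ Fh) => //; case. Qed.

Let smooth_cov2 i j : smooth_on Bs (fun z => cov2 h (F z.2) i j z.1).
Proof.
apply: (smooth_add oBs).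
  exact: (@smooth_pd_slice _ (fun z => pd j (F z.2) z.1) i (smooth_pdF j)).
apply: (smooth_christoffel_vec oBs oB sh hu smooth_F (smooth_pdF i) (smooth_pdF j)).
by case=> x t; exact: FB.
Qed.

Let smooth_inverse : smooth_on Bs (fun z => invmx (induced_metric h (F z.2) z.1)).
Proof. exact: smooth_invmx. Qed.

Let smooth_mcfield : smooth_on Bs (fun z => mcfield h om (F z.2) z.1).
Proof.
apply: (smooth_mulmx oBs) => //.
apply: (smooth_sum oBs) => i; apply: (smooth_sum oBs) => j; apply: (smooth_scale oBs).
  exact: (smooth_entry oBs).
apply: (smooth_mulmx oBs); last exact: smooth_trmx.
by apply: (smooth_mulmx oBs) => //; exact: smooth_comp_F.
Qed.

(** Joint smoothness, rather than smoothness of each time slice, is what allows the divergence to be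
    integrated in time later. *)
Lemma smooth_family_divergence : smooth_on Bs
  (fun z => divergence (induced_metric h (F z.2)) (mcfield h om (F z.2)) z.1).
Proof.
apply: (smooth_sum oBs) => a; apply: (smooth_add oBs).
  apply: (@smooth_pd_slice _ (fun z => mcfield h om (F z.2) z.1 0 a) a).
  exact: smooth_entry.
apply: (smooth_sum oBs) => b; apply: (smooth_mul oBs); last exact: smooth_entry.
apply: (smooth_mul oBs); first exact: smooth_cst.
apply: (smooth_sum oBs) => l; apply: (smooth_mul oBs); first exact: smooth_entry.
have sd i j k : smooth_on Bs (fun z => pd i (fun y => induced_metric h (F z.2) y j k) z.1).
  apply: (@smooth_pd_slice _ (fun z => induced_metric h (F z.2) z.1 j k) i).
  exact: smooth_entry.
by apply: (smooth_add oBs); [apply: (smooth_add oBs)|apply: (smooth_opp oBs)]; exact: sd.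
Qed.

End Family.
End Slices.

Lemma jacobian_near {R : realType} n m (f g : 'rV[R]_n -> 'rV[R]_m) x :
  (\forall y \near x, f y = g y) -> differentiable f x -> 'J f x = 'J g x.
Proof.
move=> fg df; apply/row_matrixP => i; apply: etrans (row_jacobian i df) _.
apply: etrans _ (esym (row_jacobian i (near_eq_differentiable fg df))).
exact: near_eq_derive.
Qed.

Lemma jacobian_id {R : realType} n (x : 'rV[R]_n) : 'J id x = 1%:M.
Proof.
have did : differentiable (@id 'rV[R]_n) x by [].
apply/row_matrixP => i; apply: etrans (row_jacobian i did) _.
by rewrite row1; exact: derive_id.
Qed.

(** * Almost Kaehler manifolds in charts *)

Section Transitions.
Context {R : realType} {n : nat} {M : manifold R n}.
Implicit Types c e : chart R n M.

Definition trans c c' : 'rV[R]_n -> 'rV[R]_n := cfun c' \o cinv c.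
Definition trans_dom c c' : set 'rV[R]_n := [set x | cimg c x /\ cdom c' (cinv c x)].

Lemma cimg_dom c x : atlas c -> cimg c x -> cdom c (cinv c x).
Proof. by move=> /atlas_chart[_ _ cK _ _] [p cp <-]; rewrite cK. Qed.

Lemma cinvK c x : atlas c -> cimg c x -> cfun c (cinv c x) = x.
Proof. by move=> /atlas_chart[_ _ cK _ _] [p cp <-]; rewrite cK. Qed.

Lemma cfunK c p : atlas c -> cdom c p -> cinv c (cfun c p) = p.
Proof. by move=> /atlas_chart[_ _ cK _ _]; exact: cK. Qed.

Lemma open_cimg c : atlas c -> open (cimg c).
Proof. by move=> /atlas_chart[]. Qed.

Lemma open_cdom c : atlas c -> open (cdom c).
Proof. by move=> /atlas_chart[]. Qed.

Lemma open_trans_dom c c' : atlas c -> atlas c' -> open (trans_dom c c').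
Proof.
move=> ac ac'; apply: open_setI_preimage (open_cimg ac) _ (open_cdom ac').
by have [] := atlas_chart ac.
Qed.

Lemma smooth_trans c c' : atlas c -> atlas c' -> smooth_on (trans_dom c c') (trans c c').
Proof. exact: atlas_compat. Qed.

Lemma cinv_trans c c' x : atlas c -> atlas c' -> trans_dom c c' x ->
  cinv c' (trans c c' x) = cinv c x.
Proof. by move=> ac ac' [_ dx]; rewrite /trans /= cfunK. Qed.

Lemma trans_dom_sym c c' x : atlas c -> atlas c' -> trans_dom c c' x ->
  trans_dom c' c (trans c c' x).
Proof.
move=> ac ac' dx; split; last by rewrite cinv_trans//; apply: cimg_dom => //; case: dx.
by case: dx => _ dx; exists (cinv c x).
Qed.

Lemma transK c c' x : atlas c -> atlas c' -> trans_dom c c' x ->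
  trans c' c (trans c c' x) = x.
Proof.
move=> ac ac' dx; rewrite -[LHS]/(cfun c (cinv c' (trans c c' x))) cinv_trans//.
by rewrite cinvK//; case: dx.
Qed.

Lemma trans_unit c c' x : atlas c -> atlas c' -> trans_dom c c' x ->
  'J (trans c c') x \in unitmx.
Proof.
move=> ac ac' dx; have dx' := trans_dom_sym ac ac' dx.
have d1 := smooth_differentiable (smooth_trans ac ac') dx.
have d2 := smooth_differentiable (smooth_trans ac' ac) dx'.
have E : 'J (trans c c') x *m 'J (trans c' c) (trans c c' x) = 1%:M.
  apply: etrans (esym (jacobian_comp d1 d2)) (etrans _ (jacobian_id x)).
  apply: jacobian_near; last exact: differentiable_comp d1 d2.
  by apply: open_near (open_trans_dom ac ac') dx _ => y dy; exact: transK.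
exact: (mulmx1_unit E).1.
Qed.

Lemma trans_dom_chart_at c x : cimg c x -> trans_dom c (chart_at (cinv c x)) x.
Proof. by move=> cx; split=> //; exact: chart_at_dom. Qed.

Lemma frame_unit c x : atlas c -> cimg c x -> frame c x \in unitmx.
Proof.
by move=> ac cx; apply: trans_unit => //; [exact: chart_at_atlas|exact: trans_dom_chart_at].
Qed.

(** The preferred chart need not vary continuously with the point. Each frame differentiates only
    the chart [c0] frozen at the base point, which [c] and [c'] share there, so the chain rule
    applies. *)
Lemma frame_trans c c' x : atlas c -> atlas c' -> trans_dom c c' x ->
  frame c x = 'J (trans c c') x *m frame c' (trans c c' x).
Proof.
move=> ac ac' dx; have [cx c'x] := dx.
rewrite /frame (cinv_trans ac ac' dx).
set c0 := chart_at (cinv c x).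
have ac0 : atlas c0 by exact: chart_at_atlas.
have dx0 : trans_dom c c0 x by exact: trans_dom_chart_at.
have dx' := trans_dom_sym ac ac' dx.
have dx1 : trans_dom c' c0 (trans c c' x).
  by split; [case: dx'|rewrite cinv_trans//; case: dx0].
have d1 := smooth_differentiable (smooth_trans ac ac') dx.
have d2 := smooth_differentiable (smooth_trans ac' ac0) dx1.
apply: etrans _ (jacobian_comp d1 d2); apply/esym/jacobian_near; last exact: differentiable_comp d1 d2.
apply: open_near (open_trans_dom ac ac') dx _ => y dy.
first [exact: (congr1 (cfun c0) (cinv_trans ac ac' dy))
  |exact: (congr1 (cfun c0) (esym (cinv_trans ac ac' dy)))].
Qed.

Lemma form_in_trans c c' (B : M -> 'M[R]_n) x : atlas c -> atlas c' -> trans_dom c c' x ->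
  form_in c B x = 'J (trans c c') x *m form_in c' B (trans c c' x) *m ('J (trans c c') x)^T.
Proof.
move=> ac ac' dx; rewrite /form_in (frame_trans ac ac' dx) (cinv_trans ac ac' dx).
by rewrite trmx_mul !mulmxA.
Qed.

End Transitions.

Section AlmostKahlerCharts.
Context {R : realType} {m : nat} {M : manifold R m} (K : almost_kahler M).
Variables (e : chart R m M) (ae : atlas e).

Definition loc_omega : 'rV[R]_m -> 'M[R]_m := form_in e (omega K).

Lemma smooth_loc_metric : smooth_on (cimg e) (loc_metric K e).
Proof. by apply: (smooth_mx (open_cimg ae)) => i j; exact: metric_smooth. Qed.

Lemma smooth_loc_omega : smooth_on (cimg e) loc_omega.
Proof. by apply: (smooth_mx (open_cimg ae)) => i j; exact: omega_smooth. Qed.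

Lemma loc_metric_sym y : (loc_metric K e y)^T = loc_metric K e y.
Proof.
have s p : (metric K p)^T = metric K p.
  by apply: bilin_ext => v w; rewrite bilin_trmx; exact: Defs.metric_sym.
by rewrite /loc_metric /form_in !trmx_mul trmxK s mulmxA.
Qed.

Lemma loc_metric_pos y (v : 'rV[R]_m) : cimg e y -> v != 0 -> 0 < bilin (loc_metric K e y) v v.
Proof.
move=> cy v0; rewrite bilin_congr; apply: metric_pos.
apply: contra_neq v0 => vf; rewrite -[v](mulmxK (frame_unit ae cy)) vf.
by rewrite mul0mx.
Qed.

Lemma loc_acs_metric y : cimg e y -> loc_acs K e y *m loc_metric K e y = loc_omega y.
Proof.
move=> cy; have fu := frame_unit ae cy.
rewrite /loc_acs /loc_metric /loc_omega /endo_in /form_in !mulmxA mulmxKV//.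
have -> : omega K (cinv e y) = acs K (cinv e y) *m metric K (cinv e y).
  by apply: bilin_ext => v w; rewrite -compat /bilin !mulmxA.
by rewrite !mulmxA.
Qed.

Lemma loc_acs_sqr y : cimg e y -> loc_acs K e y *m loc_acs K e y = - 1%:M.
Proof.
move=> cy; have fu := frame_unit ae cy.
have J2 p : acs K p *m acs K p = - 1%:M.
  apply/row_matrixP => i; rewrite rowE mulmxA acs_sqr [RHS]rowE.
  by rewrite mulmxN mulmx1.
rewrite /loc_acs /endo_in !mulmxA mulmxKV// -(mulmxA (frame e y)) J2.
by rewrite mulmxN mulmx1 mulNmx mulmxV.
Qed.

End AlmostKahlerCharts.

(** * Graphs of exact forms in a Weinstein neighborhood *)

Section CotangentModel.
Context {R : realType} {n m : nat} {L : manifold R n} {M : manifold R m}.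
Variables (K : almost_kahler M) (iota : L -> M) (Psi : weinstein_map K iota).

Definition wpsi (c : chart R n L) (e : chart R m M) : 'rV[R]_n * 'rV[R]_n -> 'rV[R]_m :=
  cfun e \o wfun Psi \o cot_inv c.
Definition wreg (c : chart R n L) (e : chart R m M) : set ('rV[R]_n * 'rV[R]_n) :=
  [set z | cot_img c (wdom Psi) z /\ cdom e (wfun Psi (cot_inv c z))].

(** A covector is stored by its components in the preferred chart, while graphs are studied in an
    arbitrary chart [c]. The chain rule through the frame shows that the same covector has the
    gradient as its fibre coordinate in [c]. *)
Lemma differential_chart (f : L -> R) (c : chart R n L) x : atlas c -> cimg c x ->
  differentiable (f \o cinv c) x ->
  differential f (cinv c x) = cot_inv c (x, grad (f \o cinv c) x).
Proof.
move=> ac cx df; rewrite /differential /cot_inv /=; apply: congr1.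
set c0 := chart_at (cinv c x).
have ac0 : atlas c0 by exact: chart_at_atlas.
have dx0 : trans_dom c c0 x by exact: trans_dom_chart_at.
have dx' := trans_dom_sym ac ac0 dx0.
have d0 := smooth_differentiable (smooth_trans ac ac0) dx0.
have d0' := smooth_differentiable (smooth_trans ac0 ac) dx'.
have dw : differentiable (f \o cinv c0) (trans c c0 x).
  apply: (@near_eq_differentiable _ _ _ ((f \o cinv c) \o trans c0 c)).
    apply: open_near (open_trans_dom ac0 ac) dx' _ => y dy.
    exact: (congr1 f (cinv_trans ac0 ac dy)).
  by apply: differentiable_comp; rewrite ?transK.
have -> : grad (f \o cinv c) x = (\row_i pd i (f \o cinv c0) (trans c c0 x)) *m (frame c x)^T.
  apply/rowP => i; rewrite [LHS]mxE.
  apply: etrans (_ : 'D_(delta_mx 0 i) ((f \o cinv c0) \o trans c c0) x = _).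
    apply: near_eq_derive; apply: open_near (open_trans_dom ac ac0) dx0 _ => y dy.
    exact: (congr1 f (esym (cinv_trans ac ac0 dy))).
  rewrite (derive_comp _ d0 dw) (derive_basis _ dw) mxE; apply: eq_bigr => j _.
  rewrite (deriveEjacobian _ d0) -rowE !mxE [RHS]mulrC.
  by [].
by rewrite -mulmxA -trmx_mul mulVmx ?trmx1 ?mulmx1//; exact: frame_unit.
Qed.

Section Regular.
Variables (c : chart R n L) (e : chart R m M).
Hypotheses (ac : atlas c) (ae : atlas e).

Lemma open_wreg : open (wreg c e).
Proof.
apply: open_setI_preimage (wdom_open ac) _ (open_cdom ae).
exact: (wfun_smooth Psi ac).1.
Qed.

Lemma smooth_wpsi : smooth_on (wreg c e) (wpsi c e).
Proof. exact: (wfun_smooth Psi ac).2. Qed.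

Lemma wpsi_cimg z : wreg c e z -> cimg e (wpsi c e z).
Proof. by case=> _ ez; exists (wfun Psi (cot_inv c z)). Qed.

Lemma wpsi_symplectic z a b : wreg c e z ->
  bilin (loc_omega K e (wpsi c e z)) ('D_a (wpsi c e) z) ('D_b (wpsi c e) z) = can_form a b.
Proof. by case=> cz ez; exact: (wfun_symplectic (w := Psi)). Qed.

Lemma loc_metric_unit y : cimg e y -> loc_metric K e y \in unitmx.
Proof. by move=> cy; apply: posdef_unitmx => v; exact: loc_metric_pos. Qed.

End Regular.

Variables (delta : R) (phi : L -> R -> R).
Hypotheses (sphi : smooth_strip delta phi)
  (phiW : forall p t, 0 <= t < delta -> wdom Psi (differential (phi^~ t) p)).

Definition chart_fun (c : chart R n L) (t : R) (x : 'rV[R]_n) : R := phi (cinv c x) t.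

Lemma smooth_chart_fun c t : atlas c -> 0 <= t < delta -> smooth_on (cimg c) (chart_fun c t).
Proof.
move=> ac td; apply: smooth_local => x cx.
have [B [f [oB Bx sf fE]]] := sphi ac cx td.
have oU : open [set y | cimg c y /\ B (y, t)].
  apply: open_setI_preimage (open_cimg ac) _ oB => y cy.
  exact: differentiable_continuous (smooth_differentiable (smooth_slice_map t (open_cimg ac)) cy).
exists [set y | cimg c y /\ B (y, t)]; split=> //.
apply: (@smooth_eq _ _ _ oU _ (fun y => f (y, t))); first by move=> y [cy By]; rewrite -fE.
by apply: (smooth_slice_scalar oU sf) => y [].
Qed.

Lemma differential_phi c x t : atlas c -> cimg c x -> 0 <= t < delta ->
  differential (phi^~ t) (cinv c x) = cot_inv c (x, grad (chart_fun c t) x).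
Proof.
move=> ac cx td; apply: differential_chart => //.
exact: smooth_differentiable (smooth_chart_fun ac td) cx.
Qed.

Lemma deformation_chart c x t : atlas c -> cimg c x -> 0 <= t < delta ->
  deformation Psi phi (cinv c x) t = wfun Psi (cot_inv c (x, grad (chart_fun c t) x)).
Proof. by move=> ac cx td; rewrite /deformation differential_phi. Qed.

Definition def_dom (c : chart R n L) (e : chart R m M) (t : R) : set 'rV[R]_n :=
  [set x | cimg c x /\ cdom e (deformation Psi phi (cinv c x) t)].
Definition def_loc (c : chart R n L) (e : chart R m M) (t : R) : 'rV[R]_n -> 'rV[R]_m :=
  loc c e (deformation Psi phi ^~ t).

Section Local.
Variables (c : chart R n L) (e : chart R m M) (t : R).
Hypotheses (ac : atlas c) (ae : atlas e) (td : 0 <= t < delta).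
Let u := chart_fun c t.
Let A := def_dom c e t.
Let F := def_loc c e t.
Let h := loc_metric K e.
Let om := loc_omega K e.

Lemma def_dom_wreg x : A x -> wreg c e (x, grad u x).
Proof.
move=> [cx ex]; rewrite /wreg /= /cot_img /= -differential_phi//; split; last exact: ex.
by split=> //; exact: phiW.
Qed.

Lemma def_locE x : A x -> F x = wpsi c e (x, grad u x).
Proof. by move=> [cx ex]; rewrite /F /def_loc /loc /= deformation_chart. Qed.

Lemma def_loc_cimg x : A x -> cimg e (F x).
Proof. by move=> Ax; rewrite def_locE//; apply: wpsi_cimg; exact: def_dom_wreg. Qed.

Lemma open_def_dom : open A.
Proof.
(* Openness is read off from the continuous map from [x] to its 1-jet and the open set [wreg], since
   at this stage nothing is known about the continuity of the deformation. *)
have -> : A = [set x | cimg c x /\ wreg c e (x, grad u x)].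
  apply/seteqP; split=> x; first by move=> Ax; split; [case: Ax|exact: def_dom_wreg].
  by move=> [cx [_ ex]]; split=> //; rewrite deformation_chart.
apply: open_setI_preimage (open_cimg ac) _ (open_wreg ac ae) => x cx.
have dg := smooth_differentiable (smooth_grad (open_cimg ac) (smooth_chart_fun ac td)) cx.
by apply: differentiable_continuous; apply: differentiable_pair.
Qed.

Let su : smooth_on A u.
Proof. by apply: smooth_sub (smooth_chart_fun ac td) => x []. Qed.

(** The common value of [div_J_mean_curvature] and [div_J_tension] in the charts [c] and [e],
    written with the intrinsic field [mcfield] so that chart changes can be applied to it. *)
Definition local_div (x : 'rV[R]_n) : R := divergence (induced_metric h F) (mcfield h om F) x.

Let oOm := open_wreg ac ae.
Let spsi := smooth_wpsi ac ae.
Let psiB := @wpsi_cimg c e.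
Let sh := smooth_loc_metric K ae.
Let som := smooth_loc_omega K ae.
Let hs y (_ : cimg e y) := loc_metric_sym K e y.
Let hpos := @loc_metric_pos _ _ _ K e ae.
Let symp := wpsi_symplectic ac ae.
Let oA := open_def_dom.

Lemma def_metric_unit x : A x -> induced_metric h F x \in unitmx.
Proof. exact: (induced_metric_unit spsi psiB hpos symp oA su def_dom_wreg def_locE). Qed.

Lemma def_metric_sym x : A x -> (induced_metric h F x)^T = induced_metric h F x.
Proof. exact: (induced_metric_sym spsi psiB hs oA su def_dom_wreg def_locE). Qed.

Lemma def_isotropic x : A x -> 'J F x *m om (F x) *m ('J F x)^T = 0.
Proof. exact: (isotropic_jet spsi symp oA su def_dom_wreg def_locE). Qed.

Lemma def_smooth : smooth_on A F.
Proof. exact: (smooth_lagrangian_graph oOm spsi oA su def_dom_wreg def_locE). Qed.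

Lemma def_mcfield_differentiable x : A x -> differentiable (mcfield h om F) x.
Proof.
exact: (differentiable_mcfield oOm (open_cimg ae) spsi psiB sh som hpos symp oA su
  def_dom_wreg def_locE).
Qed.

Lemma def_metric_differentiable x : A x -> differentiable (induced_metric h F) x.
Proof.
exact: (differentiable_induced_metric oOm (open_cimg ae) spsi psiB sh oA su
  def_dom_wreg def_locE).
Qed.

Lemma local_div_expansion x : A x -> local_div x =
  - (\sum_a \sum_p \sum_i \sum_j invmx (induced_metric h F x) a p *
       invmx (induced_metric h F x) i j * pd a (pd j (pd i (pd p u))) x) +
  lower_order_term h om (wpsi c e) (jet2 u x) (third u x).
Proof.
move=> Ax; rewrite (induced_metric_jet h spsi oA su def_dom_wreg def_locE Ax).
exact: (divergence_mcfield oOm (open_cimg ae) spsi psiB sh som hs hpos symp oA su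
  def_dom_wreg def_locE).
Qed.

Lemma div_J_mean_curvatureE x : A x ->
  div_J_mean_curvature K c e (deformation Psi phi ^~ t) x = local_div x.
Proof.
move=> Ax; apply: divergence_near; first exact: open_near oA Ax (fun y _ => erefl).
apply: open_near oA Ax _ => y Ay; apply: tangential_mean_curvature; first exact: def_isotropic.
by apply: loc_acs_metric => //; exact: def_loc_cimg.
Qed.

Lemma div_J_tensionE x : A x ->
  div_J_tension K c e (deformation Psi phi ^~ t) x = local_div x.
Proof.
move=> Ax; apply: divergence_near; first exact: open_near oA Ax (fun y _ => erefl).
apply: open_near oA Ax _ => y Ay; apply: tangential_tension; last 2 first.
- exact: def_isotropic.
- by apply: loc_acs_metric => //; exact: def_loc_cimg.
- exact: smooth_differentiable def_smooth Ay.
Qed.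

End Local.

Lemma def_metric_ambient c e e' t x : atlas c -> atlas e -> atlas e' -> 0 <= t < delta ->
  def_dom c e t x -> def_dom c e' t x ->
  induced_metric (loc_metric K e') (def_loc c e' t) x =
    induced_metric (loc_metric K e) (def_loc c e t) x /\
  local_div c e' t x = local_div c e t x.
Proof.
move=> ac ae ae' td Ax Ax'.
pose A := def_dom c e t `&` def_dom c e' t.
have oA : open A by apply: openI; exact: open_def_dom.
have AA : A x by [].
have FB y : A y -> trans_dom e e' (def_loc c e t y).
  move=> [[cy ey] [_ e'y]]; split; first exact: def_loc_cimg.
  by rewrite cfunK.
have F'E y : A y -> def_loc c e' t y = trans e e' (def_loc c e t y).
  by move=> [[cy ey] _]; rewrite /def_loc /loc /trans /= cfunK.
have sF : smooth_on A (def_loc c e t).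
  by apply: smooth_sub (def_smooth ac ae td) => y [].
have oB := open_trans_dom ae ae'.
have img y : trans_dom e e' y -> cimg e' (trans e e' y).
  by move=> /(trans_dom_sym ae ae')[].
have dh' y (By : trans_dom e e' y) :=
  smooth_differentiable (smooth_loc_metric K ae') (img y By).
have h's y (_ : trans_dom e e' y) := loc_metric_sym K e' (trans e e' y).
have h'u y (By : trans_dom e e' y) := loc_metric_unit ae' (img y By).
have hE y (By : trans_dom e e' y) := form_in_trans (metric K) ae ae' By.
have omE y (By : trans_dom e e' y) := form_in_trans (omega K) ae ae' By.
have Tu y (By : trans_dom e e' y) := trans_unit ae ae' By.
have sT := smooth_trans ae ae'.
have gE y (Ay : A y) : induced_metric (loc_metric K e') (def_loc c e' t) y =
    induced_metric (loc_metric K e) (def_loc c e t) y.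
  exact: (induced_metric_ambient oA sF sT FB F'E hE Ay).
split; first exact: gE.
apply: divergence_near; apply: (open_near oA AA); first exact: gE.
move=> y Ay; exact: (mcfield_ambient oA oB sF sT FB F'E Tu dh' h's h'u hE omE Ay).
Qed.

Lemma local_div_source c c' e t x : atlas c -> atlas c' -> atlas e -> 0 <= t < delta ->
  def_dom c e t x -> trans_dom c c' x ->
  local_div c e t x = local_div c' e t (trans c c' x).
Proof.
move=> ac ac' ae td Ax dx.
pose A := def_dom c e t `&` trans_dom c c'.
have oA : open A by apply: openI; [exact: open_def_dom|exact: open_trans_dom].
have oA' := open_def_dom ac' ae td.
have ss : smooth_on A (trans c c') by apply: smooth_sub (smooth_trans ac ac') => y [].
have sA y : A y -> def_dom c' e t (trans c c' y).
  move=> [[cy ey] dy]; split; last by rewrite cinv_trans.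
  by have [] := trans_dom_sym ac ac' dy.
have su y (Ay : A y) := trans_unit ac ac' Ay.2.
have sF' := def_smooth ac' ae td.
have FE y : A y -> def_loc c e t y = def_loc c' e t (trans c c' y).
  move=> [_ dy]; rewrite /def_loc /loc /= -[cinv c' _]/(cinv c' (trans c c' y)).
  by rewrite cinv_trans.
have lagr := @def_isotropic c' e t ac' ae td.
have gu := @def_metric_unit c' e t ac' ae td.
have gE := induced_metric_source (loc_metric K e) oA ss sA sF' FE.
have XE := mcfield_source oA ss sA su sF' FE lagr gu.
apply: (divergence_source oA oA' ss sA su (@def_metric_differentiable c' e t ac' ae td)
  (@def_metric_sym c' e t ac' ae td) gu gE _ (@def_mcfield_differentiable c' e t ac' ae td) XE).
- by move=> y [Ay _]; exact: def_mcfield_differentiable.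
- by [].
Qed.

(** The charts are changed one at a time, through the mixed pair [c], [e']: both charts of [M]
    contain the same image point, so [x] lies in the mixed domain as well. *)
Lemma local_div_invariant c c' e e' x x' t : atlas c -> atlas c' -> atlas e -> atlas e' ->
  0 <= t < delta -> def_dom c e t x -> def_dom c' e' t x' -> cinv c x = cinv c' x' ->
  local_div c e t x = local_div c' e' t x'.
Proof.
move=> ac ac' ae ae' td [cx ex] [c'x' e'x'] xx'.
have Ax : def_dom c e t x by [].
have Ax1 : def_dom c e' t x by split=> //; rewrite xx'.
have [_ <-] := def_metric_ambient ac ae ae' td Ax Ax1.
have dx : trans_dom c c' x by split=> //; rewrite xx'; exact: cimg_dom.
rewrite (local_div_source ac ac' ae' td Ax1 dx); congr (local_div _ _ _ _).
by rewrite /trans /= xx' cinvK.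
Qed.

End CotangentModel.

(** * Extension across the initial time and the flow equation *)

Lemma differentiable_fst {R : realType} {V W : normedModType R} (z : V * W) :
  differentiable (fst : V * W -> V) z.
Proof.
have c : continuous (linear_of (@fst_is_linear R V W)) by move=> x; exact: cvg_fst.
exact: linear_differentiable c.
Qed.

Lemma derive_fst {R : realType} {V W : normedModType R} (z v : V * W) :
  'D_v (fst : V * W -> V) z = v.1.
Proof.
have c : continuous (linear_of (@fst_is_linear R V W)) by move=> x; exact: cvg_fst.
exact: linear_derive z v c.
Qed.

Section Flow.
Context {R : realType} {n m : nat} {L : manifold R n} {M : manifold R m}.
Variables (K : almost_kahler M) (iota : L -> M) (Psi : weinstein_map K iota).
Variables (delta : R) (phi : L -> R -> R).
Hypotheses (sphi : smooth_strip delta phi)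
  (phiW : forall p t, 0 <= t < delta -> wdom Psi (differential (phi^~ t) p)).

Let F p t := deformation Psi phi p t.

Definition slice_grad (f : 'rV[R]_n * R -> R) (z : 'rV[R]_n * R) : 'rV[R]_n :=
  grad (fun y => f (y, z.2)) z.1.

Section Extension.
Variables (c : chart R n L) (e : chart R m M) (ac : atlas c) (ae : atlas e).

(** The extension [f] lives on an open set and hence, near time 0, also at negative times. Its
    gradient agrees with that of [phi] at the given point, so after shrinking, the graph of its
    gradient stays in the open set where [wpsi] is defined and symplectic. *)
Lemma local_extension x0 t0 : 0 <= t0 < delta -> def_dom Psi phi c e t0 x0 ->
  exists (B : set ('rV[R]_n * R)) f, [/\ open B, B (x0, t0), smooth_on B f,
    forall z, B z -> wreg Psi c e (z.1, slice_grad f z) &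
    forall x t, B (x, t) -> cimg c x /\ (0 <= t < delta -> phi (cinv c x) t = f (x, t))].
Proof.
move=> t0d [cx0 ex0].
have [B0 [f [oB0 B0x sf fE]]] := sphi ac cx0 t0d.
pose B1 : set ('rV[R]_n * R) := [set z | B0 z /\ cimg c z.1].
have oB1 : open B1.
  by apply: open_setI_preimage oB0 _ (open_cimg ac) => z _; exact: cvg_fst.
have sf1 : smooth_on B1 f by apply: smooth_sub sf => z [].
have sg : smooth_on B1 (slice_grad f).
  apply: (smooth_mx oB1) => i j; under eq_fun do rewrite mxE.
  exact: (smooth_pd_slice oB1).
have dg z : B1 z -> {for z, continuous (fun z => (z.1, slice_grad f z))}.
  move=> Bz; apply: differentiable_continuous; apply: differentiable_pair.
    exact: differentiable_fst.
  exact: smooth_differentiable sg Bz.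
exists [set z | B1 z /\ wreg Psi c e (z.1, slice_grad f z)], f.
have gE : slice_grad f (x0, t0) = grad (chart_fun phi c t0) x0.
  apply/rowP => i; rewrite !mxE; apply: near_eq_derive => /=.
  have oU : open [set y | cimg c y /\ B0 (y, t0)].
    apply: open_setI_preimage (open_cimg ac) _ oB0 => y cy.
    exact: differentiable_continuous (smooth_differentiable (smooth_slice_map t0 (open_cimg ac)) cy).
  by apply: (open_near oU) => // y [cy By]; rewrite -fE.
split.
- exact: (open_setI_preimage oB1 dg (open_wreg (Psi := Psi) ac ae)).
- split=> //; rewrite gE.
  exact: (def_dom_wreg sphi phiW ac t0d (conj cx0 ex0 : def_dom Psi phi c e t0 x0)).
- by apply: smooth_sub sf => z [[]].
- by move=> z [].
- by move=> x t [[B0z cx] _]; split=> // td; exact: fE.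
Qed.

Variables (B : set ('rV[R]_n * R)) (f : 'rV[R]_n * R -> R).
Hypotheses (oB : open B) (sf : smooth_on B f).
Hypotheses (fW : forall z, B z -> wreg Psi c e (z.1, slice_grad f z)).
Hypotheses (fE : forall x t, B (x, t) -> cimg c x /\
  (0 <= t < delta -> phi (cinv c x) t = f (x, t))).

Let h := loc_metric K e.
Let om := loc_omega K e.
Let Fh (z : 'rV[R]_n * R) : 'rV[R]_m := wpsi Psi c e (z.1, slice_grad f z).
Let Fs (t : R) (x : 'rV[R]_n) : 'rV[R]_m := Fh (x, t).
Let slice t : set 'rV[R]_n := [set y | B (y, t)].

Let open_slice t : open (slice t).
Proof.
have -> : slice t = [set y | setT y /\ B (y, t)] by apply/seteqP; split=> y // [].
apply: open_setI_preimage openT _ oB => y _.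
exact: differentiable_continuous (smooth_differentiable (smooth_slice_map t openT) I).
Qed.

Let smooth_slice_f t : smooth_on (slice t) (fun y => f (y, t)).
Proof. by apply: (smooth_slice_scalar (@open_slice t) sf). Qed.

Let sliceW t x : slice t x -> wreg Psi c e (x, grad (fun y => f (y, t)) x).
Proof. exact: fW. Qed.

Let slice_near t x : slice t x -> \forall s \near t, B (x, s).
Proof.
move=> Bx.
have ct : {for t, continuous (fun s : R => (x, s))}.
  by apply: differentiable_continuous; exact: differentiable_pair.
by apply: (ct B); exact: open_nbhs_nbhs.
Qed.

Let grad_phi t x : 0 <= t < delta -> slice t x ->
  grad (chart_fun phi c t) x = grad (fun y => f (y, t)) x.
Proof.
move=> td Bx; apply/rowP => i; rewrite !mxE; apply: near_eq_derive.
by apply: (open_near (@open_slice t) Bx) => y /fE[_ <-].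
Qed.

Lemma slice_dom t x : 0 <= t < delta -> slice t x -> def_dom Psi phi c e t x.
Proof.
move=> td Bx; have [cx _] := fE Bx; split=> //.
rewrite (deformation_chart Psi sphi)// grad_phi//.
by have [] := fW Bx.
Qed.

Let def_loc_slice t x : 0 <= t < delta -> slice t x ->
  def_loc Psi phi c e t x = wpsi Psi c e (x, grad (fun y => f (y, t)) x).
Proof.
move=> td Bx; rewrite (def_locE sphi ac td (slice_dom td Bx)).
by rewrite grad_phi.
Qed.

Let spsi := smooth_wpsi Psi ac ae.
Let psiB := @wpsi_cimg _ _ _ _ _ _ _ Psi c e.
Let symp := wpsi_symplectic (Psi := Psi) ac ae.
Let hpos := @loc_metric_pos _ _ _ K e ae.

Definition div_extension (z : 'rV[R]_n * R) : R :=
  divergence (induced_metric h (Fs z.2)) (mcfield h om (Fs z.2)) z.1.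

Lemma smooth_div_extension : smooth_on B div_extension.
Proof.
have sFh : smooth_on B Fh.
  apply: (@smooth_comp_mx _ _ _ oB _ _ _ (wreg Psi c e) (wpsi Psi c e)
    (fun z => (z.1, slice_grad f z))) => //.
  - exact: findim_base.
  - exact: open_wreg.
  apply: (smooth_pair oB).
    apply: (smooth_linear oB (l := linear_of (@fst_is_linear R 'rV[R]_n R))).
    by move=> z; exact: cvg_fst.
  apply: (smooth_mx oB) => i j; under eq_fun do rewrite mxE.
  exact: (smooth_pd_slice oB).
have FB z : B z -> cimg e (Fh z) by move=> Bz; apply: psiB; exact: fW.
have gu z : B z -> induced_metric h (fun y => Fh (y, z.2)) z.1 \in unitmx.
  case: z => x t Bz.
  exact: (induced_metric_unit spsi psiB hpos symp (@open_slice t) (@smooth_slice_f t)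
    (@sliceW t) (fun _ _ => erefl) Bz).
exact: (smooth_family_divergence oB (open_cimg ae) (smooth_loc_metric K ae)
  (smooth_loc_omega K ae) (loc_metric_unit K ae) sFh FB gu).
Qed.

Lemma div_extensionE x t : B (x, t) -> 0 <= t < delta ->
  div_extension (x, t) = local_div Psi phi c e t x.
Proof.
move=> Bx td.
apply: divergence_near; apply: (open_near (@open_slice t) Bx) => y By.
  apply: etrans (induced_metric_jet h spsi (@open_slice t) (@smooth_slice_f t)
    (@sliceW t) (fun _ _ => erefl) By) (esym _).
  exact: (induced_metric_jet h spsi (@open_slice t) (@smooth_slice_f t)
    (@sliceW t) (fun x => def_loc_slice td (x := x)) By).
apply: etrans (mcfield_jet h spsi symp (@open_slice t) (@smooth_slice_f t)
    (@sliceW t) (fun _ _ => erefl) By) (esym _).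
exact: (mcfield_jet h spsi symp (@open_slice t) (@smooth_slice_f t)
    (@sliceW t) (fun x => def_loc_slice td (x := x)) By).
Qed.

Lemma dt_phi x t : B (x, t) -> 0 <= t < delta ->
  dt delta (phi (cinv c x)) t = 'D_(0, 1) f (x, t).
Proof.
move=> Bx td; have df := smooth_differentiable sf Bx.
have dfx : differentiable (fun s => f (x, s)) t.
  by apply: (@differentiable_comp _ _ _ _ (fun s => (x, s)) f) => //; exact: differentiable_pair.
rewrite -(derive_time df) /=; apply: dt_eq => //; last exact: diff_derivable.
by apply: filterS (slice_near Bx) => s /fE[].
Qed.

Hypothesis flow : flow_equation K delta (deformation Psi phi).

Lemma flow_gradient x t i : B (x, t) -> 0 <= t < delta ->
  pd i (fun y => 'D_(0, 1) f (y, t)) x = pd i (fun y => div_extension (y, t)) x.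
Proof.
move=> Bx td; have Ax := slice_dom td Bx; have [cx ex] := Ax.
have sg : smooth_on B (slice_grad f).
  apply: (smooth_mx oB) => k j; under eq_fun do rewrite mxE.
  exact: (smooth_pd_slice oB).
have dg := smooth_differentiable sg Bx.
have dfst : differentiable (fst : 'rV[R]_n * R -> 'rV[R]_n) (x, t).
  exact: differentiable_fst.
have dbase : differentiable (fun z => (z.1, slice_grad f z)) (x, t) by exact: differentiable_pair.
have dpsi : differentiable (wpsi Psi c e) (x, slice_grad f (x, t)).
  exact: smooth_differentiable spsi (fW Bx).
have dFh : differentiable Fh (x, t).
  exact: (@differentiable_comp _ _ _ _ (fun z => (z.1, slice_grad f z)) (wpsi Psi c e)).
pose w := 'D_(0, 1) Fh (x, t).
pose g' := 'D_(0, 1) (slice_grad f) (x, t).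
(* The base point [x] does not move, so the velocity in the coordinates of the cotangent bundle is
   purely vertical. *)
have wE : w = 'D_(0, g') (wpsi Psi c e) (x, slice_grad f (x, t)).
  apply: etrans (derive_comp _ dbase dpsi) _.
  apply: (congr1 (fun v => 'D_v (wpsi Psi c e) (x, slice_grad f (x, t)))).
  apply: etrans (derive_pair _ dfst dg) (congr1 (fun a => (a, g')) _).
  exact: derive_fst.
have dtE : dt delta (fun s => cfun e (F (cinv c x) s)) t = w.
  have dx : differentiable (fun s : R => (x, s)) t by exact: differentiable_pair.
  have dFx : differentiable (fun s => Fh (x, s)) t.
    exact: (@differentiable_comp _ _ _ _ (fun s => (x, s)) Fh _ dx dFh).
  apply: etrans (_ : 'D_1 (fun s => Fh (x, s)) t = _); last exact: derive_time dFh.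
  apply: (dt_eq td _ (diff_derivable dFx)).
  apply: filterS (slice_near Bx) => s Bs sd.
  by rewrite /F (deformation_chart Psi sphi ac cx sd) (grad_phi sd Bs).
have isot := def_isotropic sphi phiW ac ae td Ax.
have JFE := jacobian_jet spsi (@open_slice t) (@smooth_slice_f t) (@sliceW t)
  (fun x => def_loc_slice td (x := x)) Bx.
have FxE := def_loc_slice td Bx.
have pairing : w *m om (def_loc Psi phi c e t x) *m ('J (def_loc Psi phi c e t) x)^T = - g'.
  apply/rowP => p; rewrite JFE FxE wE.
  have := symp (0, g') (delta_mx 0 p, delta_mx 0 p *m hessian (fun y => f (y, t)) x) (fW Bx).
  rewrite -(jet_jacobian_mul spsi (jt := jet2 (fun y => f (y, t)) x) _ (fW Bx)).
  rewrite /bilin trmx_mul mulmxA trmx_delta -colE [X in X = _]mxE => ->.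
  by rewrite /can_form /= mul0mx [X in X - _]mxE sub0r trmx_delta -colE !mxE.
have Fy := def_loc_cimg sphi phiW ac td Ax.
have gu := def_metric_unit sphi phiW ac ae td Ax.
have := flow ac ae cx td ex; rewrite /= -/(F _) dtE.
move/(congr1 (fun v => v *m om (def_loc Psi phi c e t x) *m ('J (def_loc Psi phi c e t) x)^T)).
(* The normal projection changes [w] by a tangent vector, which pairs to zero with tangent vectors
   by isotropy. *)
have -> : normal_part (loc_metric K e) (loc c e (fun p => F p t)) x w *m
   om (def_loc Psi phi c e t x) *m ('J (def_loc Psi phi c e t) x)^T = - g'.
  rewrite /normal_part !mulmxBl pairing -[X in _ - X]mulmxA -[X in _ - X]mulmxA.
  by rewrite [X in _ - _ *m X]mulmxA isot mulmx0 subr0.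
set N := gradient _ _ _; set JF := 'J (def_loc Psi phi c e t) x.
(* [J om = J J h = - h], so the right side is minus the metric applied to the gradient. This sign
   cancels the one from the vertical pairing. *)
have -> : N *m JF *m loc_acs K e (def_loc Psi phi c e t x) *m om (def_loc Psi phi c e t x) *m JF^T
   = - (N *m induced_metric h (def_loc Psi phi c e t) x).
  rewrite -(mulmxA (N *m JF)) /om -(loc_acs_metric K ae Fy) (mulmxA (loc_acs _ _ _)).
  rewrite (loc_acs_sqr K ae Fy) mulNmx mul1mx mulmxN mulNmx; congr (- _).
  by rewrite /induced_metric !mulmxA.
rewrite /N /gradient (mulmxKV gu) => /oppr_inj /rowP /(_ i); rewrite [RHS]mxE => g'i.
(* Exchange of time and space derivatives, legitimate also at time 0 because [f] is smooth on an
   open set. *)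
have -> : pd i (fun y => 'D_(0, 1) f (y, t)) x = g' 0 i.
  have sDf v : smooth_on B ('D_v f) by exact: smooth_derive.
  apply: etrans (pd_slice _ (smooth_differentiable (sDf _) Bx)) _.
  rewrite (derive_commutes oB _ _ sf Bx) /g' (derive_coord _ _ _ dg).
  apply: near_eq_derive; apply: (open_near oB Bx) => z Bz.
  apply/esym; apply: etrans (mxE _ _ _ _) _.
  exact: (pd_slice _ (smooth_differentiable sf Bz)).
rewrite g'i; apply: near_eq_derive; apply: (open_near (@open_slice t) Bx) => y By.
apply: etrans (esym (div_extensionE By td)).
exact: (div_J_mean_curvatureE sphi phiW ac ae td (slice_dom td By)).
Qed.

End Extension.
End Flow.

(** * Normalization of the potential *)

Section Normalization.
Context {R : realType} {n m : nat} {L : manifold R n} {M : manifold R m}.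
Variables (K : almost_kahler M) (iota : L -> M) (Psi : weinstein_map K iota).
Variables (delta : R) (phi : L -> R -> R).
Hypotheses (sphi : smooth_strip delta phi)
  (phiW : forall p t, 0 <= t < delta -> wdom Psi (differential (phi^~ t) p)).

Let F p t := deformation Psi phi p t.

(** Evaluating in the preferred charts makes this a function of the point and the time alone, even
    while the deformed point wanders through several charts of [M]. By [speed_defectE] any other
    charts give the same value. *)
Definition speed_defect (p : L) (t : R) : R :=
  div_J_tension K (chart_at p) (chart_at (deformation Psi phi p t))
    (deformation Psi phi ^~ t) (cfun (chart_at p) p) - dt delta (phi p) t.

Lemma speed_defectE c e x t : atlas c -> atlas e -> 0 <= t < delta ->
  def_dom Psi phi c e t x ->
  speed_defect (cinv c x) t = local_div Psi phi c e t x - dt delta (phi (cinv c x)) t.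
Proof.
move=> ac ae td Ax; rewrite /speed_defect; set p := cinv c x.
set c0 := chart_at p; set e0 := chart_at _.
have ac0 : atlas c0 by exact: chart_at_atlas.
have ae0 : atlas e0 by exact: chart_at_atlas.
have pK : cinv c0 (cfun c0 p) = p by apply: cfunK => //; exact: chart_at_dom.
have Ax0 : def_dom Psi phi c0 e0 t (cfun c0 p).
  split; first by exists p => //; exact: chart_at_dom.
  by rewrite pK; exact: chart_at_dom.
apply: (congr1 (fun z => z - _)).
apply: etrans (div_J_tensionE sphi phiW ac0 ae0 td Ax0) (esym _).
by apply: (local_div_invariant sphi phiW ac ac0 ae ae0 td Ax Ax0); rewrite pK.
Qed.

Hypothesis flow : flow_equation K delta (deformation Psi phi).

Lemma speed_defect_local c x0 t0 : atlas c -> cimg c x0 -> 0 <= t0 < delta ->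
  exists (B : set ('rV[R]_n * R)) k, [/\ open B, B (x0, t0), smooth_on B k &
    forall x t, B (x, t) -> 0 <= t < delta ->
      speed_defect (cinv c x) t = k (x, t) /\
      forall i, pd i (fun y => k (y, t)) x = 0].
Proof.
move=> ac cx td0; set e := chart_at (F (cinv c x0) t0).
have ae : atlas e by exact: chart_at_atlas.
have Ax0 : def_dom Psi phi c e t0 x0 by split=> //; exact: chart_at_dom.
have [B [f [oB B0 sf fW fE]]] := local_extension sphi phiW ac ae td0 Ax0.
have sD : smooth_on B (div_extension Psi c e f) := smooth_div_extension ac ae oB sf fW.
have sT : smooth_on B ('D_(0, 1) f) by exact: smooth_derive.
have sk : smooth_on B (fun z => div_extension Psi c e f z - 'D_(0, 1) f z).
  by apply: (smooth_add oB) => //; exact: smooth_opp.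
exists B, (fun z => div_extension Psi c e f z - 'D_(0, 1) f z); split=> // x t Bx td.
have dom : def_dom Psi phi c e t x by exact: (slice_dom sphi ac oB fW fE td Bx).
split.
  rewrite (speed_defectE ac ae td dom) (dt_phi oB sf fE Bx td).
  by rewrite (div_extensionE sphi ac ae oB sf fW fE Bx td).
move=> i; have dx : differentiable (fun y : 'rV[R]_n => (y, t)) x by exact: differentiable_pair.
have d1 : differentiable (fun y => div_extension Psi c e f (y, t)) x.
  exact: (@differentiable_comp _ _ _ _ (fun y => (y, t)) (div_extension Psi c e f) _ dx
    (smooth_differentiable sD Bx)).
have d2 : differentiable (fun y => 'D_(0, 1) f (y, t)) x.
  exact: (@differentiable_comp _ _ _ _ (fun y => (y, t)) ('D_(0, 1) f) _ dx
    (smooth_differentiable sT Bx)).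
apply: etrans (derive_sub_fun _ d1 d2) _; apply/eqP; rewrite subr_eq0; apply/eqP/esym.
exact: (flow_gradient sphi phiW ac ae oB sf fW fE flow i Bx td).
Qed.

(** The ball depends only on the chart of [L] and works for all times at once. The neighbourhoods
    supplied by [speed_defect_local] may shrink as [t] varies, but they only serve to show that the
    space differential vanishes at each point. This uniformity is what makes the time integral
    locally constant in space. *)
Lemma speed_defect_ball c x0 r t : atlas c -> (forall x, ball x0 r x -> cimg c x) ->
  0 <= t < delta -> forall x, ball x0 r x ->
  speed_defect (cinv c x) t = speed_defect (cinv c x0) t.
Proof.
move=> ac sub td.
apply: (@eq_on_ball _ _ (fun x => speed_defect (cinv c x) t) x0 r) => y By.
have [B [k [oB B0 sk kE]]] := speed_defect_local ac (sub y By) td.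
have cs : {for y, continuous (fun x : 'rV[R]_n => (x, t))}.
  by apply: differentiable_continuous; exact: differentiable_pair.
have near_k : \forall x \near y, k (x, t) = speed_defect (cinv c x) t.
  have nB : nbhs (y, t) B by exact: open_nbhs_nbhs.
  have nc : nbhs y [set x | B (x, t)] by exact: (cs B nB).
  by apply: filterS nc => x Bx; have [->] := kE x t Bx td.
have dk : differentiable (fun x => k (x, t)) y.
  apply: (@differentiable_comp _ _ _ _ (fun x => (x, t)) k); first exact: differentiable_pair.
  exact: smooth_differentiable sk B0.
have dg := near_eq_differentiable near_k dk.
split=> // v; rewrite -deriveE// (derive_basis _ dg) big1// => i _.
have [_ /(_ i) k0] := kE y t B0 td.
have -> : pd i (fun x => speed_defect (cinv c x) t) y = 0.
  by rewrite -k0; apply/esym/near_eq_derive.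
by rewrite scaler0.
Qed.

(** The maximum of [s] and 0, written with the norm so that continuity is immediate. *)
Definition pospart (s : R) : R := (s + `|s|) / 2.

Lemma pospart_ge0 s : 0 <= pospart s.
Proof. by rewrite divr_ge0// -lerBlDl sub0r ler_normr lexx orbT. Qed.

Lemma pospart_id s : 0 <= s -> pospart s = s.
Proof. by move=> s0; rewrite /pospart ger0_norm//; field. Qed.

Lemma pospart_lt s : 0 < delta -> s < delta -> pospart s < delta.
Proof.
move=> d0 sd; have [s0|s0] := leP 0 s; first by rewrite pospart_id.
by rewrite /pospart ltr0_norm// subrr mul0r.
Qed.

Lemma pospart_continuous : continuous pospart.
Proof. by move=> s; apply: cvgMl; apply: cvgD; [exact: cvg_id|exact: norm_continuous]. Qed.

(* Extended constantly to negative times so that its primitive is differentiable at 0 *)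
Definition defect_ext (p : L) (s : R) : R :=
  if pospart s < delta then speed_defect p (pospart s) else 0.

Hypothesis d0 : 0 < delta.

Lemma defect_extE p t : 0 <= t < delta -> defect_ext p t = speed_defect p t.
Proof. by move=> /andP[t0 td]; rewrite /defect_ext pospart_id// td. Qed.

(** Near [s] the extended defect is a smooth local representative composed with the continuous map
    [pospart]; this covers negative times and time 0 together. *)
Lemma defect_ext_continuous p s : s < delta -> {for s, continuous (defect_ext p)}.
Proof.
move=> sd; set c := chart_at p.
have ac : atlas c by exact: chart_at_atlas.
have cp : cdom c p by exact: chart_at_dom.
have cx : cimg c (cfun c p) by exists p.
have td : 0 <= pospart s < delta by rewrite pospart_ge0 pospart_lt.
have [B [k [oB B0 sk kE]]] := speed_defect_local ac cx td.
have cg : {for s, continuous (fun r => (cfun c p, pospart r))}.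
  apply: (@continuous_comp _ _ _ pospart (fun r : R => (cfun c p, r))).
    exact: pospart_continuous.
  by apply: differentiable_continuous; exact: differentiable_pair.
have ck : {for s, continuous (fun r => k (cfun c p, pospart r))}.
  apply: (@continuous_comp _ _ _ (fun r => (cfun c p, pospart r)) k) => //.
  exact: differentiable_continuous (smooth_differentiable sk B0).
have near_k : \forall r \near s, k (cfun c p, pospart r) = defect_ext p r.
  have nB : nbhs (cfun c p, pospart s) B by exact: open_nbhs_nbhs.
  have nd : \forall r \near s, r < delta by exact: lt_nbhsl.
  have nc : nbhs s [set r | B (cfun c p, pospart r)] by exact: (cg B nB).
  apply: filterS2 nc nd => r Br rd.
  have rd' : 0 <= pospart r < delta by rewrite pospart_ge0 pospart_lt.
  have [<- _] := kE _ _ Br rd'.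
  by rewrite cfunK// /defect_ext pospart_lt.
have eqs := nbhs_singleton near_k.
have : defect_ext p @ s --> k (cfun c p, pospart s) by apply: cvg_trans ck; exact: near_eq_cvg.
by rewrite eqs.
Qed.

(** Any negative base point would do in place of -1: it makes 0 an interior point for the
    fundamental theorem of calculus. Subtracting the value at 0 preserves the initial condition. *)
Definition correction (p : L) (t : R) : R :=
  primitive (-1) (defect_ext p) t - primitive (-1) (defect_ext p) 0.

Lemma is_derive_correction p t : 0 <= t < delta ->
  is_derive t 1 (correction p) (speed_defect p t).
Proof.
move=> td; rewrite -(defect_extE p td).
have dP : is_derive t 1 (primitive (-1) (defect_ext p)) (defect_ext p t).
  apply: (@is_derive_primitive _ _ delta) => [x /andP[_ xd]|].
    exact: defect_ext_continuous.
  by case/andP: td => t0 ->; rewrite (lt_le_trans _ t0)// ltrN10.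
have := is_deriveB dP (is_derive_cst (primitive (-1) (defect_ext p) 0) t 1).
by rewrite subr0.
Qed.

Lemma correction_ball c x0 r x : atlas c -> (forall x, ball x0 r x -> cimg c x) ->
  ball x0 r x -> correction (cinv c x) = correction (cinv c x0).
Proof.
move=> ac sub Bx; rewrite /correction; suff -> : defect_ext (cinv c x) = defect_ext (cinv c x0) by [].
apply/funext => s; rewrite /defect_ext; case: ifPn => // sd.
by apply: (speed_defect_ball ac sub) => //; rewrite pospart_ge0.
Qed.

(** The constant extension of the defect is in general only continuous at 0, so [correction] itself
    need not be smooth across 0. The smooth function [q] is a primitive of a smooth local
    representative of the defect; it has the same derivative at the admissible times and the same
    value at [t0]. *)
Lemma correction_local p t0 : 0 <= t0 < delta -> exists (I : set R) q,
  [/\ open I, I t0, smooth_on I q & forall t, I t -> 0 <= t < delta -> correction p t = q t].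
Proof.
move=> td0; set c := chart_at p.
have ac : atlas c by exact: chart_at_atlas.
have cp : cdom c p by exact: chart_at_dom.
have cx : cimg c (cfun c p) by exists p.
set x := cfun c p.
have [B [k [oB B0 sk kE]]] := speed_defect_local ac cx td0.
have cs (t : R) : {for t, continuous (fun s : R => (x, s))}.
  by apply: differentiable_continuous; exact: differentiable_pair.
have nB : nbhs (x, t0) B by exact: open_nbhs_nbhs.
have /nbhs_ballP[r /= r0 rB] : nbhs t0 [set s | B (x, s)] by exact: (cs t0 B nB).
(* The base point [a] of the primitive must itself lie where [k] is defined, hence half the radius
   on the left; the end [b] is excluded and may lie on the boundary. *)
pose a := t0 - r / 2; pose b := t0 + r.
have inB s : a <= s < b -> B (x, s).
  move=> /andP[las lsb]; apply: rB; rewrite /ball /= ltr_distl; apply/andP; split.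
    by rewrite /b in lsb; rewrite ltrBlDr -ltrBlDl ltrBlDr; move: lsb; rewrite addrC; lra.
  by move: las; rewrite /a; lra.
pose I : set R := [set s | a < s /\ s < b].
have oI : open I.
  have -> : I = `]a, b[%classic by apply/seteqP; split=> s /=; rewrite in_itv /= => /andP.
  exact: interval_open.
have It0 : I t0 by rewrite /I /a /b /=; split; lra.
have IB s : I s -> B (x, s) by move=> [las lsb]; apply: inB; rewrite ltW.
pose kx s := k (x, s).
have ckx s : a <= s < b -> {for s, continuous kx}.
  move=> sab; apply: (@continuous_comp _ _ _ (fun s => (x, s)) k); first exact: cs.
  exact: differentiable_continuous (smooth_differentiable sk (inB s sab)).
have skx : smooth_on I kx.
  apply: (@smooth_comp _ _ _ oI _ B k (fun s => (x, s))) => //; first exact: findim_strip.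
  apply: (smooth_pair oI); first exact: smooth_cst.
  by apply: (smooth_linear oI (l := idfun)) => s; exact: cvg_id.
pose q s := primitive a kx s - primitive a kx t0 + correction p t0.
have dq s : I s -> is_derive s 1 q (kx s).
  move=> [las lsb].
  have dP : is_derive s 1 (primitive a kx) (kx s).
    by apply: (@is_derive_primitive _ _ b) => //; rewrite las.
  have := is_deriveD (is_deriveB dP (is_derive_cst (primitive a kx t0) s 1))
    (is_derive_cst (correction p t0) s 1).
  by rewrite subr0 addr0.
exists I, q; split=> //; first exact: (smooth_of_derive oI dq skx).
have dd s : I s -> 0 <= s < delta -> is_derive s 1 (correction p - q) 0.
  move=> Is sd; have := is_deriveB (is_derive_correction p sd) (dq s Is).
  have [kxE _] := kE x s (IB s Is) sd.
  by rewrite -[p](cfunK ac cp) kxE subrr.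
have qt0 : (correction p - q) t0 = 0 by rewrite /q !fctE; lra.
move=> t It td; apply/eqP; rewrite -subr_eq0 -[X in X == _]/((correction p - q) t) -qt0.
apply/eqP; case/andP: td => t_ge0 t_lt; case/andP: td0 => t0_ge0 t0_lt.
case: It => at_ tb; case: It0 => at0 t0b.
have [tt0|/ltW tt0] := leP t t0.
  by apply: eq_of_derive0 => // z /andP[z1 z2]; apply: dd; [split|apply/andP; split]; lra.
by apply/esym/eq_of_derive0 => // z /andP[z1 z2]; apply: dd; [split|apply/andP; split]; lra.
Qed.

Definition normalized (p : L) (t : R) : R := phi p t + correction p t.

Lemma cimg_ball (c : chart R n L) x : atlas c -> cimg c x ->
  exists2 r, 0 < r & forall y, ball x r y -> cimg c y.
Proof.
move=> ac cx; have nx : nbhs x (cimg c) by apply: open_nbhs_nbhs; split=> //; exact: open_cimg.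
by have [r r0 rB] := (nbhs_ballP _ _).1 nx; exists r.
Qed.

Lemma smooth_normalized : smooth_strip delta normalized.
Proof.
move=> c x0 t0 ac cx td0.
have [B [f [oB B0 sf fE]]] := sphi ac cx td0.
have [r r0 rB] := cimg_ball ac cx.
have [I [q [oI It0 sq qE]]] := correction_local (cinv c x0) td0.
(* On the ball the correction depends on the time alone, so the extension can use its values at the
   centre, represented by [q] on [I]. *)
pose B' : set ('rV[R]_n * R) := [set z | B z /\ (ball x0 r z.1 /\ I z.2)].
have oB' : open B'.
  have -> : B' = B `&` ([set z | setT z /\ (ball x0 r) z.1] `&` [set z | setT z /\ I z.2]).
    by apply/seteqP; split=> z /=; [move=> [? []]|move=> [? [[_ ?] [_ ?]]]].
  apply: openI => //; apply: openI; apply: open_setI_preimage openT _ _.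
  - by move=> z _; exact: cvg_fst.
  - exact: ball_open.
  - by move=> z _; exact: cvg_snd.
  - exact: oI.
exists B', (fun z => f z + q z.2); split=> //.
- by split=> //; split=> //; exact: ballxx.
- apply: (smooth_add oB'); first by apply: smooth_sub sf => z [].
  apply: (@smooth_comp _ _ _ oB' _ I q snd) => //; first exact: findim_scalar.
    apply: (smooth_linear oB' (l := linear_of (@snd_is_linear R 'rV[R]_n R))).
    by move=> z; exact: cvg_snd.
  by move=> z [_ []].
- move=> x t [Bx [bx It]] cx' td; rewrite /normalized fE//.
  by rewrite (correction_ball ac rB bx) qE.
Qed.

Lemma normalized0 p : phi p 0 = 0 -> normalized p 0 = 0.
Proof. by move=> p0; rewrite /normalized p0 /correction subrr addr0. Qed.

Lemma differential_normalized p t : 0 <= t < delta ->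
  differential (normalized^~ t) p = differential (phi^~ t) p.
Proof.
move=> td; rewrite /differential; apply: congr1; apply/rowP => i; rewrite !mxE.
set c := chart_at p; have ac : atlas c by exact: chart_at_atlas.
have cx : cimg c (cfun c p) by exists p => //; exact: chart_at_dom.
have [r r0 rB] := cimg_ball ac cx.
have du : differentiable ((phi^~ t) \o cinv c) (cfun c p).
  exact: smooth_differentiable (smooth_chart_fun sphi ac td) cx.
apply: etrans (_ : pd i (fun y => ((phi^~ t) \o cinv c) y +
    cst (correction (cinv c (cfun c p)) t) y) (cfun c p) = _).
  apply: near_eq_derive.
  have nb : nbhs (cfun c p) (ball (cfun c p) r) by exact: nbhsx_ballx.
  apply: filterS nb => y Bz.
  exact: (congr1 (fun g => phi (cinv c y) t + g t) (correction_ball ac rB Bz)).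
apply: etrans (derive_add_fun _ du (differentiable_cst _ _)) _.
by rewrite derive_cst addr0.
Qed.

Lemma dt_normalized p t : 0 <= t < delta ->
  dt delta (normalized p) t = dt delta (phi p) t + speed_defect p t.
Proof.
move=> td; set c := chart_at p; have ac : atlas c by exact: chart_at_atlas.
have cp : cdom c p by exact: chart_at_dom.
have cx : cimg c (cfun c p) by exists p.
have [B [f [oB B0 sf fE]]] := sphi ac cx td.
have dfx : differentiable (fun s => f (cfun c p, s)) t.
  apply: (@differentiable_comp _ _ _ _ (fun s => (cfun c p, s)) f); first exact: differentiable_pair.
  exact: smooth_differentiable sf B0.
have near_f : \forall s \near t, 0 <= s < delta -> phi p s = f (cfun c p, s).
  have cs : {for t, continuous (fun s : R => (cfun c p, s))}.
    by apply: differentiable_continuous; exact: differentiable_pair.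
  have nB : nbhs (cfun c p, t) B by exact: open_nbhs_nbhs.
  have nc : nbhs t [set s | B (cfun c p, s)] by exact: (cs B nB).
  by apply: filterS nc => s Bs sd; rewrite -[p in LHS](cfunK ac cp) fE.
have dK := is_derive_correction p td.
have dK' : differentiable (correction p) t by apply/derivable1_diffP; case: dK.
rewrite (dt_eq td near_f (diff_derivable dfx)).
have -> : speed_defect p t = 'D_1 (correction p) t by case: dK.
rewrite -(derive_add_fun _ dfx dK'); apply: (dt_eq td).
  by apply: filterS near_f => s fs sd; rewrite /normalized fs.
by apply: diff_derivable; exact: (differentiableD dfx dK').
Qed.

Lemma deformation_normalized t : 0 <= t < delta ->
  deformation Psi normalized ^~ t = deformation Psi phi ^~ t.
Proof. by move=> td; apply/funext => p; rewrite /deformation differential_normalized. Qed.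

Lemma dt_normalized_tension c e x t : atlas c -> atlas e -> cimg c x -> 0 <= t < delta ->
  cdom e (deformation Psi normalized (cinv c x) t) ->
  dt delta (normalized (cinv c x)) t =
  div_J_tension K c e (deformation Psi normalized ^~ t) x.
Proof.
move=> ac ae cx td; have E := deformation_normalized td.
rewrite -[deformation Psi normalized _ t]/((deformation Psi normalized ^~ t) _) E => ex.
have Ax : def_dom Psi phi c e t x by [].
rewrite dt_normalized// (speed_defectE ac ae td Ax) addrC subrK.
by rewrite (div_J_tensionE sphi phiW ac ae td Ax).
Qed.

End Normalization.

Theorem proposition3p1 (R : realType) (n : nat)
  (M : manifold R (2 * n)%N) (K : almost_kahler M)
  (L : manifold R n) (iota : L -> M)
  (L_compact : compact [set: L]) (L_embedded : embedding iota)
  (L_lagrangian : lagrangian K iota)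
  (Psi : weinstein_map K iota) :
  exists G : chart R n L -> 'rV[R]_n -> ('I_n -> R) -> ('I_n -> 'I_n -> R) ->
             ('I_n -> 'I_n -> 'I_n -> R) -> R,
  forall (delta : R) (phi : L -> R -> R), 0 < delta ->
    smooth_strip delta phi ->
    (forall p, phi p 0 = 0) ->
    (forall p t, 0 <= t < delta -> wdom Psi (differential (phi^~ t) p)) ->
    flow_equation K delta (deformation Psi phi) ->
  exists phi' : L -> R -> R,
    [/\ smooth_strip delta phi',
        forall p, phi' p 0 = 0,
        forall p t, 0 <= t < delta ->
          differential (phi'^~ t) p = differential (phi^~ t) p
      & forall c e x t, atlas c -> atlas e -> cimg c x -> 0 <= t < delta ->
          let F := deformation Psi phi' ^~ t in
          let u := fun y => phi' (cinv c y) t in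
          let ginv := invmx (induced_metric (loc_metric K e) (loc c e F) x) in
          cdom e (F (cinv c x)) ->
          dt delta (phi' (cinv c x)) t =
            - (\sum_a \sum_p \sum_i \sum_j
                 ginv a p * ginv i j * pd a (pd j (pd i (pd p u))) x)
            + G c x (fun i => pd i u x)
                    (fun i j => pd i (pd j u) x)
                    (fun i j k => pd i (pd j (pd k u)) x)
          /\
          dt delta (phi' (cinv c x)) t = div_J_tension K c e F x].
Proof.
(* The image point depends only on [x] and the first derivatives, so the preferred chart around it
   is available to [G] without reference to [phi], to [t] or to the chart [e] of the conclusion. *)
exists (fun c x p1 p2 p3 =>
  let e := chart_at (wfun Psi (cot_inv c (x, \row_i p1 i))) in
  lower_order_term (loc_metric K e) (loc_omega K e) (wpsi Psi c e)
    ((x, \row_i p1 i), \matrix_(i, j) p2 i j) p3).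
move=> delta phi d0 sphi phi0 phiW flow.
have sphi' := smooth_normalized sphi phiW flow d0.
have dphi' := differential_normalized sphi phiW flow.
have phiW' p t : 0 <= t < delta -> wdom Psi (differential ((normalized Psi delta phi)^~ t) p).
  by move=> td; rewrite dphi'//; exact: phiW.
exists (normalized Psi delta phi); split=> //; first by move=> p; exact: normalized0.
move=> c e x t ac ae cx td F u ginv ex.
have tens := dt_normalized_tension sphi phiW flow d0 ac ae cx td ex.
split; last exact: tens.
set e0 := chart_at (wfun Psi (cot_inv c (x, \row_i pd i u x))).
have ae0 : atlas e0 by exact: chart_at_atlas.
have Ax : def_dom Psi (normalized Psi delta phi) c e t x by [].
have Ax0 : def_dom Psi (normalized Psi delta phi) c e0 t x.
  by split=> //; rewrite (deformation_chart Psi sphi' ac cx td); exact: chart_at_dom.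
apply: etrans tens _; apply: etrans (div_J_tensionE sphi' phiW' ac ae td Ax) _.
(* Move from the given chart [e] to the chart [e0] used by [G]; the induced metric, and with it the
   leading term, is the same in both. *)
have [gE <-] := def_metric_ambient sphi' phiW' ac ae ae0 td Ax Ax0.
rewrite (local_div_expansion sphi' phiW' ac ae0 td Ax0) gE.
by [].
Qed.
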